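(* Let $(M,\mathscr{L})$ be a reversible Lagrangian system with $S=\mathrm{id}$, that is, $\mathscr{L}(x,\dot x,t)=\mathscr{L}(x,-\dot x,-t)$, with $\mathscr{L}$ $\tau$-periodic in $t$, $\tau=2T$. Let $\gamma$ be a reversible $\tau$-periodic trajectory, $\gamma(-t)=\gamma(t)$, and suppose that $\gamma_+=\gamma|_{[0,T]}$ is a nondegenerate minimum of $\mathscr{A}_+$. Then $h_\rho$ is positive definite for all $\rho\in\mathbb{C}$ with $|\rho|=1$. Hence $\gamma$ has no multipliers on the unit circle.
   Context: $\mathscr{L}(x,\dot x,t)$ is smooth on $TM\times\mathbb{R}$ with $\mathscr{L}_{\dot x\dot x}$ positive definite. $\mathscr{A}_+(\nu)=\int_0^T\mathscr{L}(\nu,\dot\nu,t)\,dt$ is considered on the set of all curves $\nu:[0,T]\to M$ with free end points (for $S=\mathrm{id}$ the end points must lie in the fixed point set of $S$, which is all of $M$). Let $E_t=T_{\gamma(t)}M$ with metric $(v,w)=\langle\mathscr{L}_{\dot x\dot x}(\gamma,\dot\gamma,t)v,w\rangle$. The second variation of the action $\int_0^\tau\mathscr{L}dt$ at $\gamma$ on $\tau$-periodic $W^{1,2}$ fields along $\gamma$ has a unique representation $h(\xi,\eta)=\int_0^\tau((D\xi,D\eta)+(U\xi,\eta))dt$, where $U(t)$ is symmetric and $D$ is a covariant derivative compatible with the metric. Nondegenerate minimum means that the second variation of $\mathscr{A}_+$ at $\gamma_+$, which is $K(\eta,\eta)=\int_0^T((D\eta,D\eta)+(U\eta,\eta))dt$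 on all $W^{1,2}$ fields $\eta(t)\in E_t$, $0\le t\le T$, is positive definite. For $|\rho|=1$, $h_\rho$ is the Hermitian form $\int_0^\tau((D\xi,D\bar\eta)+(U\xi,\bar\eta))dt$ on the space of complex locally $W^{1,2}$ vector fields $\xi(t)\in E_t$ along $\gamma$ with $\xi(t+\tau)=\rho\,\xi(t)$. Multipliers are the eigenvalues of the monodromy operator $(\xi(0),D\xi(0))\mapsto(\xi(\tau),D\xi(\tau))$ of the variational system $D^2\xi=U\xi$. *)

(* Defs.v *)
From HB Require Import structures.
From mathcomp Require Import all_boot all_order all_algebra.
From mathcomp Require Import all_classical all_reals all_analysis.
From mathcomp Require Import complex.

Set Implicit Arguments.
Unset Strict Implicit.
Unset Printing Implicit Defensive.

Import Order.TTheory GRing.Theory Num.Theory.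
Import numFieldNormedType.Exports.
Local Open Scope classical_set_scope.
Local Open Scope ring_scope.
Local Open Scope complex_scope.

Fixpoint Ck_on {R : realType} {V W : normedModType R} (k : nat)
    (O : set V) (f : V -> W) {struct k} : Prop :=
  if k is k'.+1 then
    (forall x, O x -> differentiable f x) /\
    (forall v, Ck_on k' O (fun x => 'D_v f x))
  else forall x, O x -> {for x, continuous f}.

Definition smooth_on {R : realType} {V W : normedModType R}
    (O : set V) (f : V -> W) : Prop := forall k, Ck_on k O f.

(* [chart i] and [chart_inv i] are total functions, meaningful only on
   [cdom i] and on its image; the atlas is not required to be maximal. *)
Record smooth_manifold (R : realType) (n : nat) := SmoothManifold {
  mpoint :> topologicalType;
  cidx : Type;
  cdom : cidx -> set mpoint;
  chart : cidx -> mpoint -> 'rV[R]_n;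
  chart_inv : cidx -> 'rV[R]_n -> mpoint;
  manifold_hausdorff : hausdorff_space mpoint;
  manifold_second_countable : @second_countable mpoint;
  cdom_open : forall i, open (cdom i);
  cdom_cover : forall x, exists i, cdom i x;
  chartK : forall i x, cdom i x -> chart_inv i (chart i x) = x;
  chart_image_open : forall i, open (chart i @` cdom i);
  chart_continuous : forall i x, cdom i x -> {for x, continuous (chart i)};
  chart_inv_continuous : forall i y, (chart i @` cdom i) y ->
    {for y, continuous (chart_inv i)};
  chart_transition : forall i j,
    smooth_on (chart i @` (cdom i `&` cdom j))
              (fun y => chart j (chart_inv i y)) }.

Arguments cdom {R n M} i : rename.
Arguments chart {R n M} i x : rename.
Arguments chart_inv {R n M} i y : rename.

(* A tangent vector is encoded by the family of its coordinate vectors in all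
   charts; vector operations are pointwise. *)
Definition tvec {R : realType} {n : nat} (M : smooth_manifold R n) :=
  cidx M -> 'rV[R]_n.

(* Membership in T_xM.  Coordinates in charts not containing x are set to 0,
   so that equality of tangent vectors at x is equality of families. *)
Definition tangent {R : realType} {n : nat} {M : smooth_manifold R n}
    (x : M) (v : tvec M) : Prop :=
  (forall i, ~ cdom i x -> v i = 0) /\
  (forall i j, cdom i x -> cdom j x ->
     v j = 'D_(v i) (fun y => chart j (chart_inv i y)) (chart i x)).

(* The vector at x whose coordinates in the chart i are v. *)
Definition tvec_of {R : realType} {n : nat} {M : smooth_manifold R n}
    (i : cidx M) (x : M) (v : 'rV[R]_n) : tvec M :=
  fun j => if x \in cdom j
           then 'D_v (fun y => chart j (chart_inv i y)) (chart i x) else 0.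

Definition smooth_into {R : realType} {n : nat} {M : smooth_manifold R n}
    {V : normedModType R} (O : set V) (f : V -> M) : Prop :=
  (forall x, O x -> {for x, continuous f}) /\
  (forall i, smooth_on (O `&` f @^-1` cdom i) (fun x => chart i (f x))).

Definition velocity {R : realType} {n : nat} {M : smooth_manifold R n}
    (c : R -> M) (t : R) : tvec M :=
  fun i => if c t \in cdom i then derive1 (fun s => chart i (c s)) t else 0.

(* A function on TM * R; its values at non-tangent families are irrelevant. *)
Definition lagrangian {R : realType} {n : nat} (M : smooth_manifold R n) :=
  M -> tvec M -> R -> R.

Definition local_lagrangian {R : realType} {n : nat} {M : smooth_manifold R n}
    (L : lagrangian M) (i : cidx M) (p : 'rV[R]_n * 'rV[R]_n * R) : R :=
  let x := chart_inv i p.1.1 in L x (tvec_of i x p.1.2) p.2.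

Definition smooth_lagrangian {R : realType} {n : nat}
    {M : smooth_manifold R n} (L : lagrangian M) : Prop :=
  forall i, smooth_on [set p | (chart i @` cdom i) p.1.1]
                      (local_lagrangian L i).

(* < L_{xdot xdot}(x, v, t) u, w >, the Hessian of L along the fibre T_xM. *)
Definition fibre_hessian {R : realType} {n : nat} {M : smooth_manifold R n}
    (L : lagrangian M) (x : M) (v : tvec M) (t : R) (u w : tvec M) : R :=
  derive1 (fun a : R =>
    derive1 (fun b : R => L x (v + a *: u + b *: w) t) 0) 0.

Definition fibrewise_convex {R : realType} {n : nat}
    {M : smooth_manifold R n} (L : lagrangian M) : Prop :=
  forall x v t w, tangent x v -> tangent x w -> w <> 0 ->
    0 < fibre_hessian L x v t w w.

Definition action {R : realType} {n : nat} {M : smooth_manifold R n}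
    (L : lagrangian M) (a b : R) (c : R -> M) : R :=
  \int[lebesgue_measure]_(t in `[a, b]) L (c t) (velocity c t) t.

(* Smoothness loses nothing: C^2 solutions are smooth since L is smooth and
   fibrewise convex. *)
Definition trajectory {R : realType} {n : nat} {M : smooth_manifold R n}
    (L : lagrangian M) (c : R -> M) : Prop :=
  smooth_into setT c /\
  forall i t, cdom i (c t) -> forall w : 'rV[R]_n,
    let j1 s := (chart i (c s), derive1 (fun r => chart i (c r)) s, s) in
    derive1 (fun s => 'D_((0, w), 0) (local_lagrangian L i) (j1 s)) t =
    'D_((w, 0), 0) (local_lagrangian L i) (j1 t).

Definition metric {R : realType} {n : nat} {M : smooth_manifold R n}
    (L : lagrangian M) (c : R -> M) (t : R) (u w : tvec M) : R :=
  fibre_hessian L (c t) (velocity c t) t u w.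

Definition smooth_field {R : realType} {n : nat} {M : smooth_manifold R n}
    (c : R -> M) (xi : R -> tvec M) : Prop :=
  (forall t, tangent (c t) (xi t)) /\
  (forall i, smooth_on (c @^-1` cdom i) (fun t => xi t i)).

(* A family of n x n matrices depending on t, one for each chart, relevant when
   c t is in the chart.  Matrices act on coordinate row vectors on the right. *)
Definition mx_family {R : realType} {n : nat} (M : smooth_manifold R n) :=
  cidx M -> R -> 'M[R]_n.

Definition smooth_periodic_mx {R : realType} {n : nat}
    {M : smooth_manifold R n} (c : R -> M) (tau : R) (A : mx_family M) : Prop :=
  (forall i, smooth_on (c @^-1` cdom i) (A i)) /\
  (forall i t, cdom i (c t) -> A i (t + tau) = A i t).

(* D xi = xi' + xi G in local coordinates. *)
Definition covD {R : realType} {n : nat} {M : smooth_manifold R n}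
    (c : R -> M) (G : mx_family M) (xi : R -> tvec M) (t : R) : tvec M :=
  fun i => if c t \in cdom i
           then derive1 (fun s => xi s i) t + xi t i *m G i t else 0.

(* G is the family of local connection matrices of a covariant derivative on
   the bundle E_t = T_{c(t)}M over R / tau Z, compatible with the metric. *)
Definition metric_connection {R : realType} {n : nat}
    {M : smooth_manifold R n} (L : lagrangian M) (c : R -> M) (tau : R)
    (G : mx_family M) : Prop :=
  [/\ smooth_periodic_mx c tau G,
      (forall xi, smooth_field c xi -> forall t, tangent (c t) (covD c G xi t))
    & (forall xi eta, smooth_field c xi -> smooth_field c eta -> forall t,
         derive1 (fun s => metric L c s (xi s) (eta s)) t =
         metric L c t (covD c G xi t) (eta t) +
         metric L c t (xi t) (covD c G eta t))].

Definition mx_apply {R : realType} {n : nat} {M : smooth_manifold R n}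
    (U : mx_family M) (t : R) (v : tvec M) : tvec M := fun i => v i *m U i t.

Definition symmetric_endomorphism {R : realType} {n : nat}
    {M : smooth_manifold R n} (L : lagrangian M) (c : R -> M) (tau : R)
    (U : mx_family M) : Prop :=
  [/\ smooth_periodic_mx c tau U,
      (forall t v, tangent (c t) v -> tangent (c t) (mx_apply U t v))
    & (forall t v w, tangent (c t) v -> tangent (c t) w ->
         metric L c t (mx_apply U t v) w = metric L c t v (mx_apply U t w))].

(* Smooth two-parameter variation of c through tau-periodic curves; the
   parameters are p.1.1 and p.1.2, the time is p.2. *)
Definition periodic_variation {R : realType} {n : nat}
    {M : smooth_manifold R n} (c : R -> M) (tau e : R)
    (F : R * R * R -> M) : Prop :=
  [/\ 0 < e,
      smooth_into [set p | `|p.1.1| < e /\ `|p.1.2| < e] F,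
      (forall t, F (0, 0, t) = c t)
    & (forall a b t, `|a| < e -> `|b| < e -> F (a, b, t + tau) = F (a, b, t))].

(* The mixed second derivative of the action over [0, tau] along every smooth
   variation with variation fields xi, eta equals
   int_0^tau ((D xi, D eta) + (U xi, eta)) dt. *)
Definition represents_second_variation {R : realType} {n : nat}
    {M : smooth_manifold R n} (L : lagrangian M) (c : R -> M) (tau : R)
    (G U : mx_family M) : Prop :=
  forall (e : R) (F : R * R * R -> M), periodic_variation c tau e F ->
    let xi t := velocity (fun a => F (a, 0, t)) 0 in
    let eta t := velocity (fun b => F (0, b, t)) 0 in
    derive1 (fun a =>
      derive1 (fun b => action L 0 tau (fun t => F (a, b, t))) 0) 0 =
    \int[lebesgue_measure]_(t in `[0, tau])
      (metric L c t (covD c G xi t) (covD c G eta t) +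
       metric L c t (mx_apply U t (xi t)) (eta t)).

(* f is absolutely continuous on [a, b] with derivative g in L^2. *)
Definition W12_on {R : realType} {n : nat} (a b : R) (f g : R -> 'rV[R]_n) :
    Prop :=
  forall k : 'I_n,
    [/\ measurable_fun `[a, b] (fun t => g t ord0 k),
        lebesgue_measure.-integrable `[a, b]
          (fun t => ((g t ord0 k) ^+ 2)%:E)
      & forall t, t \in `[a, b] ->
          f t ord0 k = f a ord0 k +
            \int[lebesgue_measure]_(s in `[a, t]) g s ord0 k].

(* On the interval J, xi is a locally W^{1,2} field along c, and zeta is a
   representative of D xi.  D xi is only defined almost everywhere; zeta is
   taken tangent at every t because the set of charts may be uncountable. *)
Definition W12_field {R : realType} {n : nat} {M : smooth_manifold R n}
    (c : R -> M) (G : mx_family M) (J : set R) (xi zeta : R -> tvec M) : Prop :=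
  (forall t, J t -> tangent (c t) (xi t) /\ tangent (c t) (zeta t)) /\
  (forall i a b, `[a, b] `<=` J -> `[a, b] `<=` c @^-1` cdom i ->
     W12_on a b (fun t => xi t i) (fun t => zeta t i - xi t i *m G i t)).

(* The second variation of the action over [0, T] with free end points is
   K(eta, eta) = int_0^T ((D eta, D eta) + (U eta, eta)) dt
   on all W^{1,2} fields eta; below, zeta = D eta. *)
Definition K_form {R : realType} {n : nat} {M : smooth_manifold R n}
    (L : lagrangian M) (c : R -> M) (T : R) (U : mx_family M)
    (eta zeta : R -> tvec M) : R :=
  \int[lebesgue_measure]_(t in `[0, T])
    (metric L c t (zeta t) (zeta t) +
     metric L c t (mx_apply U t (eta t)) (eta t)).

Definition nondegenerate_minimum {R : realType} {n : nat}
    {M : smooth_manifold R n} (L : lagrangian M) (c : R -> M) (T : R)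
    (G U : mx_family M) : Prop :=
  forall eta zeta, W12_field c G `[0, T] eta zeta ->
    (exists2 t, t \in `[0, T] & eta t <> 0) -> 0 < K_form L c T U eta zeta.

(* The pair (u, w) stands for u + i w. *)
Definition ctvec {R : realType} {n : nat} (M : smooth_manifold R n) : Type :=
  (tvec M * tvec M)%type.

Definition cscale {R : realType} {n : nat} {M : smooth_manifold R n}
    (rho : R[i]) (v : ctvec M) : ctvec M :=
  let: a +i* b := rho in (a *: v.1 - b *: v.2, a *: v.2 + b *: v.1).

(* (v, conj w) for the complex bilinear extension of the metric. *)
Definition herm_metric {R : realType} {n : nat} {M : smooth_manifold R n}
    (L : lagrangian M) (c : R -> M) (t : R) (v w : ctvec M) : R[i] :=
  let g := metric L c t in
  (g v.1 w.1 + g v.2 w.2) +i* (g v.2 w.1 - g v.1 w.2).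

Definition cmx_apply {R : realType} {n : nat} {M : smooth_manifold R n}
    (U : mx_family M) (t : R) (v : ctvec M) : ctvec M :=
  (mx_apply U t v.1, mx_apply U t v.2).

Definition ccovD {R : realType} {n : nat} {M : smooth_manifold R n}
    (c : R -> M) (G : mx_family M) (xi : R -> ctvec M) (t : R) : ctvec M :=
  (covD c G (fun s => (xi s).1) t, covD c G (fun s => (xi s).2) t).

Definition cintegral {R : realType} (a b : R) (f : R -> R[i]) : R[i] :=
  (\int[lebesgue_measure]_(t in `[a, b]) complex.Re (f t)) +i*
  (\int[lebesgue_measure]_(t in `[a, b]) complex.Im (f t)).

(* The value h_rho(xi, eta), where Dxi and Deta represent D xi and D eta. *)
Definition h_form {R : realType} {n : nat} {M : smooth_manifold R n}
    (L : lagrangian M) (c : R -> M) (tau : R) (U : mx_family M)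
    (xi Dxi eta Deta : R -> ctvec M) : R[i] :=
  cintegral 0 tau (fun t =>
    herm_metric L c t (Dxi t) (Deta t) +
    herm_metric L c t (cmx_apply U t (xi t)) (eta t)).

(* The domain of h_rho: complex locally W^{1,2} fields with
   xi (t + tau) = rho xi (t). *)
Definition h_domain {R : realType} {n : nat} {M : smooth_manifold R n}
    (c : R -> M) (tau : R) (G : mx_family M) (rho : R[i])
    (xi Dxi : R -> ctvec M) : Prop :=
  [/\ W12_field c G setT (fun t => (xi t).1) (fun t => (Dxi t).1),
      W12_field c G setT (fun t => (xi t).2) (fun t => (Dxi t).2)
    & forall t, xi (t + tau) = cscale rho (xi t)].

(* In R[i], 0 < z means that z is real and positive. *)
Definition h_positive_definite {R : realType} {n : nat}
    {M : smooth_manifold R n} (L : lagrangian M) (c : R -> M) (tau : R)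
    (G U : mx_family M) (rho : R[i]) : Prop :=
  forall xi Dxi, h_domain c tau G rho xi Dxi ->
    (exists t, xi t <> (0, 0)) -> 0 < h_form L c tau U xi Dxi xi Dxi.

Definition variational_solution {R : realType} {n : nat}
    {M : smooth_manifold R n} (c : R -> M) (G U : mx_family M)
    (xi : R -> ctvec M) : Prop :=
  [/\ smooth_field c (fun t => (xi t).1), smooth_field c (fun t => (xi t).2)
    & forall t, ccovD c G (ccovD c G xi) t = cmx_apply U t (xi t)].

(* Smoothness in [variational_solution] is automatic, the coefficients being
   smooth.  This is the graph of the monodromy operator
   (xi(0), D xi(0)) |-> (xi(tau), D xi(tau)). *)
Definition monodromy {R : realType} {n : nat} {M : smooth_manifold R n}
    (c : R -> M) (tau : R) (G U : mx_family M)
    (p q : ctvec M * ctvec M) : Prop :=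
  exists xi, [/\ variational_solution c G U xi,
                 p = (xi 0, ccovD c G xi 0)
               & q = (xi tau, ccovD c G xi tau)].

Definition multiplier {R : realType} {n : nat} {M : smooth_manifold R n}
    (c : R -> M) (tau : R) (G U : mx_family M) (rho : R[i]) : Prop :=
  exists2 p : ctvec M * ctvec M, p <> ((0, 0), (0, 0)) &
    monodromy c tau G U p (cscale rho p.1, cscale rho p.2).

(* Reversibility for the involution S = id. *)
Definition reversible_lagrangian {R : realType} {n : nat}
    {M : smooth_manifold R n} (L : lagrangian M) : Prop :=
  forall x v t, tangent x v -> L x v t = L x (- v) (- t).

Definition periodic_lagrangian {R : realType} {n : nat}
    {M : smooth_manifold R n} (L : lagrangian M) (tau : R) : Prop :=
  forall x v t, tangent x v -> L x v (t + tau) = L x v t.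

(* Main.v *)
Require Import Defs.
From mathcomp Require Import all_boot all_order all_algebra.
From mathcomp Require Import all_classical all_reals all_analysis.
From mathcomp Require Import measurable_realfun complex ring lra.

Set Implicit Arguments.
Unset Strict Implicit.
Unset Printing Implicit Defensive.

Import Order.TTheory GRing.Theory Num.Theory.
Import numFieldNormedType.Exports.
Local Open Scope classical_set_scope.
Local Open Scope ring_scope.

(** The point is that the representation of the second variation by a metric
    connection D and a symmetric potential U is unique, and that the action over
    a period does not change when a periodic curve is reversed in time.  Hence
    the reversal t |-> - t transforms (D, U) into itself: in every chart the
    connection matrices satisfy G(- t) = - G(t) and the potential satisfies
    U(- t) = U(t) ([connection_odd_potential_even]).  Consequently, if zeta
    represents D xi, then - zeta (tau - t) represents the derivative of
    xi (tau - t), and splitting the period at T gives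
      int_0^tau ((D xi, D xi) + (U xi, xi)) dt = K(xi) + K(xi reversed)
    for every field xi, whether or not it satisfies a boundary condition
    ([index_form_split]).  Both terms are nonnegative, and one of them is
    positive when xi does not vanish on [0, tau], so the index form over a
    period is positive definite without any boundary condition
    ([index_form_gt0]).

    The two assertions follow.  For a complex field xi = xi_1 + i xi_2 the value
    h_rho(xi, xi) is the sum of the index forms of xi_1 and xi_2
    ([h_form_diag]); if xi (t + tau) = rho xi (t) with |rho| = 1, then xi
    vanishes identically as soon as it vanishes on [0, tau].  If rho were a
    multiplier of modulus 1, then integration by parts would show that the index
    form of the corresponding solution of D^2 xi = U xi is the difference
    of the boundary terms Re (D xi, conj xi) at tau and at 0; multiplication by
    rho preserves this quantity, so the index form would vanish and xi = 0.

    The uniqueness of (D, U) is proved on explicit variations.  In a chart i,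
    let phi be a periodic bump function supported near the times congruent to t0,
    theta a bounded periodic function, and consider the fields phi u and
    theta phi w with constant coordinate vectors u and w, and their reversals;
    they are the variation fields of an explicit two-parameter variation
    ([local_variation]).  Both
    connections being metric, G(t) + G(- t) is antisymmetric, the terms in phi'
    cancel, and the densities of the two index forms differ by phi^2 times a
    continuous coefficient ([density_gapE]).  The integral of this difference is
    zero for every phi, so the coefficient is zero ([gap_coef_eq0]); taking
    theta = 1, and theta vanishing at t0 with theta'(t0) nonzero, separates
    U from G. *)

(** * Calculus of k times differentiable maps *)

Section CkCalculus.
Context {R : realType}.
Implicit Types (V W X : normedModType R) (k : nat).

Lemma near_open_eq {T : topologicalType} {W : Type} (O : set T) (f g : T -> W)
    (x : T) : open O -> (forall y, O y -> f y = g y) -> O x ->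
  \forall y \near x, f y = g y.
Proof.
by move=> oO fg Ox; apply: filterS (open_nbhs_nbhs (conj oO Ox)) => y /fg.
Qed.

Lemma near_eq_continuous {T U : topologicalType} (f g : T -> U) (x : T) :
  (\forall y \near x, f y = g y) -> {for x, continuous f} ->
  {for x, continuous g}.
Proof.
move=> fg; rewrite /prop_for /continuous_at -(nbhs_singleton fg).
by apply: cvg_trans; apply: near_eq_cvg; apply: filterS fg => y ->.
Qed.

(** The difference g - f vanishes near x, hence is differentiable at x. *)
Lemma near_eq_differentiable {V W} (f g : V -> W) (x : V) :
  (\forall y \near x, f y = g y) -> differentiable f x -> differentiable g x.
Proof.
move=> fg df; pose e := g - f.
have en : \forall y \near x, e y = 0.
  by apply: filterS fg => y; rewrite /e !fctE => ->; rewrite subrr.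
have eE : e \o shift x = cst (e x) + (\0 : {linear V -> W}) +o_ 0 id.
  apply/eqaddoP => _/posnumP[eps].
  have : \forall h \near 0, e (h + x) = 0.
    move: en; rewrite (near_shift 0) => H; apply: filterS H => y.
    by rewrite /comp /shift subr0.
  apply: filterS => h eh.
  by rewrite !fctE /= eh (nbhs_singleton en) addr0 subrr normr0 mulr_ge0.
have de : differentiable e x.
  have c0 : continuous (\0 : {linear V -> W}) by move=> y; exact: cst_continuous.
  have E := diff_unique c0 eE.
  by apply/diff_locallyP; split; [rewrite E | rewrite E].
have -> : g = f + e by rewrite /e addrC subrK.
exact: differentiableD.
Qed.

Lemma Ck_on_ext {V W} k (O : set V) (f g : V -> W) :
  open O -> (forall x, O x -> f x = g x) -> Ck_on k O f -> Ck_on k O g.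
Proof.
move=> oO; elim: k f g => [|k IH] f g fg /=.
  move=> cf x Ox; apply: near_eq_continuous (cf x Ox).
  exact: near_open_eq fg Ox.
move=> [df Df]; split=> [x Ox|v].
  by apply: near_eq_differentiable (df x Ox); exact: near_open_eq fg Ox.
apply: (IH _ _ _ (Df v)) => x Ox.
by apply: near_eq_derive; exact: near_open_eq fg Ox.
Qed.

Lemma Ck_on_sub {V W} k (O Q : set V) (f : V -> W) :
  Q `<=` O -> Ck_on k O f -> Ck_on k Q f.
Proof.
move=> sO; elim: k f => [|k IH] f /=; first by move=> cf x /sO /cf.
by move=> [df Df]; split=> [x /sO /df|v] //; exact: IH.
Qed.

(** The sets [Q] need not be open: [Ck_on] only asserts properties at each
    point of the set. *)
Lemma Ck_on_local {V W} k (O : set V) (f : V -> W) :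
  (forall x, O x -> exists2 Q : set V, Q x & Ck_on k Q f) -> Ck_on k O f.
Proof.
elim: k f => [|k IH] f /= H; first by move=> x /H[Q Qx] CO'; exact: CO'.
split=> [x /H[Q Qx [dO' _]]|v]; first exact: dO'.
by apply: IH => x /H[Q Qx [_ Df]]; exists Q.
Qed.

Lemma Ck_on_continuous {V W} k (O : set V) (f : V -> W) x :
  Ck_on k O f -> O x -> {for x, continuous f}.
Proof.
case: k => [|k] /= => [H|[df _] Ox]; first exact: H.
exact: differentiable_continuous (df _ Ox).
Qed.

Lemma Ck_onW {V W} k (O : set V) (f : V -> W) : Ck_on k.+1 O f -> Ck_on k O f.
Proof.
elim: k f => [|k IH] f; first by move=> H x Ox; exact: Ck_on_continuous H Ox.
by move=> [df Df]; split=> // v; exact: IH.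
Qed.

Lemma Ck_on_cst {V W} k (O : set V) (w : W) : Ck_on k O (cst w : V -> W).
Proof.
elim: k w => [|k IH] w /=; first by move=> x _; exact: cst_continuous.
split=> [x _|v]; first exact: differentiable_cst.
by rewrite (_ : (fun x => _) = cst 0)//; apply/funext => x; rewrite derive_cst.
Qed.

Lemma Ck_onD {V W} k (O : set V) (f g : V -> W) : open O ->
  Ck_on k O f -> Ck_on k O g -> Ck_on k O (fun x => f x + g x).
Proof.
move=> oO; elim: k f g => [|k IH] f g /=.
  by move=> cf cg x Ox; apply: continuousD; [exact: cf|exact: cg].
move=> [df Df] [dg Dg]; split=> [x Ox|v].
  by apply: (@differentiableD _ _ _ f g); [exact: df|exact: dg].
apply: Ck_on_ext (IH _ _ (Df v) (Dg v)) => // x Ox /=.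
by rewrite -(@deriveD _ _ _ f g); [|exact: diff_derivable (df _ Ox)|exact: diff_derivable (dg _ Ox)].
Qed.

Lemma Ck_on_sum {V W} k (O : set V) (I : Type) (r : seq I) (F : I -> V -> W) : open O ->
  (forall i, Ck_on k O (F i)) -> Ck_on k O (fun x => \sum_(i <- r) F i x).
Proof.
move=> oO H; elim: r => [|i r IH].
  by apply: (@Ck_on_ext V W k O (cst (0 : W) : V -> W) _) => // [x _|]; [rewrite big_nil|exact: Ck_on_cst].
by apply: Ck_on_ext (Ck_onD oO (H i) IH) => // x _; rewrite big_cons.
Qed.

Lemma Ck_onM {V} k (O : set V) (f g : V -> R) : open O ->
  Ck_on k O f -> Ck_on k O g -> Ck_on k O (fun x => f x * g x).
Proof.
move=> oO; elim: k f g => [|k IH] f g.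
  by move=> cf cg x Ox; apply: continuousM; [exact: cf|exact: cg].
move=> Cf Cg; case: (Cf) => df Df; case: (Cg) => dg Dg; split=> [x Ox|v].
  by apply: (@differentiableM _ _ f g); [exact: df|exact: dg].
have H1 := IH _ _ (Ck_onW Cf) (Dg v); have H2 := IH _ _ (Ck_onW Cg) (Df v).
apply: Ck_on_ext (Ck_onD oO H1 H2) => // x Ox.
by rewrite -[RHS]/('D_v (f * g) x) deriveM //; [exact: diff_derivable (df _ Ox)|exact: diff_derivable (dg _ Ox)].
Qed.

Lemma derive_scalel {V W} (f : V -> R) (w : W) x v : differentiable f x ->
  'D_v (fun x => f x *: w) x = 'D_v f x *: w.
Proof.
move=> df; rewrite !deriveE //; last exact: differentiableZl.
by rewrite diffZl.
Qed.

Lemma Ck_on_scalel {V W} k (O : set V) (f : V -> R) (w : W) : open O ->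
  Ck_on k O f -> Ck_on k O (fun x => f x *: w).
Proof.
move=> oO; elim: k f => [|k IH] f /=.
  by move=> cf x Ox; apply: continuousZr_tmp; exact: cf.
move=> [df Df]; split=> [x Ox|v]; first by apply: differentiableZl; exact: df.
by apply: Ck_on_ext (IH _ (Df v)) => // x Ox; rewrite derive_scalel //; exact: df.
Qed.

(** Precomposition with a map [l] whose linear part is [l0]. *)
Lemma Ck_on_affine {V W X} k (O : set W) (l l0 : V -> W) (f : W -> X) :
  (forall h v x, l (h *: v + x) = h *: l0 v + l x) ->
  (forall x, differentiable l x) ->
  Ck_on k O f -> Ck_on k (l @^-1` O) (fun x => f (l x)).
Proof.
move=> lE dl; elim: k f => [|k IH] f /=.
  move=> cf x Ox; apply: (@continuous_comp _ _ _ l f); last exact: (cf _ Ox).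
  exact: differentiable_continuous.
move=> [df Df]; split=> [x Ox|v].
  by apply: (@differentiable_comp _ _ _ _ l f) => //; exact: (df _ Ox).
have -> : (fun x => 'D_v (fun x => f (l x)) x) = (fun x => 'D_(l0 v) f (l x)); last first.
  exact: IH (Df (l0 v)).
apply/funext => x; rewrite /derive /=.
by under eq_fun do rewrite lE.
Qed.

Lemma derive_coord {V} m n (f : V -> 'M[R]_(m, n)) i j x v :
  differentiable f x -> 'D_v (fun x => f x i j) x = 'D_v f x i j.
Proof. by move=> df; rewrite derive_mx ?mxE //; exact: diff_derivable. Qed.

Lemma differentiable_coord_comp {V} m n (f : V -> 'M[R]_(m, n)) i j x :
  differentiable f x -> differentiable (fun x => f x i j) x.
Proof.
move=> df; apply: (@differentiable_comp _ _ _ _ f (fun M : 'M[R]_(m, n) => M i j)) => //.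
exact: differentiable_coord.
Qed.

Lemma Ck_on_coord {V} k (O : set V) m n (f : V -> 'M[R]_(m, n)) i j : open O ->
  Ck_on k O f -> Ck_on k O (fun x => f x i j).
Proof.
move=> oO; elim: k f => [|k IH] f /=.
  move=> cf x Ox; apply: (@continuous_comp _ _ _ f (fun M : 'M[R]_(m, n) => M i j)).
    exact: cf.
  exact: coord_continuous.
move=> [df Df]; split=> [x Ox|v].
  by apply: differentiable_coord_comp; exact: df.
by apply: Ck_on_ext (IH _ (Df v)) => // x Ox; rewrite derive_coord //; exact: df.
Qed.

(** A matrix valued map is of class C^k when its entries are. *)
Lemma Ck_on_mx {V} k (O : set V) m n (f : V -> 'M[R]_(m, n)) : open O ->
  (forall i j, Ck_on k O (fun x => f x i j)) -> Ck_on k O f.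
Proof.
move=> oO H; pose F i j x := f x i j *: (delta_mx i j : 'M[R]_(m, n)).
have : Ck_on k O (fun x => \sum_i \sum_j F i j x).
  apply: Ck_on_sum => // i; apply: Ck_on_sum => // j.
  exact: Ck_on_scalel.
by apply: Ck_on_ext => // x _; rewrite [RHS]matrix_sum_delta.
Qed.

(** Composition, for an inner map with values in a space [W] having a finite
    basis [e] with dual basis [p]. *)
Lemma Ck_on_comp_basis {V W} k m (e : 'I_m -> W) (p : 'I_m -> W -> R)
    (O : set V) (Q : set W) (f : V -> W) (g : W -> R) :
  open O -> (forall y, y = \sum_i p i y *: e i) ->
  (forall k i f, Ck_on k O f -> Ck_on k O (fun x => p i (f x))) ->
  (forall x, O x -> Q (f x)) -> Ck_on k O f -> Ck_on k Q g ->
  Ck_on k O (fun x => g (f x)).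
Proof.
move=> oO pE Cp fO; elim: k g => [|k IH] g.
  move=> cf cg x Ox; apply: (@continuous_comp _ _ _ f g); first exact: cf.
  by apply: cg; exact: fO.
move=> Cf [dg Dg]; case: (Cf) => df Df; split=> [x Ox|v].
  by apply: (@differentiable_comp _ _ _ _ f g); [exact: df|exact: (dg _ (fO _ Ox))].
have H : Ck_on k O (fun x => \sum_i p i ('D_v f x) * 'D_(e i) g (f x)).
  apply: Ck_on_sum => // i; apply: Ck_onM => //.
    exact: (Cp k i (fun x => 'D_v f x) (Df v)).
  exact: (IH _ (Ck_onW Cf) (Dg (e i))).
apply: Ck_on_ext H => // x Ox.
have [dfx dgx] := (df _ Ox, dg _ (fO _ Ox)).
rewrite [RHS]deriveE; last exact: differentiable_comp.
rewrite (diff_comp dfx dgx) /= -(deriveE v dfx) {2}(pE ('D_v f x)) linear_sum /=.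
by apply: eq_bigr => i _; rewrite linearZ /= -deriveE.
Qed.

Lemma Ck_on_compR {V} k (O : set V) (Q : set R) (f : V -> R) (g : R -> R) :
  open O -> (forall x, O x -> Q (f x)) -> Ck_on k O f -> Ck_on k Q g ->
  Ck_on k O (fun x => g (f x)).
Proof.
move=> oO; apply: (@Ck_on_comp_basis V R k 1 (fun=> 1) (fun _ y => y)) => //.
by move=> y; rewrite big_ord1 /GRing.scale /= mulr1.
Qed.

Lemma Ck_on_comp {V} k (O : set V) n (Q : set 'rV[R]_n) (f : V -> 'rV[R]_n)
    m p (g : 'rV[R]_n -> 'M[R]_(m, p)) :
  open O -> open Q -> (forall x, O x -> Q (f x)) -> Ck_on k O f -> Ck_on k Q g ->
  Ck_on k O (fun x => g (f x)).
Proof.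
move=> oO oQ fO Cf Cg; apply: Ck_on_mx => // i j.
apply: (@Ck_on_comp_basis V 'rV[R]_n k n (fun i => delta_mx 0 i)
  (fun i y => y 0 i) O Q f (fun y => g y i j)) => //.
- by move=> y; rewrite {1}[y]row_sum_delta.
- by move=> k' i' f' Cf'; exact: Ck_on_coord.
- exact: Ck_on_coord.
Qed.

Lemma smooth_on_differentiable {V W} (O : set V) (f : V -> W) x :
  smooth_on O f -> O x -> differentiable f x.
Proof. by move=> /(_ 1%N)[+ _]; apply. Qed.

Lemma smooth_on_continuous {V W} (O : set V) (f : V -> W) x :
  smooth_on O f -> O x -> {for x, continuous f}.
Proof. by move=> /(_ 0%N); exact. Qed.

Lemma smooth_on_derive {V W} (O : set V) (f : V -> W) v :
  smooth_on O f -> smooth_on O (fun x => 'D_v f x).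
Proof. by move=> H k; have [_] := H k.+1; exact. Qed.

Lemma smooth_on_derive1 {W} (O : set R) (f : R -> W) :
  smooth_on O f -> smooth_on O (fun x => derive1 f x).
Proof.
move=> sf; have := @smooth_on_derive R W O f (1 : R) sf.
by rewrite (_ : derive1 f = fun x => 'D_1 f x) //; apply/funext => x; rewrite derive1E.
Qed.

End CkCalculus.

(** * Smooth periodic bump functions *)

Section Bump.
Context {R : realType}.
Implicit Types (p q : {poly R}) (x t : R).

Lemma derive_scale {W : normedModType R} (f : R -> W) x (v : R) :
  differentiable f x -> 'D_v f x = v *: 'D_1 f x.
Proof.
move=> df; rewrite !deriveE // -[in LHS](mulr1 v) -[v * 1]/(v *: 1).
by rewrite linearZ.
Qed.

(** A map of one real variable with a C^k derivative is of class C^(k+1). *)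
Lemma Ck_on_derive1 {W : normedModType R} k (O : set R) (f df : R -> W) :
  open O -> (forall x, O x -> is_derive x 1 f (df x)) -> Ck_on k O df -> Ck_on k.+1 O f.
Proof.
move=> oO fE Cdf.
have dif x : O x -> differentiable f x.
  by move=> /fE[/derivable1_diffP].
split=> [x /dif //|v].
have : Ck_on k O (v \*: df).
  elim: k df {fE} Cdf => [|k IH] df.
    by move=> cf x Ox; apply: continuousZl_tmp; exact: cf.
  move=> [ddf Ddf]; split=> [x Ox|w]; first by apply: differentiableZ; exact: ddf.
  apply: Ck_on_ext (IH _ (Ddf w)) => // x Ox.
  by rewrite [RHS]deriveZ //; exact: diff_derivable (ddf _ Ox).
apply: Ck_on_ext => // x Ox.
by rewrite derive_scale; [rewrite (@derive_val _ _ _ _ _ _ _ (fE _ Ox))|exact: dif].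
Qed.

(** The functions x |-> p(1/x) exp(-1/x), extended by 0 to x <= 0; they form a
    family stable under differentiation. *)
Definition flat p x : R := if 0 < x then p.[x^-1] * expR (- x^-1) else 0.

Lemma horner_le_monomial q : exists C : R, exists n,
  0 <= C /\ forall y, 1 <= y -> `|q.[y]| <= C * y ^+ n.
Proof.
elim/poly_ind: q => [|q c [C [n [C0 H]]]].
  by exists 0, 0%N; split=> // y _; rewrite horner0 normr0 mul0r.
exists (C + `|c|), n.+1; split=> [|y y1]; first exact: addr_ge0.
have y0 : 0 <= y by exact: le_trans y1.
rewrite hornerD hornerM hornerX hornerC mulrDl (le_trans (ler_normD _ _))//.
apply: lerD; last by rewrite ler_peMr// exprn_ege1.
by rewrite normrM exprSr mulrA (ger0_norm y0) ler_wpM2r// H.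
Qed.

(** The flat functions are O(x) near 0, for exp grows faster than any
    polynomial; applied to X p, this is their differentiability at 0. *)
Lemma flat_bound q : exists2 C : R, 0 <= C & forall x, x < 1 -> `|flat q x| <= C * `|x|.
Proof.
have [C [n [C0 H]]] := horner_le_monomial q.
exists (C * n.+1`!%:R) => [|x x1]; first by rewrite mulr_ge0.
rewrite /flat; case: ifP => [x0|_]; last by rewrite normr0 mulr_ge0 ?mulr_ge0.
have y1 : 1 <= x^-1 by rewrite invf_ge1// ltW.
have y0 : 0 < x^-1 by rewrite invr_gt0.
have E0 := expR_gt0 x^-1.
rewrite normrM expRN (@ger0_norm _ (expR _)^-1) ?invr_ge0 ?expR_ge0//.
rewrite ler_pdivrMr// (le_trans (H _ y1))// (gtr0_norm x0) -!mulrA ler_wpM2l//.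
(* The term of order n + 1 of the exponential series absorbs the degree n. *)
have E := expR_ge1Dxn n (ltW y0).
have F0 : 0 < (n.+1)`!%:R :> R by rewrite ltr0n fact_gt0.
have : x^-1 ^+ n.+1 / (n.+1)`!%:R <= expR x^-1 by apply: le_trans E; rewrite lerDr.
rewrite ler_pdivrMr// exprS -ler_pdivlMl ?invr_gt0// invrK => /le_trans; apply.
by rewrite le_eqVlt; apply/orP; left; apply/eqP; ring.
Qed.

Lemma is_derive_flat p x : is_derive x 1 (flat p) (flat ('X^2 * (p - p^`())) x).
Proof.
have [x0|x0|<-] := ltgtP 0 x.
- have nx : \forall y \near x, (fun y => p.[y^-1] * expR (- y^-1)) y = flat p y.
    by near=> y; rewrite /flat ifT//; near: y; exact: lt_nbhsr.
  apply: near_eq_is_derive nx _.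
  have xn0 : x != 0 by rewrite gt_eqF.
  have D1 : is_derive x 1 (fun y : R => y^-1) (- x ^- 2).
    apply: is_derive_eq (@is_deriveV R id x 1 1 xn0 (is_derive_id x 1)) _.
    by rewrite /GRing.scale /= mulr1.
  have D2 : is_derive x 1 (fun y : R => p.[y^-1]) (p^`().[x^-1] * - x ^- 2).
    exact: (is_derive1_comp (is_derive_poly p x^-1) D1).
  have D3 : is_derive x 1 (fun y : R => expR (- y^-1)) (expR (- x^-1) * x ^- 2).
    have DN : is_derive x 1 (fun y : R => - y^-1) (x ^- 2).
      by have := is_deriveN D1; rewrite opprK.
    exact: (@is_derive1_comp R expR (fun y => - y^-1) x _ _ (is_derive_expR _) DN).
  apply: (is_derive_eq (is_deriveM D2 D3)).
  rewrite /flat x0 hornerM hornerXn hornerD hornerN /GRing.scale /= exprVn; ring.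
- have nx : \forall y \near x, cst 0 y = flat p y.
    by near=> y; rewrite /flat ifF//; apply/negbTE; rewrite -leNgt ltW//; near: y; exact: lt_nbhsl.
  apply: near_eq_is_derive nx _.
  by rewrite /flat ifF; [exact: is_derive_cst|apply/negbTE; rewrite -leNgt ltW].
- have [C C0 H] := flat_bound ('X * p).
  rewrite [flat (_ * _) 0]/flat ltxx.
  have c : (fun h : R => h^-1 *: ((flat p \o shift 0) (h *: 1) - flat p 0)) @ 0^' --> 0.
    apply/cvgrPdist_le => /= e e0.
    near=> h.
    have h0 : h != 0 by near: h; exact: nbhs_dnbhs_neq.
    have h1 : `|h| < 1 by near: h; apply: dnbhs0_lt.
    have he : `|h| <= e / (C + 1) by near: h; apply: dnbhs0_le; rewrite divr_gt0// ltr_wpDl.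
    rewrite sub0r normrN addr0 [flat p 0]/flat ltxx subr0 /GRing.scale /= mulr1.
    (* The difference quotient at 0 is itself a flat function. *)
    have -> : h^-1 * flat p h = flat ('X * p) h.
      by rewrite /flat; case: ifP; rewrite ?mulr0// hornerM hornerX mulrA.
    apply: le_trans (H _ _) _; first by rewrite (le_lt_trans (ler_norm h)).
    rewrite ler_pdivlMr ?ltr_wpDl// in he.
    by apply: le_trans he; rewrite mulrC ler_wpM2l// lerDl.
  by split; [apply/cvg_ex; exists 0|apply/cvg_lim].
Unshelve. all: by end_near. Qed.

Lemma Ck_on_flat k p : Ck_on k setT (flat p).
Proof.
elim: k p => [|k IH] p.
  move=> x _; apply: differentiable_continuous; apply/derivable1_diffP.
  exact: (@ex_derive _ _ _ _ _ _ _ (is_derive_flat p x)).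
by apply: Ck_on_derive1 (openT) _ (IH _) => x _; exact: is_derive_flat.
Qed.

Lemma Ck_on_sin_cos k : Ck_on k setT (@sin R) /\ Ck_on k setT (@cos R).
Proof.
elim: k => [|k [IHs IHc]].
  by split=> x _; [exact: continuous_sin|exact: continuous_cos].
split; first by apply: Ck_on_derive1 (openT) _ IHc => x _.
have H : Ck_on k setT (fun x => (-1) * sin x) by apply: Ck_onM => //; [exact: openT|exact: Ck_on_cst].
apply: Ck_on_derive1 (openT) _ H => x _.
by apply: is_derive_eq; rewrite mulN1r.
Qed.

Lemma periodic_int {X : Type} (f : R -> X) (T : R) (k : int) :
  (forall x, f (x + T) = f x) -> forall x, f (x + T *~ k) = f x.
Proof.
move=> fT; have H n x : f (x + T *+ n) = f x.
  by elim: n => [|n IH]; rewrite ?mulr0n ?addr0// mulrSr addrA fT IH.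
case: k => n x; first exact: H.
by rewrite NegzE mulrNz -[LHS](H n.+1) pmulrn subrK.
Qed.

(** Reduction of a real number modulo [T] to an interval of length [T]. *)
Lemma modulo_period (T a x : R) : 0 < T -> exists k : int, a <= x + T *~ k < a + T.
Proof.
move=> T0; exists (- Num.floor ((x - a) / T)).
have /andP[] := floor_itv ((x - a) / T); set m := Num.floor _.
rewrite ler_pdivlMr// ltr_pdivrMr// intrD mulr1z mulrDl mul1r mulrNz !mulrzl => h1 h2.
by apply/andP; split; lra.
Qed.

(** Where the cosine is close to 1, the angle is close to a multiple of 2 pi. *)
Lemma cos_localize (d : R) : 0 < d -> exists2 kappa : R, kappa < 1 &
  forall x, kappa < cos x -> exists k : int, `|x + pi *+ 2 *~ k| < d.
Proof.
have pi0 := pi_gt0 R.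
move=> d0; pose e := Num.min d pi.
have e0 : 0 < e by rewrite lt_min d0.
have ed : e <= d by rewrite ge_min lexx.
have epi : e <= pi by rewrite ge_min lexx orbT.
exists (cos e) => [|x cx].
  by rewrite -[ltRHS]cos0 ltr_cos// in_itv /= ?lexx ?(ltW pi0) ?(ltW e0) ?epi.
have [k kx] := modulo_period (- pi) x (T := pi *+ 2) (mulrn_wgt0 2 pi0).
exists k; apply: lt_le_trans ed.
set y := x + _ in kx *.
have cy : cos y = cos x by exact: (periodic_int k (@cosD2pi R)).
have yp : `|y| <= pi.
  by rewrite ler_norml; move: kx => /andP[-> h]/=; lra.
by rewrite -(@ltr_cos R `|y| e) ?cos_norm ?cy// in_itv /= ?normr_ge0 ?yp ?epi ?(ltW e0).
Qed.

(** The angle at time [t], for a uniform rotation of period [tau] that starts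
    at time [t0]. *)
Definition phase (tau t0 t : R) : R := (pi *+ 2 / tau) * (t - t0).

(** A smooth bump of period [tau] centred at [t0]; it is positive exactly where
    the cosine of the phase exceeds [kappa]. *)
Definition cos_bump (tau t0 kappa t : R) : R := flat 1 (cos (phase tau t0 t) - kappa).

Section BumpProperties.
Variables (tau t0 : R).
Hypothesis tau_gt0 : 0 < tau.

Lemma phaseD t : phase tau t0 (t + tau) = phase tau t0 t + pi *+ 2.
Proof. by rewrite /phase addrAC mulrDr divfK// gt_eqF. Qed.

Lemma cos_phase_periodic t : cos (phase tau t0 (t + tau)) = cos (phase tau t0 t).
Proof. by rewrite phaseD cosD2pi. Qed.

Lemma bump_periodic kappa t : cos_bump tau t0 kappa (t + tau) = cos_bump tau t0 kappa t.
Proof. by rewrite /cos_bump cos_phase_periodic. Qed.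

Lemma bump_neq0 kappa t : cos_bump tau t0 kappa t != 0 -> kappa < cos (phase tau t0 t).
Proof. by rewrite /cos_bump /flat; case: ifP; rewrite ?eqxx// subr_gt0. Qed.

Lemma bump_gt0 kappa t : kappa < cos (phase tau t0 t) -> 0 < cos_bump tau t0 kappa t.
Proof.
by move=> k; rewrite /cos_bump /flat subr_gt0 k hornerC mul1r expR_gt0.
Qed.

Lemma bump_center_gt0 kappa : kappa < 1 -> 0 < cos_bump tau t0 kappa t0.
Proof. by move=> k; apply: bump_gt0; rewrite /phase subrr mulr0 cos0. Qed.

Lemma smooth_phase : smooth_on setT (phase tau t0).
Proof.
have d x : is_derive x 1 (phase tau t0) (pi *+ 2 / tau).
  by rewrite /phase; apply: is_derive_eq; rewrite subr0 /GRing.scale /= mulr1.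
case=> [|k]; last by apply: Ck_on_derive1 (openT) _ (Ck_on_cst _ _ _) => x _; exact: d.
move=> x _; apply: differentiable_continuous; apply/derivable1_diffP.
exact: (@ex_derive _ _ _ _ _ _ _ (d x)).
Qed.

Lemma smooth_cos_phase : smooth_on setT (fun t => cos (phase tau t0 t)).
Proof.
by move=> k; apply: (@Ck_on_compR _ _ k _ setT (phase tau t0) cos) => //;
  [exact: openT|exact: smooth_phase|exact: (Ck_on_sin_cos k).2].
Qed.

Lemma smooth_sin_phase : smooth_on setT (fun t => sin (phase tau t0 t)).
Proof.
by move=> k; apply: (@Ck_on_compR _ _ k _ setT (phase tau t0) sin) => //;
  [exact: openT|exact: smooth_phase|exact: (Ck_on_sin_cos k).1].
Qed.

Lemma smooth_bump kappa : smooth_on setT (cos_bump tau t0 kappa).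
Proof.
move=> k; apply: (@Ck_on_compR _ _ k _ setT (fun t => cos (phase tau t0 t) - kappa) (flat 1)) => //.
- exact: openT.
- apply: Ck_onD; [exact: openT|exact: smooth_cos_phase|exact: Ck_on_cst].
- exact: Ck_on_flat.
Qed.

Lemma derive1_sin_phase : derive1 (fun t => sin (phase tau t0 t)) t0 = pi *+ 2 / tau.
Proof.
rewrite derive1E; have d : is_derive t0 1 (phase tau t0) (pi *+ 2 / tau).
  by rewrite /phase; apply: is_derive_eq; rewrite subr0 /GRing.scale /= mulr1.
have := is_derive1_comp (is_derive_sin (phase tau t0 t0)) d.
by move=> /(@derive_val _ _ _ _ _ _ _) -> ; rewrite /phase subrr mulr0 cos0 mul1r.
Qed.

(** The times at which the cosine of the phase is close to 1 are close to
    [t0] modulo [tau]. *)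
Lemma bump_localize (P : R -> Prop) : (forall t, P (t + tau) = P t) ->
  (\forall t \near t0, P t) ->
  exists2 kappa : R, kappa < 1 & forall t, kappa < cos (phase tau t0 t) -> P t.
Proof.
move=> Pp /nbhs_normP[d /= d0 Pd].
have pi0 := pi_gt0 R.
have w0 : 0 < pi *+ 2 / tau :> R by rewrite divr_gt0// mulrn_wgt0.
have [kappa k1 H] := cos_localize (mulr_gt0 w0 d0).
exists kappa => // t /H[k kd].
rewrite -(@periodic_int _ P tau k Pp); apply: Pd => /=.
rewrite distrC; move: kd; rewrite /phase.
have -> : pi *+ 2 / tau * (t - t0) + pi *+ 2 *~ k = pi *+ 2 / tau * (t + tau *~ k - t0).
  by rewrite addrAC mulrDr [in RHS]mulrDr mulrzAr divfK ?gt_eqF// -mulrDr.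
by rewrite normrM (gtr0_norm w0) ltr_pM2l.
Qed.

End BumpProperties.
End Bump.

(** * Lebesgue integrals on intervals *)

Section Integrals.
Context {R : realType}.
Local Notation mu := (@lebesgue_measure R).
Implicit Types (f g : R -> R) (a b p : R).

Lemma within_continuous_pointwise {W : topologicalType} a b (f : R -> W) :
  (forall t, t \in `[a, b] -> {for t, continuous f}) -> {within `[a, b], continuous f}.
Proof. by move=> cf; apply: continuous_in_subspaceT => t /set_mem; exact: cf. Qed.

Lemma within_continuousM (A : set R) f g : {within A, continuous f} ->
  {within A, continuous g} -> {within A, continuous (fun t => f t * g t)}.
Proof. by move=> cf cg t; apply: continuousM; [exact: cf|exact: cg]. Qed.

Lemma within_continuousD (A : set R) f g : {within A, continuous f} ->
  {within A, continuous g} -> {within A, continuous (fun t => f t + g t)}.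
Proof. by move=> cf cg t; apply: continuousD; [exact: cf|exact: cg]. Qed.

Lemma within_continuous_cst (A : set R) (c : R) : {within A, continuous (fun=> c)}.
Proof. by apply: continuous_subspaceT => t; exact: cst_continuous. Qed.

Lemma within_continuous_sum (A : set R) (I : Type) (r : seq I) (F : I -> R -> R) :
  (forall i, {within A, continuous (F i)}) ->
  {within A, continuous (fun t => \sum_(i <- r) F i t)}.
Proof.
move=> H; elim: r => [|i r IH].
  by under eq_fun do rewrite big_nil; exact: within_continuous_cst.
by under eq_fun do rewrite big_cons; exact: within_continuousD.
Qed.

Lemma within_continuous_integrable f a b : {within `[a, b], continuous f} ->
  mu.-integrable `[a, b] (EFin \o f).
Proof. by move=> cf; apply: continuous_compact_integrable => //; exact: segment_compact. Qed.

Lemma within_continuous_measurable f a b : {within `[a, b], continuous f} ->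
  measurable_fun `[a, b] f.
Proof. by move=> cf; apply: subspace_continuous_measurable_fun. Qed.

Lemma within_continuous_bounded f a b : {within `[a, b], continuous f} ->
  exists2 C : R, 0 <= C & forall t, t \in `[a, b] -> `|f t| <= C.
Proof.
move=> cf; have := continuous_compact cf (@segment_compact R a b).
move=> /compact_bounded[M [Mr H]]; exists (`|M| + 1) => [|t tab]; first exact: addr_ge0.
by apply: (H (`|M| + 1)); [rewrite ltr_pwDr// ler_norm|exists t].
Qed.

(** Change of variable t |-> p - t. *)
Definition refl p : R -> R := fun t => p - t.

Lemma refl_itv p a b : refl p @^-1` `[a, b] = `[p - b, p - a]%classic.
Proof.
by apply/seteqP; split=> t /=; rewrite /refl !in_itv /= => /andP[h1 h2]; apply/andP; split; lra.
Qed.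

Lemma measurable_refl p : measurable_fun setT (refl p : measurableTypeR R -> measurableTypeR R).
Proof.
apply: continuous_measurable_fun => t; apply: cvgB; [exact: cvg_cst|exact: cvg_id].
Qed.

Lemma pushforward_refl p (A : set (measurableTypeR R)) : measurable A ->
  pushforward mu (refl p : _ -> measurableTypeR R) A = mu A.
Proof.
move=> mA; apply/esym/lebesgue_measure_unique => //=.
  exact: measurable_refl.
move=> ? _ [[a b]] _ <-.
rewrite /pushforward (_ : refl p @^-1` _ = `[p - b, p - a[%classic).
  by rewrite !lebesgue_measure_itv/= !lte_fin ltrD2l ltrN2 -!EFinD (_ : p - a - (p - b) = b - a)//; ring.
by apply/seteqP; split=> t /=; rewrite /refl !in_itv /= => /andP[h1 h2]; apply/andP; split; lra.
Qed.

Lemma measurable_fun_refl p (D : set R) (g : R -> \bar R) : measurable D ->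
  measurable_fun D g -> measurable_fun (refl p @^-1` D) (g \o refl p).
Proof.
move=> mD mg; apply: (measurable_comp mD) => //; first by move=> _ [t ? <-].
by apply: measurable_funTS; exact: measurable_refl.
Qed.

Lemma integral_refl p (D : set R) (g : R -> \bar R) : measurable D -> measurable_fun D g ->
  (\int[mu]_(t in D) g t = \int[mu]_(t in refl p @^-1` D) g (refl p t))%E.
Proof.
move=> mD mg.
have H (h : R -> \bar R) : measurable_fun D h -> (forall t, 0 <= h t)%E ->
    (\int[mu]_(t in D) h t = \int[mu]_(t in refl p @^-1` D) h (refl p t))%E.
  move=> mh h0.
  have := @ge0_integral_pushforward _ _ (measurableTypeR R) (measurableTypeR R) R (refl p)
    (measurable_refl p) mu D h mD mh (fun y _ => h0 y).
    move=> <-; apply: eq_measure_integral; first exact: measurable_refl.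
  by move=> ? B mB BD; exact/esym/pushforward_refl.
rewrite integralE [RHS]integralE.
have mp : measurable_fun D (g^\+)%E by exact: measurable_funepos.
have mn : measurable_fun D (g^\-)%E by exact: measurable_funeneg.
rewrite (H _ mp (funepos_ge0 _)) (H _ mn (funeneg_ge0 _)).
by congr (_ - _)%E; apply: eq_integral => t _; rewrite ?(funeposE, funenegE).
Qed.

Lemma integrable_refl p (D : set R) f : measurable D ->
  mu.-integrable D (EFin \o f) -> mu.-integrable (refl p @^-1` D) (EFin \o (f \o refl p)).
Proof.
move=> mD /integrableP[mf fi]; apply/integrableP; split.
  exact: measurable_fun_refl mD mf.
rewrite (integral_refl p) // in fi.
exact: measurableT_comp.
Qed.

Lemma Rintegral_refl p a b f : measurable_fun `[a, b] f ->
  \int[mu]_(t in `[a, b]) f t = \int[mu]_(t in `[p - b, p - a]) f (p - t).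
Proof.
move=> mf; rewrite /Rintegral -refl_itv -(@integral_refl p _ (EFin \o f))//.
exact/measurable_EFinP.
Qed.

(** Square integrable functions on an interval. *)
Definition L2 a b f := measurable_fun `[a, b] f /\
  mu.-integrable `[a, b] (fun t => ((f t) ^+ 2)%:E).

Lemma L2M_integrable a b f g : L2 a b f -> L2 a b g ->
  mu.-integrable `[a, b] (fun t => (f t * g t)%:E).
Proof.
move=> [mf f2] [mg g2].
have mI : measurable (`[a, b]%classic : set (measurableTypeR R)) by exact: measurable_itv.
have := integrableD mI f2 g2; apply: le_integrable => //.
  by apply/measurable_EFinP; exact: measurable_funM.
move=> t _; rewrite /= lee_fin normrM (@ger0_norm _ (_ + _)) ?addr_ge0 ?sqr_ge0//.
rewrite -(real_normK (num_real (f t))) -(real_normK (num_real (g t))).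
have := sqr_ge0 (`|f t| - `|g t|); have := normr_ge0 (f t); have := normr_ge0 (g t); nra.
Qed.

Lemma L2D a b f g : L2 a b f -> L2 a b g -> L2 a b (fun t => f t + g t).
Proof.
move=> Lf Lg; case: (Lf) => mf f2; case: (Lg) => mg g2; split; first exact: measurable_funD.
have mI : measurable (`[a, b]%classic : set (measurableTypeR R)) by exact: measurable_itv.
have fg := L2M_integrable Lf Lg.
have := integrableD mI (integrableD mI f2 g2) (integrableD mI fg fg).
by apply: eq_integrable => // t _ /=; rewrite -!EFinD; congr EFin; ring.
Qed.

Lemma L2_continuousM a b f g : L2 a b f -> {within `[a, b], continuous g} ->
  L2 a b (fun t => f t * g t).
Proof.
move=> [mf f2] cg.
have mg := within_continuous_measurable cg.
have [C C0 H] := within_continuous_bounded cg.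
have mI : measurable (`[a, b]%classic : set (measurableTypeR R)) by exact: measurable_itv.
split; first exact: measurable_funM.
have := @integrableZl _ _ _ mu _ mI (C ^+ 2) _ f2; apply: le_integrable => //.
  by apply/measurable_EFinP; apply: measurable_funX; exact: measurable_funM.
move=> t /= tab; rewrite lee_fin exprMn mulrC !normrM ler_wpM2r//.
by rewrite (ger0_norm C0) ler_pM// H.
Qed.

Lemma L2_continuous a b f : {within `[a, b], continuous f} -> L2 a b f.
Proof.
move=> cf; split; first exact: within_continuous_measurable.
have := within_continuous_integrable (within_continuousM cf cf).
by apply: eq_integrable => // t _ /=; rewrite expr2.
Qed.

Lemma L2_integrable a b f : L2 a b f -> mu.-integrable `[a, b] (EFin \o f).
Proof.
move=> Lf; have L1 : L2 a b (cst 1) by apply: L2_continuous; apply: within_continuous_pointwise => t _; exact: cst_continuous.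
have := L2M_integrable Lf L1; apply: eq_integrable => //=.
by move=> t _; rewrite mulr1.
Qed.

Lemma L2_sum a b (I : Type) (r : seq I) (F : I -> R -> R) :
  (forall i, L2 a b (F i)) -> L2 a b (fun t => \sum_(i <- r) F i t).
Proof.
move=> H; elim: r => [|i r IH].
  rewrite (_ : (fun t => _) = cst 0); last by apply/funext => t; rewrite big_nil.
  by apply: L2_continuous; apply: within_continuous_pointwise => t _; exact: cst_continuous.
rewrite (_ : (fun t => _) = (fun t => F i t + \sum_(i <- r) F i t)).
  exact: L2D.
by apply/funext => t; rewrite big_cons.
Qed.

End Integrals.

Section LocalIntegrals.
Context {R : realType}.
Local Notation mu := (@lebesgue_measure R).
Implicit Types (f g : R -> R) (a b p : R).

Lemma integrable_setU (A B : set (measurableTypeR R)) (f : R -> \bar R) :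
  measurable A -> measurable B ->
  mu.-integrable A f -> mu.-integrable B f -> mu.-integrable (A `|` B) f.
Proof.
move=> mA mB iA iB.
have mD : measurable (B `\` A) by exact: measurableD.
have iD : mu.-integrable (B `\` A) f by apply: integrableS iB.
have -> : A `|` B = A `|` (B `\` A).
  by apply/seteqP; split=> t /=; have := pselect (A t); tauto.
move/integrableP: iA => [mfA fA]; move/integrableP: iD => [mfD fD].
have mU : measurable_fun (A `|` (B `\` A)) f by apply/measurable_funU.
apply/integrableP; split => //; rewrite ge0_integral_setU //.
- exact: lte_add_pinfty.
- exact: measurableT_comp.
- by apply/disj_setPS => t [? []].
Qed.

(** Integrability on a segment is a local property. *)
Lemma integrable_local a b (f : R -> \bar R) :
  (forall t, t \in `[a, b] -> exists2 d : R, 0 < d &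
    mu.-integrable (`[a, b] `&` `]t - d, t + d[) f) ->
  mu.-integrable `[a, b] f.
Proof.
move=> H.
pose d t := xget 1 [set d : R | 0 < d /\ mu.-integrable (`[a, b] `&` `]t - d, t + d[) f].
have dP t : t \in `[a, b] -> 0 < d t /\ mu.-integrable (`[a, b] `&` `]t - d t, t + d t[) f.
  by move=> /H[e e0 ie]; rewrite /d; case: xgetP => [y -> //|/(_ e)[]].
have := @segment_compact R a b; rewrite compact_cover => /(_ R `[a, b]%classic
  (fun t => `]t - d t, t + d t[%classic)) [||D Dab abD].
- by move=> i _; exact: interval_open.
- move=> t tab; exists t => //=; have [d0 _] := dP t tab.
  by rewrite in_itv /=; apply/andP; split; lra.
pose s := finmap.enum_fset D.
have -> : `[a, b]%classic = `[a, b] `&` \big[setU/set0]_(i <- s) `]i - d i, i + d i[%classic.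
  apply/seteqP; split=> [t tab|t []//]; split => //.
  by rewrite -bigcup_seq; exact: abD.
have : forall i, i \in s -> i \in `[a, b] by move=> i /Dab; rewrite inE.
elim: s => [_|i s IH sab]; first by rewrite big_nil setI0; exact: integrable_set0.
rewrite big_cons setIUr; apply: integrable_setU.
- by apply: measurableI; exact: measurable_itv.
- apply: measurableI; first exact: measurable_itv.
  by apply: bigsetU_measurable => j _; exact: measurable_itv.
- by have [] := dP i (sab i (mem_head _ _)).
- by apply: IH => j js; apply: sab; rewrite in_cons js orbT.
Qed.

Lemma Rintegral_split a b c f : a <= c <= b -> mu.-integrable `[a, b] (EFin \o f) ->
  \int[mu]_(t in `[a, b]) f t =
  \int[mu]_(t in `[a, c]) f t + \int[mu]_(t in `[c, b]) f t.
Proof.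
move=> /andP[ac cb] fi.
have := @Rintegral_itvB R f (BLeft a) (BRight b) c fi.
rewrite !bnd_simp => /(_ ac cb) E.
rewrite -(Rintegral_itv_obnd_cbnd (r := c) (b := BRight b)); last first.
  apply: integrableS fi => //.
  by move=> t /=; rewrite !in_itv /= => /andP[ct ->]; rewrite (le_trans ac (ltW ct)).
by rewrite -E addrC subrK.
Qed.

Lemma Rintegral_FTC a b (f F : R -> R) : a <= b ->
  (forall t, t \in `[a, b] -> is_derive t 1 F (f t)) ->
  {within `[a, b], continuous f} ->
  \int[mu]_(t in `[a, b]) f t = F b - F a.
Proof.
rewrite le_eqVlt => /predU1P[<- _ _|ab dF cf].
  by rewrite set_itv1 Rintegral_set1 subrr.
have cF t : t \in `[a, b] -> {for t, continuous F}.
  by move=> /dF[/derivable1_diffP/differentiable_continuous].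
rewrite /Rintegral (@continuous_FTC2 R f F) //.
  split.
  - by move=> t /subset_itv_oo_cc /dF[].
  - by apply: cvg_at_right_filter; apply: cF; rewrite in_itv /= lexx ltW.
  - by apply: cvg_at_left_filter; apply: cF; rewrite in_itv /= lexx ltW.
by move=> t /subset_itv_oo_cc /dF[_]; rewrite derive1E.
Qed.

Lemma Rintegral_gt0 a b f t0 : a < b -> continuous f ->
  (forall t, t \in `[a, b] -> 0 <= f t) -> t0 \in `[a, b] -> 0 < f t0 ->
  0 < \int[mu]_(t in `[a, b]) f t.
Proof.
move=> ab cf f0 t0ab ft0.
have /nbhs_normP[d /= d0 Hd] : \forall t \near t0, f t0 / 2 < f t.
  by apply: (cvgr_gt (f t0) (cf t0)); rewrite ltr_pdivrMr// ltr_pMr// ltr1n.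
pose c := Num.max a (t0 - d / 2); pose e := Num.min b (t0 + d / 2).
have /andP[at0 t0b] : a <= t0 <= b by move: t0ab; rewrite in_itv.
have d2 : 0 < d / 2 by rewrite divr_gt0.
have ce : c < e by rewrite gt_max !lt_min; apply/andP; split; apply/andP; split; lra.
have fi : mu.-integrable `[a, b] (EFin \o f).
  by apply: within_continuous_integrable; apply: within_continuous_pointwise => t _; exact: cf.
have sub : `[c, e] `<=` `[a, b].
  move=> t /=; rewrite !in_itv /= ge_max le_min.
  by move=> /andP[/andP[-> _] /andP[-> _]].
have fi' : mu.-integrable `[c, e] (EFin \o f).
  by apply: integrableS fi => //.
apply: (@lt_le_trans _ _ (\int[mu]_(t in `[c, e]) f t)).
  apply: (@lt_le_trans _ _ (\int[mu]_(t in `[c, e]) (f t0 / 2))).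
    rewrite Rintegral_cst /=; last exact: measurable_itv.
    by rewrite lebesgue_measure_itv /= lte_fin ce /= mulr_gt0 ?subr_gt0 ?divr_gt0.
  apply: le_Rintegral => //.
    by apply: within_continuous_integrable; exact: within_continuous_cst.
  move=> t; rewrite /= in_itv /= ge_max le_min => /andP[/andP[_ h1] /andP[_ h2]].
  by apply/ltW/Hd => /=; rewrite ltr_norml; apply/andP; split; lra.
have fint A B : mu.-integrable `[A, B] (EFin \o f) ->
    (\int[mu]_(t in `[A, B]) (f t)%:E)%E \is a fin_num.
  by move=> ?; apply: integrable_fin_num => //; exact: measurable_itv.
apply: fine_le; [exact: fint|exact: fint|].
apply: ge0_subset_integral => //.
by have /integrableP[] := fi.
Qed.

(** Indefinite integrals of square integrable functions are continuous. *)
Lemma primitive_within_continuous a b f g : a <= b -> mu.-integrable `[a, b] (EFin \o g) ->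
  (forall t, t \in `[a, b] -> f t = f a + \int[mu]_(s in `[a, t]) g s) ->
  {within `[a, b], continuous f}.
Proof.
move=> ab gi fE.
have c1 := parameterized_integral_continuous ab gi.
have c2 := within_continuousD (@within_continuous_cst R `[a, b]%classic (f a)) c1.
apply: subspace_eq_continuous c2 => t /set_mem tab /=.
exact/esym/fE.
Qed.

End LocalIntegrals.

(** * Symmetry of second derivatives *)

Section Schwarz.
Context {R0 : realType}.

Lemma second_difference_sym (a b c d : R0) : a - b - (c - d) = a - c - (b - d).
Proof. by ring. Qed.

Lemma half_dist_contra (a b z : R0) :
  `|a - z| < `|a - b| / 2 -> `|b - z| < `|a - b| / 2 -> False.
Proof.
move=> h1 h2; have := ler_normD (a - z) (z - b).
rewrite subrKA [`|z - b|]distrC; lra.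
Qed.

End Schwarz.

Section Schwarz.
Context {R : realType} {V : normedModType R}.
Implicit Types (W : normedModType R) (O : set V).

Lemma is_derive_line {W} (f : V -> W) (q u : V) (s : R) :
  derivable f (q + s *: u) u ->
  is_derive s 1 (fun s => f (q + s *: u)) ('D_u f (q + s *: u)).
Proof.
have E : (fun h : R => h^-1 *: (((fun s => f (q + s *: u)) \o shift s) (h *: (1 : R)) - f (q + s *: u)))
   = (fun h => h^-1 *: ((f \o shift (q + s *: u)) (h *: u) - f (q + s *: u))).
  apply/funext => h /=; congr (_ *: (f _ - _)).
  by rewrite [h *: 1]mulr1 scalerDl addrCA.
move=> df; split; first by rewrite /derivable E.
by rewrite /derive E.
Qed.

Lemma derive1_line {W} (f : V -> W) (q u : V) :
  derive1 (fun s : R => f (q + s *: u)) 0 = 'D_u f q.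
Proof.
rewrite /derive1 /derive /=.
by under eq_fun do rewrite scale0r !addr0 [q + _]addrC.
Qed.

(** The second difference of [f] on a parallelogram is a value of the mixed
    derivative, by the mean value theorem in each direction. *)
Lemma rectangle_MVT (f : V -> R) O (p u w : V) (h : R) : 0 < h ->
  (forall x, O x -> differentiable f x) ->
  (forall x, O x -> differentiable ('D_u f) x) ->
  (forall a b, 0 <= a <= h -> 0 <= b <= h -> O (p + a *: u + b *: w)) ->
  exists a b, [/\ 0 <= a <= h, 0 <= b <= h &
    f (p + h *: u + h *: w) - f (p + h *: u) - (f (p + h *: w) - f p) =
    h * h * 'D_w ('D_u f) (p + a *: u + b *: w)].
Proof.
move=> h0 df ddf inO.
have hh : 0 <= h <= h by rewrite lexx ltW.
have zh : 0 <= (0 : R) <= h by rewrite lexx ltW.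
pose g s := f (p + h *: w + s *: u) - f (p + s *: u).
pose dg s := 'D_u f (p + h *: w + s *: u) - 'D_u f (p + s *: u).
have O1 s : 0 <= s <= h -> O (p + h *: w + s *: u).
  by move=> sh; rewrite addrAC; exact: inO.
have O2 s : 0 <= s <= h -> O (p + s *: u).
  by move=> sh; have := inO s 0 sh zh; rewrite scale0r addr0.
have gD s : 0 <= s <= h -> is_derive s 1 g (dg s).
  move=> sh; apply: is_deriveB; apply: is_derive_line; apply: diff_derivable.
    by apply: df; exact: O1.
  by apply: df; exact: O2.
have sub s : s \in `]0, h[ -> 0 <= s <= h.
  by rewrite in_itv /= => /andP[s0 sh]; rewrite !ltW.
have cont (k dk : R -> R) : (forall s, 0 <= s <= h -> is_derive s 1 k (dk s)) ->
    {within `[0, h], continuous k}.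
  move=> kD; apply: within_continuous_pointwise => s; rewrite in_itv /=.
  by move=> /kD[/derivable1_diffP/differentiable_continuous].
have [a ah] := @MVT R g dg 0 h h0 (fun s sh => gD s (sub s sh)) (cont g dg gD).
rewrite subr0 => gE.
have ah' := sub _ ah.
pose k s := 'D_u f (p + a *: u + s *: w).
pose dk s := 'D_w ('D_u f) (p + a *: u + s *: w).
have kD s : 0 <= s <= h -> is_derive s 1 k (dk s).
  move=> sh; apply: (@is_derive_line _ ('D_u f)); apply: diff_derivable.
  by apply: ddf; exact: inO.
have [b bh] := @MVT R k dk 0 h h0 (fun s sh => kD s (sub s sh)) (cont k dk kD).
rewrite subr0 => kE.
have bh' := sub _ bh.
exists a, b; split => //.
have : dg a = h * dk b.
  by rewrite mulrC -kE /dg /k scale0r addr0 [p + h *: w + _]addrAC.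
rewrite -/(dk b) -mulrA => <-; rewrite mulrC -gE /g scale0r !addr0 [p + h *: w + _]addrAC.
by rewrite !opprB.
Qed.

(** Schwarz's theorem: the second difference does not depend on the order of
    the directions, and its quotient by [h * h] is close to both mixed
    derivatives at [p]. *)
Lemma derive_sym (f : V -> R) O (p u w : V) : open O -> Ck_on 2 O f -> O p ->
  'D_u ('D_w f) p = 'D_w ('D_u f) p.
Proof.
move=> oO [df Df] Op; apply/eqP; rewrite -subr_eq0; apply/negPn/negP => ne.
set X := 'D_u ('D_w f); set Y := 'D_w ('D_u f).
have cX : {for p, continuous X} by have [_ /(_ u) /(_ p Op)] := Df w.
have cY : {for p, continuous Y} by have [_ /(_ w) /(_ p Op)] := Df u.
pose e := `|X p - Y p| / 2.
have e0 : 0 < e by rewrite divr_gt0// normr_gt0.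
have nX : \forall x \near p, `|X p - X x| < e by move/cvgrPdist_lt: cX => /(_ _ e0).
have nY : \forall x \near p, `|Y p - Y x| < e by move/cvgrPdist_lt: cY => /(_ _ e0).
have nO : \forall x \near p, O x by exact: open_nbhs_nbhs.
have /nbhs_normP[r /= r0 Hr] : \forall x \near p,
  [/\ O x, `|X p - X x| < e & `|Y p - Y x| < e] by apply: filterS3 nO nX nY => x; split.
pose N := `|u| + `|w| + 1.
have N0 : 0 < N by rewrite ltr_wpDl ?addr_ge0.
pose h := r / N.
have h0 : 0 < h by rewrite divr_gt0.
have Hin a b (u' w' : V) : `|u'| + `|w'| + 1 = N ->  0 <= a <= h -> 0 <= b <= h ->
  [/\ O (p + a *: u' + b *: w'), `|X p - X (p + a *: u' + b *: w')| < e
    & `|Y p - Y (p + a *: u' + b *: w')| < e].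
  move=> NE /andP[a0 ah] /andP[b0 bh]; apply: Hr => /=.
  rewrite -addrA opprD addrA subrr add0r normrN.
  apply: (le_lt_trans (ler_normD _ _)); rewrite !normrZ !ger0_norm//.
  have hN : h * N = r by rewrite divfK// gt_eqF.
  rewrite -hN -NE !mulrDr mulr1.
  by apply: ltr_pwDr => //; apply: lerD; apply: ler_wpM2r.
have HinO a b u' w' NE ah bh := let: And3 H _ _ := Hin a b u' w' NE ah bh in H.
have [a [b [ah bh E1]]] := @rectangle_MVT f O p u w h h0 df (fun x Ox => (Df u).1 x Ox)
  (fun a b => HinO a b u w erefl).
have NE : `|w| + `|u| + 1 = N by rewrite /N [`|w| + _]addrC.
have [c [d [ch dh E2]]] := @rectangle_MVT f O p w u h h0 df (fun x Ox => (Df w).1 x Ox)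
  (fun a b => HinO a b w u NE).
have [_ _ H1] := Hin a b u w erefl ah bh.
have [_ H2 _] := Hin c d w u NE ch dh.
have E : Y (p + a *: u + b *: w) = X (p + c *: w + d *: u).
  have hn0 : h * h != 0 by rewrite mulf_neq0// gt_eqF.
  apply: (mulfI hn0); rewrite [p + h *: w + _]addrAC in E2.
  have S := second_difference_sym (f (p + h *: u + h *: w)) (f (p + h *: u)) (f (p + h *: w)) (f p).
  exact: (etrans (esym E1) (etrans S E2)).
rewrite E in H1; exact: half_dist_contra H2 H1.
Qed.

End Schwarz.

(** * Tangent vectors and the fibre Hessian in a chart *)

Section DirectionalDerivatives.
Context {R : realType}.
Implicit Types V W X : normedModType R.

Lemma derive_comp {V W X} (f : V -> W) (g : W -> X) x v :
  differentiable f x -> differentiable g (f x) ->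
  'D_v (g \o f) x = 'D_('D_v f x) g (f x).
Proof.
move=> df dg; rewrite (deriveE _ dg) (deriveE _ df) deriveE; last exact: differentiable_comp.
by rewrite diff_comp.
Qed.

Lemma derive1_comp_mx {V W} (f : R -> V) (g : V -> W) t :
  differentiable f t -> differentiable g (f t) ->
  derive1 (g \o f) t = 'D_(derive1 f t) g (f t).
Proof. by move=> df dg; rewrite !derive1E derive_comp. Qed.

Lemma derive_lin {V W} (f : V -> W) x v w (a b : R) : differentiable f x ->
  'D_(a *: v + b *: w) f x = a *: 'D_v f x + b *: 'D_w f x.
Proof. by move=> df; rewrite !(deriveE _ df) linearD !linearZ. Qed.

Lemma derive_lin_sum {V W} (f : V -> W) x m (a : 'I_m -> R) (v : 'I_m -> V) :
  differentiable f x ->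
  'D_(\sum_i a i *: v i) f x = \sum_i a i *: 'D_(v i) f x.
Proof.
move=> df; rewrite (deriveE _ df) linear_sum; apply: eq_bigr => i _.
by rewrite linearZ (deriveE _ df).
Qed.

End DirectionalDerivatives.

Section Tangent.
Context {R : realType} {n : nat} {M : smooth_manifold R n}.
Implicit Types (x : M) (v w : tvec M) (i j : cidx M).

(** Change of coordinates from the chart [i] to the chart [j]. *)
Definition transition i j (y : 'rV[R]_n) : 'rV[R]_n := chart j (chart_inv i y).

Lemma chart_overlap_open i j : open (chart i @` (cdom i `&` cdom (M := M) j)).
Proof.
have -> : chart i @` (cdom i `&` cdom j) =
    (chart i @` cdom i) `&` (chart_inv i @^-1` cdom (M := M) j).
  apply/seteqP; split=> [_ [x [xi xj] <-]|y [[x xi <-]]] /=.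
    by split; [exists x|rewrite chartK].
  by rewrite chartK // => xj; exists x.
rewrite openE => y [yi yj].
have h1 : nbhs y (chart i @` cdom (M := M) i).
  by apply: open_nbhs_nbhs; split => //; exact: chart_image_open.
have h2 : nbhs y (chart_inv i @^-1` cdom (M := M) j).
  apply: (chart_inv_continuous yi).
  by apply: open_nbhs_nbhs; split => //; exact: cdom_open.
exact: filterI.
Qed.

Lemma transition_differentiable i j x : cdom i x -> cdom j x ->
  differentiable (@transition i j) (chart i x).
Proof.
move=> xi xj; apply: (smooth_on_differentiable (@chart_transition _ _ M i j)).
by exists x.
Qed.

(** The right-hand side is the identity only on the image of the chart. *)
Lemma transition_id i x : cdom i x -> \forall y \near chart i x, y = transition i i y.
Proof.
move=> xi; have := near_open_eq (f := id) (g := transition i i) (x := chart i x)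
  (@chart_image_open _ _ M i).
by apply; [move=> _ [z zi <-]; rewrite /transition chartK|exists x].
Qed.

Lemma tangent_out x v i : tangent x v -> ~ cdom i x -> v i = 0.
Proof. by case=> + _; exact. Qed.

Lemma tangent_lin x v w (a b : R) : tangent x v -> tangent x w ->
  tangent x (a *: v + b *: w).
Proof.
move=> [v0 vT] [w0 wT]; split=> [i xi|i j xi xj].
  by rewrite !fctE v0 // w0 // !scaler0 addr0.
rewrite [LHS]/(a *: v j + b *: w j) [(_ + _) i]/(a *: v i + b *: w i).
rewrite (derive_lin _ _ _ _ (transition_differentiable xi xj)).
by rewrite (vT i j xi xj) (wT i j xi xj).
Qed.

Lemma tangentZ x v (a : R) : tangent x v -> tangent x (a *: v).
Proof. by move=> vT; rewrite -[a *: v]addr0 -(scale0r v); exact: tangent_lin. Qed.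

Lemma tangentD x v w : tangent x v -> tangent x w -> tangent x (v + w).
Proof. by move=> vT wT; rewrite -(scale1r v) -(scale1r w); exact: tangent_lin. Qed.

Lemma tangentN x v : tangent x v -> tangent x (- v).
Proof. by rewrite -scaleN1r; exact: tangentZ. Qed.

Lemma tangent0 x : tangent x (0 : tvec M).
Proof. by split=> // i j _ _; rewrite derive0. Qed.

Lemma tvec_of_chart x v i : tangent x v -> cdom i x -> tvec_of i x (v i) = v.
Proof.
move=> [v0 vT] xi; apply/funext => j; rewrite /tvec_of.
by case: ifPn => [/set_mem xj|/negP xj]; [rewrite -vT|rewrite v0// => /mem_set].
Qed.

Lemma tvec_ofE x (v : 'rV[R]_n) i : cdom i x -> tvec_of i x v i = v.
Proof.
move=> xi; rewrite /tvec_of ifT ?mem_set//.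
have := near_eq_derive v (transition_id xi); rewrite derive_id => {2}->.
by [].
Qed.

Lemma tvec_of_tangent x (v : 'rV[R]_n) i : cdom i x -> tangent x (tvec_of i x v).
Proof.
move=> xi; split=> [j xj|j k xj xk]; first by rewrite /tvec_of ifF //; apply/negP => /set_mem.
rewrite /tvec_of !ifT ?mem_set //.
have dij := transition_differentiable xi xj; have dik := transition_differentiable xi xk.
have E : chart j x = transition i j (chart i x) by rewrite /transition chartK.
have djk := transition_differentiable xj xk.
rewrite -/(transition i j) -/(transition i k) -/(transition j k).
rewrite E in djk *.
rewrite -(derive_comp _ dij djk); apply: near_eq_derive.
apply: (near_open_eq (@chart_overlap_open i j)); last by exists x.
by move=> _ [z [zi zj] <-]; rewrite /transition /= !chartK.
Qed.

Lemma velocityE (c : R -> M) t i : cdom i (c t) ->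
  velocity c t i = derive1 (fun s => chart i (c s)) t.
Proof. by move=> it; rewrite /velocity ifT //; exact/mem_set. Qed.

Lemma velocity_out (c : R -> M) t i : ~ cdom i (c t) -> velocity c t i = 0.
Proof. by move=> it; rewrite /velocity ifF //; apply/negP => /set_mem. Qed.

Lemma velocity_tangent (c : R -> M) t : {for t, continuous c} ->
  (forall i, cdom i (c t) -> differentiable (fun s => chart i (c s)) t) ->
  tangent (c t) (velocity c t).
Proof.
move=> cc dc; split=> [i|i j xi xj]; first exact: velocity_out.
rewrite (velocityE xi) (velocityE xj).
rewrite -/(transition i j).
rewrite -(derive1_comp_mx (dc i xi) (transition_differentiable xi xj)).
rewrite !derive1E; apply: near_eq_derive.
have : \forall s \near t, cdom i (c s).
  by apply: cc; apply: open_nbhs_nbhs; split => //; exact: cdom_open.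
by apply: filterS => s si; rewrite /transition /= chartK.
Qed.

End Tangent.

Section Hessian.
Context {R : realType} {n : nat} {M : smooth_manifold R n}.
Variable L : lagrangian M.
Hypothesis L_smooth : smooth_lagrangian L.
Implicit Types (x : M) (i j : cidx M).

Local Notation space := ('rV[R]_n * 'rV[R]_n * R)%type.

(** The points (y, v, t) of the phase space whose position lies in the image of
    the chart [i]. *)
Definition phase_dom i : set space := [set p | (chart i @` cdom (M := M) i) p.1.1].

Lemma phase_dom_open i : open (phase_dom i).
Proof.
apply: (@open_comp _ _ (fun p : space => p.1.1)); last exact: chart_image_open.
by move=> p _; apply: (@continuous_comp _ _ _ fst fst); apply: cvg_fst.
Qed.

Lemma lagrangian_chart i x (v : tvec M) t : cdom i x -> tangent x v ->
  L x v t = local_lagrangian L i (chart i x, v i, t).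
Proof. by move=> xi vT; rewrite /local_lagrangian /= chartK // tvec_of_chart. Qed.

(** The direction of the phase space along the fibre, with coordinates [u]. *)
Definition vert (u : 'rV[R]_n) : space := ((0, u), 0).

Lemma fibre_hessian_chart i x (v : tvec M) t (u w : tvec M) : cdom i x ->
  tangent x v -> tangent x u -> tangent x w ->
  fibre_hessian L x v t u w =
  'D_(vert (u i)) ('D_(vert (w i)) (local_lagrangian L i)) (chart i x, v i, t).
Proof.
move=> xi vT uT wT; rewrite /fibre_hessian -derive1_line; congr (derive1 _ 0).
apply/funext => a.
rewrite -derive1_line; congr (derive1 _ 0); apply/funext => b.
have T : tangent x (v + a *: u + b *: w).
  exact: (tangentD (tangentD vT (tangentZ a uT)) (tangentZ b wT)).
rewrite (lagrangian_chart _ xi T); congr (local_lagrangian L i _).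
rewrite /vert /=.
by congr (_, _, _); rewrite /= ?scaler0 ?addr0 // [b *: 0]mulr0 [a *: 0]mulr0 !addr0.
Qed.

(** The matrix of the fibre Hessian in the chart [i], at a point of the phase
    space given in coordinates. *)
Definition hess i (p : space) : 'M[R]_n :=
  \matrix_(k, l) 'D_(vert (delta_mx 0 k)) ('D_(vert (delta_mx 0 l)) (local_lagrangian L i)) p.

Lemma vert_sum (u : 'rV[R]_n) : vert u = \sum_k u 0 k *: vert (delta_mx 0 k).
Proof.
have vertD (u' w' : 'rV[R]_n) : vert (u' + w') = vert u' + vert w'.
  by rewrite /vert; congr (_, _, _); rewrite /= addr0.
have vertZ (a : R) (u' : 'rV[R]_n) : vert (a *: u') = a *: vert u'.
  by rewrite /vert; congr (_, _, _); rewrite /= ?scaler0 // [a *: 0]mulr0.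
rewrite {1}[u]row_sum_delta (big_morph vert vertD (erefl _)).
by apply: eq_bigr => k _; rewrite vertZ.
Qed.

(** The bilinear form with matrix [H]. *)
Definition bform (H : 'M[R]_n) (u w : 'rV[R]_n) : R := (u *m H *m w^T) 0 0.

Lemma bformE (H : 'M[R]_n) (u w : 'rV[R]_n) : bform H u w = \sum_k \sum_l u 0 k * w 0 l * H k l.
Proof.
rewrite /bform mxE exchange_big /=; apply: eq_bigr => l _.
rewrite !mxE mulr_suml; by apply: eq_bigr => k _; ring.
Qed.

Lemma local_lagrangian_smooth i : smooth_on (phase_dom i) (local_lagrangian L i).
Proof. exact: L_smooth. Qed.

Lemma hessE i (p : space) (u w : 'rV[R]_n) : phase_dom i p ->
  'D_(vert u) ('D_(vert w) (local_lagrangian L i)) p = bform (hess i p) u w.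
Proof.
move=> ip; have oi := @phase_dom_open i.
have d1 q : phase_dom i q -> differentiable (local_lagrangian L i) q.
  exact: smooth_on_differentiable (@local_lagrangian_smooth i).
have d2 (v : space) q : phase_dom i q -> differentiable ('D_v (local_lagrangian L i)) q.
  exact: smooth_on_differentiable (smooth_on_derive v (@local_lagrangian_smooth i)).
have E : \forall q \near p, 'D_(vert w) (local_lagrangian L i) q =
    (\sum_l w 0 l \*: 'D_(vert (delta_mx 0 l)) (local_lagrangian L i)) q.
  apply: near_open_eq oi _ ip => q iq; rewrite (vert_sum w) (derive_lin_sum _ _ (d1 q iq)).
  by rewrite fct_sumE.
rewrite (near_eq_derive _ E) derive_sum; last first.
  by move=> l; apply: diff_derivable; apply: differentiableZ; exact: d2.
rewrite bformE exchange_big; apply: eq_bigr => l _.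
rewrite deriveZ; last by apply: diff_derivable; exact: d2.
rewrite (vert_sum u) (derive_lin_sum _ _ (d2 _ p ip)) scaler_sumr.
apply: eq_bigr => k _; rewrite mxE /GRing.scale /=; ring.
Qed.

Lemma hess_sym i (p : space) : phase_dom i p -> (hess i p)^T = hess i p.
Proof.
move=> ip; apply/matrixP => k l; rewrite !mxE.
exact: (derive_sym _ _ (@phase_dom_open i) (@local_lagrangian_smooth i 2%N) ip).
Qed.

Lemma hess_differentiable i (p : space) k l : phase_dom i p ->
  differentiable (fun q => hess i q k l) p.
Proof.
move=> ip; rewrite (_ : (fun q => _) =
  'D_(vert (delta_mx 0 k)) ('D_(vert (delta_mx 0 l)) (local_lagrangian L i))).
  apply: smooth_on_differentiable ip.
  by do 2 apply: smooth_on_derive; exact: local_lagrangian_smooth.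
by apply/funext => q; rewrite mxE.
Qed.

End Hessian.

(** * The metric along a curve *)

Section Bform.
Context {R : realType} {n : nat}.
Implicit Types (H G : 'M[R]_n) (u v w : 'rV[R]_n).

Lemma bformDl H u v w : bform H (u + v) w = bform H u w + bform H v w.
Proof. by rewrite /bform !mulmxDl mxE. Qed.

Lemma bformDr H u v w : bform H u (v + w) = bform H u v + bform H u w.
Proof. by rewrite /bform linearD mulmxDr mxE. Qed.

Lemma bformZl H (a : R) u w : bform H (a *: u) w = a * bform H u w.
Proof. by rewrite /bform -!scalemxAl mxE. Qed.

Lemma bformZr H (a : R) u w : bform H u (a *: w) = a * bform H u w.
Proof. by rewrite /bform linearZ -scalemxAr mxE. Qed.

Lemma bformC H u w : H^T = H -> bform H u w = bform H w u.
Proof.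
move=> HT; rewrite !bformE exchange_big; apply: eq_bigr => k _; apply: eq_bigr => l _.
have -> : H l k = H k l by rewrite -{1}HT mxE.
by rewrite [u 0 l * _]mulrC.
Qed.

End Bform.

Section Derive1.
Context {R : realType}.

Lemma derive1_shift {W : normedModType R} (f : R -> W) (a t : R) :
  derive1 (fun s => f (s + a)) t = derive1 f (t + a).
Proof. by rewrite /derive1; under eq_fun do rewrite -addrA. Qed.

Lemma derive1_reflect {W : normedModType R} (f : R -> W) (t : R) :
  differentiable f (- t) -> derive1 (fun s => f (- s)) t = - derive1 f (- t).
Proof.
move=> df; have dN : is_derive t 1 (fun s : R => - s) (- 1) by exact: is_deriveN.
have dn : differentiable (fun s : R => - s) t by apply/derivable1_diffP; case: dN.
rewrite (derive1_comp_mx (f := fun s : R => - s) dn df) derive1E.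
rewrite (@derive_val _ _ _ _ _ _ _ dN) derive1E.
by rewrite !(deriveE _ df) linearN.
Qed.

End Derive1.

Section MetricAlong.
Context {R : realType} {n : nat} {M : smooth_manifold R n}.
Variables (L : lagrangian M) (c : R -> M).
Hypothesis L_smooth : smooth_lagrangian L.
Hypothesis c_smooth : smooth_into setT c.
Implicit Types (i j : cidx M) (t : R).

Local Notation dom i := (c @^-1` cdom i).

Lemma dom_open i : open (dom i).
Proof.
apply: open_comp; last exact: cdom_open.
by move=> t _; exact: c_smooth.1.
Qed.

Lemma near_dom i t : dom i t -> \forall s \near t, dom i s.
Proof. by move=> it; apply: open_nbhs_nbhs; split => //; exact: dom_open. Qed.

(** The curve in the chart [i]. *)
Definition cchart i t : 'rV[R]_n := chart i (c t).

Lemma cchart_smooth i : smooth_on (dom i) (cchart i).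
Proof. by move=> k; apply: Ck_on_sub (c_smooth.2 i k) => t it; split. Qed.

(** The lift of the curve to the phase space, in the chart [i]. *)
Definition jet i t : 'rV[R]_n * 'rV[R]_n * R := (cchart i t, derive1 (cchart i) t, t).

Lemma jet_dom i t : dom i t -> phase_dom i (jet i t).
Proof. by move=> it; exists (c t). Qed.

Lemma jet_differentiable i t : dom i t -> differentiable (jet i) t.
Proof.
move=> it; apply: differentiable_pair; last exact: ex_diff.
apply: differentiable_pair.
  exact: smooth_on_differentiable (@cchart_smooth i) it.
exact: smooth_on_differentiable (smooth_on_derive1 (@cchart_smooth i)) it.
Qed.

Lemma velocity_curve_tangent t : tangent (c t) (velocity c t).
Proof.
apply: velocity_tangent; first exact: c_smooth.1.
by move=> i it; exact: smooth_on_differentiable (@cchart_smooth i) it.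
Qed.

(** Gram matrix of the metric in the chart [i]. *)
Definition gram i t : 'M[R]_n := hess L i (jet i t).

Lemma metric_chart i t (u w : tvec M) : dom i t -> tangent (c t) u -> tangent (c t) w ->
  metric L c t u w = bform (gram i t) (u i) (w i).
Proof.
move=> it uT wT; rewrite /metric (fibre_hessian_chart _ _ it (velocity_curve_tangent t) uT wT).
by rewrite (velocityE it) -hessE //; last exact: jet_dom.
Qed.

Lemma gram_sym i t : dom i t -> (gram i t)^T = gram i t.
Proof. by move=> it; apply: hess_sym => //; exact: jet_dom. Qed.

Lemma gram_pos i t (v : 'rV[R]_n) : fibrewise_convex L -> dom i t -> v != 0 ->
  0 < bform (gram i t) v v.
Proof.
move=> Lc it v0; have vT := tvec_of_tangent v it.
have := @Lc (c t) (velocity c t) t _ (velocity_curve_tangent t) vT.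
rewrite -/(metric L c t _ _) (metric_chart it vT vT) (tvec_ofE v it); apply => E.
by move/eqP: v0; apply; rewrite -(tvec_ofE v it) E.
Qed.

Lemma gram_coord_differentiable i t k l : dom i t -> differentiable (fun s => gram i s k l) t.
Proof.
move=> it; apply: (@differentiable_comp _ _ _ _ (jet i) (fun p => hess L i p k l)).
  exact: jet_differentiable.
by apply: hess_differentiable => //; exact: jet_dom.
Qed.

Lemma metricZl t (a : R) (u w : tvec M) : tangent (c t) u -> tangent (c t) w ->
  metric L c t (a *: u) w = a * metric L c t u w.
Proof.
have [i it] := cdom_cover (c t) => uT wT.
rewrite (metric_chart it (tangentZ a uT) wT) (metric_chart it uT wT).
exact: bformZl.
Qed.

Lemma metricC t (u w : tvec M) : tangent (c t) u -> tangent (c t) w ->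
  metric L c t u w = metric L c t w u.
Proof.
have [i it] := cdom_cover (c t) => uT wT.
rewrite (metric_chart it uT wT) (metric_chart it wT uT).
exact: bformC (gram_sym it).
Qed.

Lemma metricZr t (a : R) (u w : tvec M) : tangent (c t) u -> tangent (c t) w ->
  metric L c t u (a *: w) = a * metric L c t u w.
Proof.
move=> uT wT; rewrite (metricC uT (tangentZ a wT)) (metricZl a wT uT).
by rewrite (metricC wT uT).
Qed.

Lemma metric0l t (w : tvec M) : tangent (c t) w -> metric L c t 0 w = 0.
Proof.
move=> wT; have := metricZl 0 (tangent0 (c t)) wT.
by rewrite scale0r mul0r.
Qed.

Lemma metric_ge0 t (u : tvec M) : fibrewise_convex L -> tangent (c t) u ->
  0 <= metric L c t u u.
Proof.
move=> Lc uT; have [->|u0] := pselect (u = 0); first by rewrite (metric0l (tangent0 (c t))).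
exact/ltW/(Lc _ _ _ _ (velocity_curve_tangent t) uT u0).
Qed.

Lemma metric_fields_differentiable (xi eta : R -> tvec M) t :
  smooth_field c xi -> smooth_field c eta ->
  differentiable (fun s => metric L c s (xi s) (eta s)) t.
Proof.
move=> [xT xS] [eT eS]; have [i it] := cdom_cover (c t).
have E : \forall s \near t,
    (\sum_k \sum_l (fun s => xi s i 0 k * eta s i 0 l * gram i s k l)) s =
    metric L c s (xi s) (eta s).
  apply: filterS (near_dom it) => s si.
  rewrite (metric_chart si (xT s) (eT s)) bformE fct_sumE; apply: eq_bigr => k _.
  by rewrite fct_sumE.
apply: near_eq_differentiable E _.
have dx := smooth_on_differentiable (xS i) it; have de := smooth_on_differentiable (eS i) it.
apply: differentiable_sum => k; apply: differentiable_sum => l.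
have dk := @differentiable_coord_comp _ _ _ _ _ 0 k _ dx.
have dl := @differentiable_coord_comp _ _ _ _ _ 0 l _ de.
exact: differentiableM (differentiableM dk dl) (gram_coord_differentiable k l it).
Qed.

End MetricAlong.

(** * Smooth fields and the covariant derivative *)

Section Fields.
Context {R : realType} {n : nat} {M : smooth_manifold R n}.
Variables (L : lagrangian M) (c : R -> M) (tau : R) (G U : mx_family M).
Hypothesis L_smooth : smooth_lagrangian L.
Hypothesis c_smooth : smooth_into setT c.
Hypothesis D_metric : metric_connection L c tau G.
Hypothesis U_symmetric : symmetric_endomorphism L c tau U.
Implicit Types (i j : cidx M) (t : R).

Local Notation dom i := (c @^-1` cdom i).

Lemma covDE (xi : R -> tvec M) t i : dom i t ->
  covD c G xi t i = derive1 (fun s => xi s i) t + xi t i *m G i t.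
Proof. by move=> it; rewrite /covD ifT //; exact/mem_set. Qed.

Lemma covD_tangent (xi : R -> tvec M) t : smooth_field c xi ->
  tangent (c t) (covD c G xi t).
Proof. by move=> xS; case: D_metric => _ + _; apply. Qed.

Lemma Ck_on_mulmx k (O : set R) (f : R -> 'rV[R]_n) (A : R -> 'M[R]_n) : open O ->
  Ck_on k O f -> Ck_on k O A -> Ck_on k O (fun t => f t *m A t).
Proof.
move=> oO Cf CA; apply: Ck_on_mx => // i l.
have H : Ck_on k O (fun t => \sum_j f t i j * A t j l).
  by apply: Ck_on_sum => // j; apply: Ck_onM => //; exact: Ck_on_coord.
by apply: Ck_on_ext oO _ H => t _; rewrite mxE.
Qed.

Lemma covD_smooth (xi : R -> tvec M) : smooth_field c xi -> smooth_field c (covD c G xi).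
Proof.
move=> xS; split=> [t|i k]; first exact: covD_tangent.
have oi := dom_open c_smooth (i:=i).
have Gs : smooth_on (dom i) (G i) by case: D_metric => -[+ _] _ _; apply.
have xs := xS.2 i.
have H : Ck_on k (dom i) (fun t => derive1 (fun s => xi s i) t + xi t i *m G i t).
  by apply: Ck_onD => //; [exact: smooth_on_derive1|exact: Ck_on_mulmx].
by apply: Ck_on_ext oi _ H => t it; rewrite covDE.
Qed.

Lemma mx_apply_smooth (xi : R -> tvec M) : smooth_field c xi ->
  smooth_field c (fun t => mx_apply U t (xi t)).
Proof.
case: U_symmetric => -[Us _] UT _ [xT xS]; split=> [t|i k]; first exact: UT.
exact: Ck_on_mulmx (dom_open c_smooth (i:=i)) (xS i k) (Us i k).
Qed.

(** The integrand of the index form on a pair of smooth fields. *)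
Definition index_density (xi eta : R -> tvec M) t : R :=
  metric L c t (covD c G xi t) (covD c G eta t) +
  metric L c t (mx_apply U t (xi t)) (eta t).

Lemma index_density_continuous (xi eta : R -> tvec M) :
  smooth_field c xi -> smooth_field c eta -> continuous (index_density xi eta).
Proof.
move=> xS eS t; apply: differentiable_continuous; apply: differentiableD.
  exact: (metric_fields_differentiable L_smooth c_smooth t (covD_smooth xS) (covD_smooth eS)).
exact: (metric_fields_differentiable L_smooth c_smooth t (mx_apply_smooth xS) eS).
Qed.

Lemma covD_eq0 (xi : R -> tvec M) t : (\forall s \near t, xi s = 0) -> covD c G xi t = 0.
Proof.
move=> x0; apply/funext => i; have [it|it] := pselect (dom i t); last first.
  by rewrite /covD ifF //; apply/negP => /set_mem.
rewrite (covDE _ it) (nbhs_singleton x0) mul0mx addr0 derive1E.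
rewrite -[RHS](@derive_cst _ _ _ 0 t 1); apply: near_eq_derive.
by apply: filterS x0 => s ->.
Qed.

Lemma index_density_eq0 (xi eta : R -> tvec M) t : smooth_field c eta ->
  (\forall s \near t, xi s = 0) -> index_density xi eta t = 0.
Proof.
move=> eS x0; rewrite /index_density (covD_eq0 x0) (nbhs_singleton x0).
rewrite (metric0l L_smooth c_smooth (covD_tangent t eS)) add0r.
have -> : mx_apply U t 0 = 0 :> tvec M by apply/funext => i; rewrite /mx_apply mul0mx.
exact: (metric0l L_smooth c_smooth (eS.1 t)).
Qed.

Lemma index_density_chart (xi eta : R -> tvec M) t i : dom i t ->
  smooth_field c xi -> smooth_field c eta ->
  index_density xi eta t =
  bform (gram L c i t) (covD c G xi t i) (covD c G eta t i) +
  bform (gram L c i t) (xi t i *m U i t) (eta t i).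
Proof.
move=> it xS eS; rewrite /index_density.
rewrite (metric_chart L_smooth c_smooth it (covD_tangent t xS) (covD_tangent t eS)).
by rewrite (metric_chart L_smooth c_smooth it ((mx_apply_smooth xS).1 t) (eS.1 t)).
Qed.

(** The field equal to [phi t *: u] in the chart [i]; it makes sense globally
    when [phi] vanishes near every time at which the curve is outside [i]. *)
Definition local_field i (phi : R -> R) (u : 'rV[R]_n) : R -> tvec M :=
  fun t => tvec_of i (c t) (phi t *: u).

(** [phi] is smooth, and vanishes near every time at which the curve is outside
    the chart [i]. *)
Definition supported_in i (phi : R -> R) : Prop :=
  smooth_on setT phi /\ forall t, ~ dom i t -> \forall s \near t, phi s = 0.

Lemma tvec_of0 i (x : M) : tvec_of i x 0 = 0 :> tvec M.
Proof. by apply/funext => j; rewrite /tvec_of derive0 if_same. Qed.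

Lemma local_field_eq0 i phi u t : phi t = 0 -> local_field i phi u t = 0.
Proof. by move=> p0; rewrite /local_field p0 scale0r tvec_of0. Qed.

Lemma local_fieldE i phi u t : dom i t -> local_field i phi u t i = phi t *: u.
Proof. exact: tvec_ofE. Qed.

(** In another chart [j], the coordinates of the field are those of [phi t *: u]
    transformed by the derivative of the transition map along the curve. *)
Lemma local_field_smooth i phi u : supported_in i phi ->
  smooth_field c (local_field i phi u).
Proof.
move=> [ps p0]; split=> [t|j k].
  have [it|it] := pselect (dom i t); first exact: tvec_of_tangent.
  rewrite local_field_eq0; first exact: tangent0.
  exact: nbhs_singleton (p0 t it).
apply: Ck_on_local => t jt; have [it|it] := pselect (dom i t); last first.
  have [Q [oQ Qt] Q0] : exists2 Q : set R, open Q /\ Q t & forall s, Q s -> phi s = 0.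
    have : nbhs t [set s | phi s = 0] by exact: p0.
    by rewrite nbhsE => -[Q [oQ Qt] Q0]; exists Q.
  exists Q => //; apply: Ck_on_ext oQ _ (Ck_on_cst k Q 0) => s Qs.
  by rewrite local_field_eq0 // Q0.
have oQ : open (dom i `&` dom j) by apply: openI; exact: dom_open.
exists (dom i `&` dom j) => //.
pose O := chart i @` (cdom i `&` cdom (M := M) j).
have oO : open O := @chart_overlap_open _ _ M i j.
have H : Ck_on k (dom i `&` dom j)
    (fun t => \sum_l (phi t * u 0 l) *: 'D_(delta_mx 0 l) (@transition _ _ M i j) (cchart c i t)).
  apply: Ck_on_mx => // a b.
  have H1 : Ck_on k (dom i `&` dom j)
      (fun t => \sum_l (phi t * u 0 l) * ('D_(delta_mx 0 l) (@transition _ _ M i j) (cchart c i t)) a b).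
    apply: Ck_on_sum => // l; apply: Ck_onM => //.
      apply: Ck_onM => //; last exact: Ck_on_cst.
      by apply: Ck_on_sub (ps k).
    apply: Ck_on_coord => //.
    apply: (Ck_on_comp (O := dom i `&` dom j) (Q := O) (f := cchart c i)
             (g := 'D_(delta_mx 0 l) (@transition _ _ M i j))) => //.
    - by move=> s [si sj]; exists (c s).
    - by apply: Ck_on_sub (cchart_smooth c_smooth i k) => s [].
    - exact: smooth_on_derive (@chart_transition _ _ M i j) k.
  apply: Ck_on_ext oQ _ H1 => s _; rewrite summxE.
  by apply: eq_bigr => l _; rewrite mxE.
apply: Ck_on_ext oQ _ H => s [si sj].
rewrite /local_field /tvec_of ifT; last exact/mem_set.
rewrite {2}[u]row_sum_delta scaler_sumr.
under [in RHS]eq_bigr do rewrite scalerA.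
by rewrite (derive_lin_sum _ _ (transition_differentiable si sj)).
Qed.

Lemma covD_local_field i phi u t : supported_in i phi -> dom i t ->
  covD c G (local_field i phi u) t i = derive1 phi t *: u + phi t *: (u *m G i t).
Proof.
move=> [ps _] it; rewrite (covDE _ it) (local_fieldE _ _ it) -scalemxAl; congr (_ + _).
have pd : differentiable phi t by exact: smooth_on_differentiable ps _.
rewrite !derive1E -(derive_scalel _ _ pd); apply: near_eq_derive.
by apply: filterS (near_dom c_smooth it) => s si; rewrite local_fieldE.
Qed.

End Fields.

(** * Variations supported in a chart *)

Section Projections.
Context {R : realType}.
Implicit Types V W : normedModType R.

Lemma differentiable_fst {V W} (p : V * W) : differentiable (@fst V W) p.
Proof. by apply: linear_differentiable => q; exact: cvg_fst. Qed.

Lemma differentiable_snd {V W} (p : V * W) : differentiable (@snd V W) p.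
Proof. by apply: linear_differentiable => q; exact: cvg_snd. Qed.

Lemma Ck_on_id {V} k (O : set V) : Ck_on k O (@id V).
Proof.
case: k => [|k]; first by move=> x _; exact: cvg_id.
split=> [x _|v]; first exact: ex_diff.
by rewrite (_ : (fun x => _) = cst v); [exact: Ck_on_cst|apply/funext => x; rewrite derive_id].
Qed.

Lemma Ck_on_time {W} k (O : set R) (f : R -> W) :
  Ck_on k O f -> Ck_on k [set p : R * R * R | O p.2] (fun p => f p.2).
Proof.
apply: (Ck_on_affine (l := @snd (R * R)%type R) (l0 := @snd (R * R)%type R)) => //.
by move=> x; exact: differentiable_snd.
Qed.

Lemma Ck_on_param1 k (O : set (R * R * R)) : Ck_on k O (fun p => p.1.1).
Proof.
apply: (@Ck_on_sub _ _ _ _ ((fun p : R * R * R => p.1.1) @^-1` setT)) => //.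
apply: (Ck_on_affine (l := fun p : R * R * R => p.1.1) (l0 := fun p => p.1.1) (f := id)) => //.
  move=> x; apply: (@differentiable_comp _ _ _ _ fst fst); exact: differentiable_fst.
exact: Ck_on_id.
Qed.

Lemma Ck_on_param2 k (O : set (R * R * R)) : Ck_on k O (fun p => p.1.2).
Proof.
apply: (@Ck_on_sub _ _ _ _ ((fun p : R * R * R => p.1.2) @^-1` setT)) => //.
apply: (Ck_on_affine (l := fun p : R * R * R => p.1.2) (l0 := fun p => p.1.2) (f := id)) => //.
  move=> x; apply: (@differentiable_comp _ _ _ _ fst snd).
    exact: differentiable_fst.
  exact: differentiable_snd.
exact: Ck_on_id.
Qed.

Lemma nbhs_time (P : R -> Prop) (p : R * R * R) :
  (\forall t \near p.2, P t) -> \forall q \near p, P q.2.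
Proof.
move=> Pp; exact: (differentiable_continuous (differentiable_snd p) Pp).
Qed.

End Projections.

Section Variation.
Context {R : realType} {n : nat} {M : smooth_manifold R n}.
Variables (c : R -> M) (tau : R).
Hypothesis c_smooth : smooth_into setT c.
Hypothesis c_periodic : forall t, c (t + tau) = c t.

Local Notation dom i := (c @^-1` cdom i).

Variables (i : cidx M) (phi psi : R -> R) (u w : 'rV[R]_n) (e : R).
Hypotheses (e_gt0 : 0 < e) (phiS : supported_in c i phi) (psiS : supported_in c i psi).
Hypotheses (phiP : forall t, phi (t + tau) = phi t) (psiP : forall t, psi (t + tau) = psi t).

(** In the chart [i], the curve is translated by a multiple of [phi u] and a
    multiple of [psi w]; outside the chart it is not modified.  The hypothesis
    [inside] keeps the translated curve in the image of the chart. *)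
Definition varied_chart (p : R * R * R) : 'rV[R]_n :=
  cchart c i p.2 + (p.1.1 * phi p.2) *: u + (p.1.2 * psi p.2) *: w.

Hypothesis inside : forall p, `|p.1.1| < e -> `|p.1.2| < e -> dom i p.2 ->
  (chart i @` cdom (M := M) i) (varied_chart p).

Definition local_variation (p : R * R * R) : M :=
  if c p.2 \in cdom i then chart_inv i (varied_chart p) else c p.2.

Let box : set (R * R * R) := [set p | `|p.1.1| < e /\ `|p.1.2| < e].
Let tdom : set (R * R * R) := [set p | dom i p.2].

Lemma tdom_open : open tdom.
Proof.
rewrite openE => p pi; apply: (nbhs_time (P := fun t => dom i t)).
exact: near_dom.
Qed.

Lemma varied_chart_smooth k : Ck_on k tdom varied_chart.
Proof.
have oT := tdom_open.
have P1 (f : R -> R) : smooth_on setT f -> Ck_on k tdom (fun p => f p.2).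
  move=> fs; apply: (@Ck_on_sub _ _ _ _ [set p : R * R * R | setT p.2]) => //.
  exact: Ck_on_time.
apply: Ck_onD => //; last first.
  apply: Ck_on_scalel => //; apply: Ck_onM => //; first exact: Ck_on_param2.
  exact: P1 psiS.1.
apply: Ck_onD => //.
  by apply: (Ck_on_time (O := dom i)); exact: cchart_smooth.
apply: Ck_on_scalel => //; apply: Ck_onM => //; first exact: Ck_on_param1.
exact: P1 phiS.1.
Qed.

Lemma local_variation_in p : dom i p.2 -> local_variation p = chart_inv i (varied_chart p).
Proof. by move=> pi; rewrite /local_variation ifT //; exact/mem_set. Qed.

Lemma local_variation_eq p : phi p.2 = 0 -> psi p.2 = 0 -> local_variation p = c p.2.
Proof.
move=> f0 s0; rewrite /local_variation /varied_chart f0 s0 !mulr0 !scale0r !addr0.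
by case: ifP => // /set_mem pi; rewrite /cchart chartK.
Qed.

Lemma local_variation_out (p : R * R * R) : ~ dom i p.2 -> \forall q \near p, local_variation q = c q.2.
Proof.
move=> pi; have H : \forall t \near p.2, phi t = 0 /\ psi t = 0.
  exact: filterI (phiS.2 _ pi) (psiS.2 _ pi).
have H2 : \forall q \near p, phi q.2 = 0 /\ psi q.2 = 0.
  exact: (nbhs_time (P := fun t => phi t = 0 /\ psi t = 0) H).
by apply: filterS H2 => q [f0 s0]; exact: local_variation_eq.
Qed.

Lemma local_variation_continuous p : box p -> {for p, continuous local_variation}.
Proof.
move=> [p1 p2]; have [pi|pi] := pselect (dom i p.2); last first.
  have E : \forall q \near p, c q.2 = local_variation q.
    by apply: filterS (local_variation_out pi) => q.
  apply: near_eq_continuous E _; apply: (@continuous_comp (R * R * R)%type R M snd c).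
    exact: differentiable_continuous (differentiable_snd p).
  exact: c_smooth.1.
have E : \forall q \near p, chart_inv i (varied_chart q) = local_variation q.
  by apply: (near_open_eq tdom_open) => // q qi; rewrite local_variation_in.
apply: near_eq_continuous E _; apply: (@continuous_comp _ _ _ varied_chart (chart_inv i)).
  exact: Ck_on_continuous (varied_chart_smooth 0) pi.
by apply: chart_inv_continuous; exact: inside.
Qed.

Lemma local_variation_smooth : smooth_into box local_variation.
Proof.
split=> [p|j k]; first exact: local_variation_continuous.
apply: Ck_on_local => p [pb pj]; have [pi|pi] := pselect (dom i p.2); last first.
  have : \forall q \near p, local_variation q = c q.2 /\ dom j q.2.
    have E := nbhs_singleton (local_variation_out pi).
  have h : dom j p.2 by move: pj; rewrite /preimage /= E.
    apply: filterI (local_variation_out pi) _.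
    exact: (nbhs_time (near_dom c_smooth h)).
  move=> H; have {H} : nbhs p [set q | local_variation q = c q.2 /\ dom j q.2] by [].
  rewrite nbhsE => -[Q [oQ Qp] QE]; exists Q => //.
  have H : Ck_on k Q (fun q => cchart c j q.2).
    apply: (@Ck_on_sub _ _ _ _ [set p : R * R * R | dom j p.2]) => [q /QE[]//|].
    by apply: (Ck_on_time (O := dom j)); exact: cchart_smooth.
  by apply: Ck_on_ext oQ _ H => q /QE[->].
pose O := chart i @` (cdom i `&` cdom (M := M) j).
have oO : open O := @chart_overlap_open _ _ M i j.
have Op : O (varied_chart p).
  have [x xi xE] := inside pb.1 pb.2 pi; exists x => //; split => //.
  by move: pj; rewrite /= local_variation_in // -xE chartK.
have : nbhs p [set q | O (varied_chart q) /\ tdom q].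
  apply: filterI; last by apply: open_nbhs_nbhs; split => //; exact: tdom_open.
  apply: (Ck_on_continuous (varied_chart_smooth 0) pi).
  exact: open_nbhs_nbhs.
rewrite nbhsE => -[Q [oQ Qp] QE]; exists Q => //.
have H : Ck_on k Q (fun q => @transition _ _ M i j (varied_chart q)).
  apply: (Ck_on_comp (O := Q) (Q := O)) => //; first by move=> q /QE[].
    by apply: Ck_on_sub (varied_chart_smooth k) => q /QE[].
  exact: (@chart_transition _ _ M i j k).
by apply: Ck_on_ext oQ _ H => q /QE[_ qi]; rewrite local_variation_in.
Qed.

Lemma local_variation_periodic_variation : periodic_variation c tau e local_variation.
Proof.
split=> //; first exact: local_variation_smooth.
  move=> t; rewrite /local_variation /varied_chart /= !mul0r !scale0r !addr0.
  by case: ifP => // /set_mem ti; rewrite /cchart chartK.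
by move=> a b t _ _; rewrite /local_variation /varied_chart /= /cchart phiP psiP c_periodic.
Qed.

(** The variation fields are the local fields of [phi u] and [psi w]. *)
Lemma velocity_local_variation1 t :
  velocity (fun a => local_variation (a, 0, t)) 0 = local_field c i phi u t.
Proof.
have E0 : local_variation (0, 0, t) = c t.
  by have [_ _ -> _] := local_variation_periodic_variation.
have [ti|ti] := pselect (dom i t); last first.
  have f0 := nbhs_singleton (phiS.2 _ ti); have s0 := nbhs_singleton (psiS.2 _ ti).
  rewrite local_field_eq0 //; apply/funext => j; rewrite /velocity; case: ifP => // _.
  have -> : (fun a => chart j (local_variation (a, 0, t))) = cst (chart j (c t)).
    by apply/funext => a; rewrite local_variation_eq.
  by rewrite derive1_cst.
apply/funext => j; rewrite /velocity /local_field /tvec_of E0; case: ifP => // _.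
have -> : (fun a => chart j (local_variation (a, 0, t))) =
    (fun a => @transition _ _ M i j (cchart c i t + a *: (phi t *: u))).
  apply/funext => a; rewrite local_variation_in // /varied_chart /=.
  by rewrite mul0r scale0r addr0 scalerA.
by rewrite derive1_line.
Qed.

Lemma velocity_local_variation2 t :
  velocity (fun b => local_variation (0, b, t)) 0 = local_field c i psi w t.
Proof.
have E0 : local_variation (0, 0, t) = c t.
  by have [_ _ -> _] := local_variation_periodic_variation.
have [ti|ti] := pselect (dom i t); last first.
  have f0 := nbhs_singleton (phiS.2 _ ti); have s0 := nbhs_singleton (psiS.2 _ ti).
  rewrite local_field_eq0 //; apply/funext => j; rewrite /velocity; case: ifP => // _.
  have -> : (fun b => chart j (local_variation (0, b, t))) = cst (chart j (c t)).
    by apply/funext => a; rewrite local_variation_eq.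
  by rewrite derive1_cst.
apply/funext => j; rewrite /velocity /local_field /tvec_of E0; case: ifP => // _.
have -> : (fun b => chart j (local_variation (0, b, t))) =
    (fun b => @transition _ _ M i j (cchart c i t + b *: (psi t *: w))).
  apply/funext => a; rewrite local_variation_in // /varied_chart /=.
  by rewrite mul0r scale0r addr0 scalerA.
by rewrite derive1_line.
Qed.

End Variation.

(** * Time reversal *)

Section Velocity.
Context {R : realType} {n : nat} {M : smooth_manifold R n}.
Implicit Types (d : R -> M) (t : R).

Lemma velocity_shift d (a t : R) : velocity (fun s => d (s + a)) t = velocity d (t + a).
Proof.
apply/funext => i; have [it|it] := pselect (cdom i (d (t + a))).
  rewrite (velocityE (c := d) it) (velocityE (c := fun s => d (s + a)) it).
  exact: (derive1_shift (fun s => chart i (d s))).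
by rewrite (velocity_out (c := d) it) (velocity_out (c := fun s => d (s + a)) it).
Qed.

Lemma velocity_reflect d t : smooth_into setT d ->
  velocity (fun s => d (- s)) t = - velocity d (- t).
Proof.
move=> dS; apply/funext => i.
have [it|it] := pselect (cdom i (d (- t))); last first.
  transitivity (0 : 'rV[R]_n); first exact: (velocity_out (c := fun s => d (- s)) it).
  by rewrite -[LHS]oppr0; congr (- _); rewrite (velocity_out (c := d) it).
rewrite [RHS]/(- velocity d (- t) i) (velocityE (c := d) it).
rewrite (velocityE (c := fun s => d (- s)) it).
apply: (derive1_reflect (f := fun s => chart i (d s))).
exact: (smooth_on_differentiable (cchart_smooth dS i) it).
Qed.

End Velocity.

Section Reversal.
Context {R : realType} {n : nat} {M : smooth_manifold R n}.
Variables (L : lagrangian M) (tau : R).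
Hypothesis L_smooth : smooth_lagrangian L.
Hypothesis L_periodic : periodic_lagrangian L tau.
Hypothesis L_reversible : reversible_lagrangian L.
Implicit Types (t : R).

Lemma action_density_continuous (d : R -> M) : smooth_into setT d ->
  continuous (fun t => L (d t) (velocity d t) t).
Proof.
move=> dS t; have [i it] := cdom_cover (d t).
have E : \forall s \near t, local_lagrangian L i (jet d i s) = L (d s) (velocity d s) s.
  apply: filterS (near_dom dS it) => s si.
  by rewrite (lagrangian_chart _ s si (velocity_curve_tangent dS s)) (velocityE si).
apply: near_eq_continuous E _; apply: continuous_comp.
  exact: differentiable_continuous (jet_differentiable dS it).
exact: smooth_on_continuous (@local_lagrangian_smooth _ _ _ L L_smooth i) (jet_dom it).
Qed.

(** The action over a period of a periodic curve is invariant under time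
    reversal. *)
Lemma action_reflect (d : R -> M) : smooth_into setT d -> (forall t, d (t + tau) = d t) ->
  action L 0 tau (fun t => d (- t)) = action L 0 tau d.
Proof.
move=> dS dP; pose f t := L (d t) (velocity d t) t.
have cf : continuous f := action_density_continuous dS.
have fP t : f (t + tau) = f t.
  rewrite /f L_periodic ?dP; last by rewrite -(dP t); exact: velocity_curve_tangent.
  rewrite -velocity_shift; congr (L _ (velocity _ t) t).
  by apply/funext => s; rewrite dP.
have mf : measurable_fun `[0, tau] f.
  by apply: within_continuous_measurable; apply: within_continuous_pointwise => t _; exact: cf.
rewrite /action -/(f _) [RHS](Rintegral_refl tau mf) subr0 subrr.
apply: eq_Rintegral => t _.
rewrite (velocity_reflect _ dS) -[tau - t]addrC fP /f.
rewrite L_reversible ?opprK //; exact: tangentN (velocity_curve_tangent dS (- t)).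
Qed.

Variable c : R -> M.
Hypothesis c_smooth : smooth_into setT c.
Hypothesis c_periodic : forall t, c (t + tau) = c t.
Hypothesis c_even : forall t, c (- t) = c t.

Local Notation dom i := (c @^-1` cdom i).

Lemma domN i t : dom i t -> dom i (- t).
Proof. by rewrite /preimage /= c_even. Qed.

Lemma velocity_curveN t : velocity c (- t) = - velocity c t.
Proof.
apply: oppr_inj; rewrite opprK -(velocity_reflect t c_smooth).
by congr (velocity _ t); apply/funext => s; rewrite c_even.
Qed.

Lemma velocity_curveP t : velocity c (t + tau) = velocity c t.
Proof.
rewrite -velocity_shift; congr (velocity _ t).
by apply/funext => s; rewrite c_periodic.
Qed.

Lemma metricP t (u w : tvec M) : tangent (c t) u -> tangent (c t) w ->
  metric L c (t + tau) u w = metric L c t u w.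
Proof.
move=> uT wT; rewrite /metric /fibre_hessian c_periodic velocity_curveP.
congr (derive1 _ 0); apply/funext => a; congr (derive1 _ 0); apply/funext => b.
apply: L_periodic; have vT := velocity_curve_tangent c_smooth t.
exact: (tangentD (tangentD vT (tangentZ a uT)) (tangentZ b wT)).
Qed.

(** The fibre Hessian of a reversible Lagrangian is even: the two velocity
    directions both change sign. *)
Lemma metricN t (u w : tvec M) : tangent (c t) u -> tangent (c t) w ->
  metric L c (- t) u w = metric L c t u w.
Proof.
move=> uT wT; have vT := velocity_curve_tangent c_smooth t.
have uT' := tangentZ (-1) uT; have wT' := tangentZ (-1) wT.
transitivity (metric L c t ((-1) *: u) ((-1) *: w)).
  rewrite /metric /fibre_hessian c_even velocity_curveN.
  congr (derive1 _ 0); apply/funext => a; congr (derive1 _ 0); apply/funext => b.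
  rewrite [RHS]L_reversible.
    congr (L _ _ _); rewrite !opprD !scalerA !mulrN1 !scaleNr !opprK //.
  exact: (tangentD (tangentD vT (tangentZ a uT')) (tangentZ b wT')).
rewrite (metricZl L_smooth c_smooth _ uT wT') (metricZr L_smooth c_smooth _ uT wT).
by rewrite mulrA mulN1r opprK mul1r.
Qed.

Lemma bform_inj (H K : 'M[R]_n) : (forall u w, bform H u w = bform K u w) -> H = K.
Proof.
have E (A : 'M[R]_n) k l : A k l = bform A (delta_mx 0 k) (delta_mx 0 l).
  by rewrite /bform -rowE trmx_delta -colE !mxE.
by move=> h; apply/matrixP => k l; rewrite !E h.
Qed.

Lemma gramN i t : dom i t -> gram L c i (- t) = gram L c i t.
Proof.
move=> it; have itN := domN it; apply: bform_inj => u w.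
have uT := tvec_of_tangent u it; have wT := tvec_of_tangent w it.
have uT' : tangent (c (- t)) (tvec_of i (c t) u) by rewrite c_even.
have wT' : tangent (c (- t)) (tvec_of i (c t) w) by rewrite c_even.
have := metricN uT wT.
rewrite (metric_chart L_smooth c_smooth it uT wT) (metric_chart L_smooth c_smooth itN uT' wT').
by rewrite !(tvec_ofE _ it).
Qed.

End Reversal.

(** * The connection is odd and the potential is even *)

Section PeriodicBump.
Context {R : realType}.
Variable tau : R.
Hypothesis tau_gt0 : 0 < tau.

Lemma flat1_le1 (x : R) : `|flat 1 x| <= 1.
Proof.
rewrite /flat; case: ifP => [x0|_]; last by rewrite normr0.
rewrite hornerC mul1r ger0_norm ?expR_ge0// expR_le1.
by rewrite oppr_le0 invr_ge0 ltW.
Qed.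

(** A bump around [t0] that vanishes near every time not congruent to a point of
    a given neighbourhood of [t0]. *)
Lemma periodic_bump (P : R -> Prop) (t0 : R) : (\forall t \near t0, P t) ->
  exists phi : R -> R, [/\ smooth_on setT phi, forall t, phi (t + tau) = phi t,
    forall t, `|phi t| <= 1, 0 < phi t0 &
    forall t, (forall k : int, ~ P (t + tau *~ k)) -> \forall s \near t, phi s = 0].
Proof.
move=> Pt0; pose P' t := exists k : int, P (t + tau *~ k).
have P'P t : P' (t + tau) = P' t.
  apply/propext; split=> -[k].
    have -> : t + tau + tau *~ k = t + tau *~ (k + 1).
      by rewrite -[tau *~ (k + 1)]mulrzl intrD1 mulrDl mul1r mulrzl -addrA [tau + _]addrC.
    by exists (k + 1).
  have -> : t + tau *~ k = t + tau + tau *~ (k - 1).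
    by rewrite mulrzBr mulr1z -addrA [tau + _]addrC subrK.
  by exists (k - 1).
have P't0 : \forall t \near t0, P' t.
  by apply: filterS Pt0 => t Pt; exists 0; rewrite mulr0z addr0.
(* The level [k] is strictly above [k0], so that the bump vanishes not only at,
   but near the times where [P'] fails. *)
have [k0 k01 H] := bump_localize tau_gt0 P'P P't0.
pose k := (k0 + 1) / 2.
have [k0k k1] : k0 < k /\ k < 1 by rewrite /k; split; lra.
exists (cos_bump tau t0 k); split.
- exact: smooth_bump.
- exact: bump_periodic.
- by move=> t; exact: flat1_le1.
- exact: bump_center_gt0.
move=> t nP; have ct : cos (phase tau t0 t) < k.
  apply: le_lt_trans k0k; rewrite leNgt; apply/negP => /H[l]; exact: nP.
have cc : {for t, continuous (fun s => cos (phase tau t0 s))}.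
  exact: smooth_on_continuous (smooth_cos_phase tau t0) _.
apply: filterS (cvgr_lt _ cc _ ct) => s sk.
apply/eqP/negPn/negP => /bump_neq0; by rewrite ltNge (ltW sk).
Qed.

Lemma Rintegral_periodic_reflect (f : R -> R) : continuous f ->
  (forall t, f (t + tau) = f t) ->
  \int[lebesgue_measure]_(t in `[0, tau]) f (- t) =
  \int[lebesgue_measure]_(t in `[0, tau]) f t.
Proof.
move=> cf fP; have mf : measurable_fun `[0, tau] f.
  by apply: within_continuous_measurable; apply: within_continuous_pointwise => t _; exact: cf.
rewrite [RHS](Rintegral_refl tau mf) subr0 subrr.
by apply: eq_Rintegral => t _; rewrite -[tau - t]addrC fP.
Qed.

(** The mixed second derivative at the origin only depends on the values near the
    origin. *)
Lemma mixed_derive_eq (f g : R -> R -> R) (e : R) : 0 < e ->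
  (forall a b, `|a| < e -> `|b| < e -> f a b = g a b) ->
  derive1 (fun a => derive1 (f a) 0) 0 = derive1 (fun a => derive1 (g a) 0) 0.
Proof.
move=> e0 fg; have near0 : \forall a \near (0 : R), `|a| < e := nbhs0_lt e0.
rewrite !derive1E; apply: near_eq_derive; apply: filterS (near0) => a ae.
rewrite !derive1E; apply: near_eq_derive; apply: filterS (near0) => b be.
exact: fg.
Qed.

End PeriodicBump.

Section Symmetry.
Context {R : realType} {n : nat} {M : smooth_manifold R n}.
Variables (L : lagrangian M) (c : R -> M) (tau : R) (G U : mx_family M).
Hypothesis L_smooth : smooth_lagrangian L.
Hypothesis L_periodic : periodic_lagrangian L tau.
Hypothesis L_reversible : reversible_lagrangian L.
Hypothesis c_smooth : smooth_into setT c.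
Hypothesis c_periodic : forall t, c (t + tau) = c t.
Hypothesis c_even : forall t, c (- t) = c t.
Hypothesis D_metric : metric_connection L c tau G.
Hypothesis U_symmetric : symmetric_endomorphism L c tau U.
Hypothesis DU : represents_second_variation L c tau G U.
Implicit Types (i j : cidx M) (t : R).

Local Notation dom i := (c @^-1` cdom i).
Local Notation mu := (@lebesgue_measure R).

Lemma covD_periodic (xi : R -> tvec M) t : (forall s, xi (s + tau) = xi s) ->
  covD c G xi (t + tau) = covD c G xi t.
Proof.
move=> xP; apply/funext => i; have [it|it] := pselect (dom i t); last first.
  by rewrite /covD !ifF //; apply/negP => /set_mem; rewrite ?c_periodic.
have itP : dom i (t + tau) by rewrite /preimage /= c_periodic.
rewrite (covDE _ _ it) (covDE _ _ itP) xP.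
have -> : G i (t + tau) = G i t by case: D_metric => -[_ GP] _ _; exact: GP.
have E : derive1 (fun s => xi s i) (t + tau) = derive1 (fun s => xi s i) t.
  transitivity (derive1 (fun s => xi (s + tau) i) t).
    exact: (esym (derive1_shift (fun s => xi s i) tau t)).
  by congr (derive1 _ t); apply/funext => s; rewrite xP.
by rewrite E.
Qed.

Lemma mx_apply_periodic t (v : tvec M) : tangent (c t) v ->
  mx_apply U (t + tau) v = mx_apply U t v.
Proof.
move=> vT; apply/funext => i; rewrite /mx_apply; have [it|it] := pselect (dom i t).
  by congr (_ *m _); case: U_symmetric => -[_ UP] _ _; exact: UP.
by rewrite (tangent_out vT it) !mul0mx.
Qed.

Lemma index_density_periodic (xi eta : R -> tvec M) t :
  smooth_field c xi -> smooth_field c eta ->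
  (forall s, xi (s + tau) = xi s) -> (forall s, eta (s + tau) = eta s) ->
  index_density L c G U xi eta (t + tau) = index_density L c G U xi eta t.
Proof.
move=> xS eS xP eP; rewrite /index_density (covD_periodic t xP) (covD_periodic t eP).
rewrite xP eP (mx_apply_periodic (xS.1 t)).
have mP := metricP L_periodic c_smooth c_periodic.
rewrite (mP _ _ _ (covD_tangent D_metric t xS) (covD_tangent D_metric t eS)).
by rewrite (mP _ _ _ ((mx_apply_smooth c_smooth U_symmetric xS).1 t) (eS.1 t)).
Qed.

Lemma supported_reflect i (phi : R -> R) : supported_in c i phi ->
  supported_in c i (fun t => phi (- t)).
Proof.
move=> [ps p0].
have Na : forall h v x : R, - (h *: v + x) = h *: - v + - x.
  by move=> h v x; rewrite opprD scalerN.
have Nd (x : R) : differentiable (fun s : R => - s) x.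
  by apply: (@differentiableN _ _ _ id); exact: ex_diff.
split=> [k|t it]; first exact: (Ck_on_affine (l := fun s : R => - s) Na Nd (ps k)).
have itN : ~ dom i (- t) by rewrite /preimage /= c_even.
exact: (differentiable_continuous (Nd t) (p0 _ itN)).
Qed.

Lemma local_field_reflect i (phi : R -> R) (u : 'rV[R]_n) t :
  local_field c i (fun s => phi (- s)) u t = local_field c i phi u (- t).
Proof. by rewrite /local_field c_even. Qed.

Lemma local_field_periodic i (phi : R -> R) (u : 'rV[R]_n) t :
  (forall s, phi (s + tau) = phi s) ->
  local_field c i phi u (t + tau) = local_field c i phi u t.
Proof. by move=> pP; rewrite /local_field c_periodic pP. Qed.

Section SecondVariation.
Variables (i : cidx M) (phi psi : R -> R) (u w : 'rV[R]_n) (e : R).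
Hypotheses (e_gt0 : 0 < e) (phiS : supported_in c i phi) (psiS : supported_in c i psi).
Hypotheses (phiP : forall t, phi (t + tau) = phi t) (psiP : forall t, psi (t + tau) = psi t).
Hypothesis inside : forall p, `|p.1.1| < e -> `|p.1.2| < e -> dom i p.2 ->
  (chart i @` cdom (M := M) i) (varied_chart c i phi psi u w p).

Local Notation F := (local_variation c i phi psi u w).
Local Notation phi' := (fun t => phi (- t)).
Local Notation psi' := (fun t => psi (- t)).
Local Notation F' := (local_variation c i phi' psi' u w).

Lemma reflect_periodic (f : R -> R) : (forall t, f (t + tau) = f t) ->
  forall t, f (- (t + tau)) = f (- t).
Proof. by move=> fP t; rewrite -(fP (- (t + tau))) opprD subrK. Qed.

Lemma varied_chart_reflect p :
  varied_chart c i phi' psi' u w p = varied_chart c i phi psi u w (p.1, - p.2).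
Proof. by rewrite /varied_chart /cchart /= c_even. Qed.

Lemma inside_reflect p : `|p.1.1| < e -> `|p.1.2| < e -> dom i p.2 ->
  (chart i @` cdom (M := M) i) (varied_chart c i phi' psi' u w p).
Proof.
move=> p1 p2 pi; rewrite varied_chart_reflect; apply: inside => //=.
by rewrite /preimage /= c_even.
Qed.

Lemma local_variation_reflect a b t : F' (a, b, t) = F (a, b, - t).
Proof. by rewrite /local_variation varied_chart_reflect /= c_even. Qed.

Lemma smooth_into_time (Q : set (R * R * R)) (F0 : R * R * R -> M) (a b : R) :
  smooth_into Q F0 -> (forall t, Q (a, b, t)) -> smooth_into setT (fun t => F0 (a, b, t)).
Proof.
move=> [Fc FS] Qt.
have la : forall h v x : R, (a, b, h *: v + x) = h *: ((0, 0, v) : R * R * R) + (a, b, x).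
  by move=> h v x; congr (_, _, _); rewrite /= [h *: 0]mulr0 add0r.
have ld (x : R) : differentiable (fun t : R => (a, b, t) : R * R * R) x.
  by apply: differentiable_pair; [exact: differentiable_cst|exact: ex_diff].
split=> [t _|j k].
  apply: (@continuous_comp _ _ _ (fun t : R => (a, b, t) : R * R * R) F0).
    exact: differentiable_continuous (ld t).
  exact: Fc.
apply: (Ck_on_sub _ (Ck_on_affine (l := fun t : R => (a, b, t) : R * R * R) la ld (FS j k))).
by move=> t [_ jt]; split => //; exact: Qt.
Qed.

(** The second variation is the same on two local fields and on their time
    reversals, the action of the varied curves being invariant under time
    reversal. *)
Lemma index_integral_reflect :
  \int[mu]_(t in `[0, tau])
    index_density L c G U (local_field c i phi u) (local_field c i psi w) t =
  \int[mu]_(t in `[0, tau])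
    index_density L c G U (local_field c i phi' u) (local_field c i psi' w) t.
Proof.
have pv := local_variation_periodic_variation c_smooth c_periodic e_gt0 phiS psiS phiP psiP inside.
have pv' := local_variation_periodic_variation c_smooth c_periodic e_gt0
  (supported_reflect phiS) (supported_reflect psiS)
  (reflect_periodic phiP) (reflect_periodic psiP) inside_reflect.
have E1 := DU pv; have E2 := DU pv'; rewrite /= in E1 E2.
have X1 : (fun t => velocity (fun a => F (a, 0, t)) 0) = local_field c i phi u.
  by apply/funext => t; exact: (velocity_local_variation1 c_smooth c_periodic e_gt0 phiS psiS phiP psiP inside).
have X2 : (fun t => velocity (fun b => F (0, b, t)) 0) = local_field c i psi w.
  by apply/funext => t; exact: (velocity_local_variation2 c_smooth c_periodic e_gt0 phiS psiS phiP psiP inside).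
have Y1 : (fun t => velocity (fun a => F' (a, 0, t)) 0) = local_field c i phi' u.
  apply/funext => t; exact: (velocity_local_variation1 c_smooth c_periodic e_gt0
    (supported_reflect phiS) (supported_reflect psiS)
    (reflect_periodic phiP) (reflect_periodic psiP) inside_reflect).
have Y2 : (fun t => velocity (fun b => F' (0, b, t)) 0) = local_field c i psi' w.
  apply/funext => t; exact: (velocity_local_variation2 c_smooth c_periodic e_gt0
    (supported_reflect phiS) (supported_reflect psiS)
    (reflect_periodic phiP) (reflect_periodic psiP) inside_reflect).
transitivity (derive1 (fun a => derive1 (fun b => action L 0 tau (fun t => F (a, b, t))) 0) 0).
  rewrite E1; apply: eq_Rintegral => t _.
  by rewrite /index_density -X1 -X2.
transitivity (derive1 (fun a => derive1 (fun b => action L 0 tau (fun t => F' (a, b, t))) 0) 0); last first.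
  rewrite E2; apply: eq_Rintegral => t _.
  by rewrite /index_density -Y1 -Y2.
have [_ FS _ FP] := pv.
have AE a b : `|a| < e -> `|b| < e ->
    action L 0 tau (fun t => F (a, b, t)) = action L 0 tau (fun t => F' (a, b, t)).
  move=> ae be.
  have dS : smooth_into setT (fun t => F (a, b, t)) by apply: (smooth_into_time FS).
  have dP t : F (a, b, t + tau) = F (a, b, t) by exact: FP.
  rewrite -(action_reflect L_smooth L_periodic L_reversible dS dP).
  by congr (action L 0 tau _); apply/funext => t; rewrite local_variation_reflect.
exact: (mixed_derive_eq (f := fun a b => action L 0 tau (fun t => F (a, b, t)))
  (g := fun a b => action L 0 tau (fun t => F' (a, b, t))) e_gt0 AE).
Qed.

End SecondVariation.
End Symmetry.

Lemma antisym_identity {R : realType} (p q x y z v b : R) :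
  - (p * (q * b + p * x) + p * (q * b + p * z)) =
    p * (- q * b + p * y) + p * (- q * b + p * v) ->
  p * p * (x + y + (z + v)) = 0.
Proof. by move=> E; lra. Qed.

Lemma bform_add_congr {R : realType} {n : nat} (H : 'M[R]_n) (a a' b b' d d' e e' : 'rV[R]_n) :
  a = a' -> b = b' -> d = d' -> e = e' ->
  bform H a b + bform H d e = bform H a' b' + bform H d' e'.
Proof. by move=> -> -> -> ->. Qed.

Section Parity.
Context {R : realType} {n : nat} {M : smooth_manifold R n}.
Variables (L : lagrangian M) (c : R -> M) (tau : R) (G U : mx_family M).
Hypothesis tau_gt0 : 0 < tau.
Hypothesis L_smooth : smooth_lagrangian L.
Hypothesis L_reversible : reversible_lagrangian L.
Hypothesis c_smooth : smooth_into setT c.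
Hypothesis c_periodic : forall t, c (t + tau) = c t.
Hypothesis c_even : forall t, c (- t) = c t.
Hypothesis D_metric : metric_connection L c tau G.
Hypothesis U_symmetric : symmetric_endomorphism L c tau U.
Implicit Types (i j : cidx M) (t : R).

Local Notation dom i := (c @^-1` cdom i).
Local Notation mu := (@lebesgue_measure R).
Local Notation bf i t := (bform (gram L c i t)).

Lemma dom_shift_int i t (k : int) : dom i (t + tau *~ k) = dom i t.
Proof. by rewrite /preimage /= (periodic_int k c_periodic). Qed.

Lemma supported_bump i t0 (P : R -> Prop) : (\forall t \near t0, P t) ->
  (forall t, P t -> dom i t) ->
  exists phi : R -> R, [/\ supported_in c i phi, forall t, phi (t + tau) = phi t,
    forall t, `|phi t| <= 1, 0 < phi t0 &
    forall t, (forall k : int, ~ P (t + tau *~ k)) -> \forall s \near t, phi s = 0].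
Proof.
move=> Pt0 Pdom; have [phi [ps pP p1 p0 pz]] := periodic_bump tau_gt0 Pt0.
exists phi; split => //; split => // t it; apply: pz => k /Pdom.
by rewrite dom_shift_int.
Qed.

Lemma derive1_reflectN (phi : R -> R) t : smooth_on setT phi ->
  derive1 (fun s => phi (- s)) (- t) = - derive1 phi t.
Proof.
move=> ps; have dp : differentiable phi (- - t) by exact: smooth_on_differentiable ps _.
by rewrite (derive1_reflect dp) opprK.
Qed.

Lemma covD_local_reflect i (phi : R -> R) u t : supported_in c i phi -> dom i t ->
  covD c G (local_field c i (fun s => phi (- s)) u) (- t) i =
  - derive1 phi t *: u + phi t *: (u *m G i (- t)).
Proof.
move=> pS it; have itN : dom i (- t) by rewrite /preimage /= c_even.
rewrite (covD_local_field G c_smooth _ (supported_reflect c_even pS) itN).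
by rewrite (derive1_reflectN t pS.1) opprK.
Qed.

(** The sum of the connection matrices at opposite times is antisymmetric for
    the metric, because the connection and its time reversal are both metric. *)
Lemma connection_sum_antisym i t (u w : 'rV[R]_n) : dom i t ->
  bf i t (u *m G i t) w + bf i t (u *m G i (- t)) w +
  (bf i t u (w *m G i t) + bf i t u (w *m G i (- t))) = 0.
Proof.
move=> it; have itN : dom i (- t) by rewrite /preimage /= c_even.
have [phi [pS _ _ p0 _]] := supported_bump (i := i) (near_dom c_smooth it) (fun _ h => h).
have pS' := supported_reflect c_even pS.
pose xi v := local_field c i phi v; pose xi' v := local_field c i (fun s => phi (- s)) v.
have xS v : smooth_field c (xi v) by exact: local_field_smooth.
have xS' v : smooth_field c (xi' v) by exact: local_field_smooth.
have [_ _ DM] := D_metric.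
pose f s := metric L c s (xi u s) (xi w s).
have fE : (fun s => metric L c s (xi' u s) (xi' w s)) = (fun s => f (- s)).
  apply/funext => s; rewrite /xi' !(local_field_reflect c_even) /f.
  have T v : tangent (c s) (xi v (- s)) by rewrite -c_even; exact: (xS v).1.
  by rewrite -(metricN L_smooth L_reversible c_smooth c_even (T u) (T w)).
have df : differentiable f (- - t).
  exact: (metric_fields_differentiable L_smooth c_smooth _ (xS u) (xS w)).
have := DM _ _ (xS' u) (xS' w) (- t); rewrite fE (derive1_reflect df) opprK.
rewrite /f (DM _ _ (xS u) (xS w) t).
have tD v := covD_tangent D_metric t (xS v).
have tD' v := covD_tangent D_metric (- t) (xS' v).
have pp : phi t * phi t != 0 by exact: (mulf_neq0 (lt0r_neq0 p0) (lt0r_neq0 p0)).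
have X v : xi v t i = phi t *: v by exact: local_fieldE.
have X' v : xi' v (- t) i = phi t *: v.
  by have := local_fieldE (fun s => phi (- s)) v itN; rewrite opprK.
pose Y (v : 'rV[R]_n) : 'rV[R]_n := derive1 phi t *: v + phi t *: (v *m G i t).
pose Y' (v : 'rV[R]_n) : 'rV[R]_n := - derive1 phi t *: v + phi t *: (v *m G i (- t)).
have DX v : covD c G (xi v) t i = Y v by exact: covD_local_field.
have DX' v : covD c G (xi' v) (- t) i = Y' v by exact: covD_local_reflect.
have F1 : metric L c t (covD c G (xi u) t) (xi w t) = bf i t (Y u) (phi t *: w).
  by rewrite -(DX u) -(X w); exact: metric_chart (tD u) ((xS w).1 t).
have F2 : metric L c t (xi u t) (covD c G (xi w) t) = bf i t (phi t *: u) (Y w).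
  by rewrite -(DX w) -(X u); exact: metric_chart ((xS u).1 t) (tD w).
have GN := gramN L_smooth L_reversible c_smooth c_even it.
have F3 : metric L c (- t) (covD c G (xi' u) (- t)) (xi' w (- t)) = bf i t (Y' u) (phi t *: w).
  by rewrite -GN -(DX' u) -(X' w); exact: metric_chart (tD' u) ((xS' w).1 (- t)).
have F4 : metric L c (- t) (xi' u (- t)) (covD c G (xi' w) (- t)) = bf i t (phi t *: u) (Y' w).
  by rewrite -GN -(DX' w) -(X' u); exact: metric_chart ((xS' u).1 (- t)) (tD' w).
rewrite F1 F2 F3 F4 /Y /Y'.
clear -pp; move: (gram L c i t) (derive1 phi t) (phi t) (G i t) (G i (- t)) pp => H q p A B pp.
rewrite !(bformDl, bformDr, bformZl, bformZr) => E; apply: (mulfI pp); rewrite mulr0.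
exact: (antisym_identity E).
Qed.

Section Gap.
Variables (i : cidx M) (theta : R -> R).
Hypotheses (thetaS : smooth_on setT theta) (thetaP : forall t, theta (t + tau) = theta t)
  (theta1 : forall t, `|theta t| <= 1).
Implicit Types (phi : R -> R) (u w : 'rV[R]_n).

Local Notation lf phi u := (local_field c i phi u).

(** The density of the index form on the fields [phi u] and [theta phi w], minus
    the density at the opposite time on the time reversals of these fields. *)
Definition density_gap phi u w t : R :=
  index_density L c G U (lf phi u) (lf (fun s => theta s * phi s) w) t -
  index_density L c G U (lf (fun s => phi (- s)) u)
    (lf (fun s => theta (- s) * phi (- s)) w) (- t).

(** The coefficient of [phi t ^ 2] in the difference. *)
Definition gap_coef u w t : R :=
  derive1 theta t * (bf i t (u *m G i t) w + bf i t (u *m G i (- t)) w) +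
  theta t * (bf i t (u *m G i t) (w *m G i t) - bf i t (u *m G i (- t)) (w *m G i (- t)) +
             (bf i t (u *m U i t) w - bf i t (u *m U i (- t)) w)).

Lemma supported_mul phi : supported_in c i phi -> supported_in c i (fun s => theta s * phi s).
Proof.
move=> [ps p0]; split=> [k|t it].
  by apply: Ck_onM; [exact: openT|exact: thetaS|exact: ps].
by apply: filterS (p0 t it) => s ->; rewrite mulr0.
Qed.

(** The scalar identity behind [density_gapE].  In it, p and q are the values of
    phi and phi', th and dth those of theta and theta', b is the pairing of u and
    w; x, z (resp. y, v) are the pairings of u, w with the matrix of the
    connection applied to u, w at time t (resp. - t), a1, a2 the pairings of both
    images, and k1, k2 those of the potential.  The hypothesis is
    [connection_sum_antisym]. *)
Lemma gap_identity (p q th dth b x y z v a1 a2 k1 k2 : R) :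
  x + y + (z + v) = 0 ->
  q * ((dth * p + th * q) * b) + th * p * (q * z) +
    p * ((dth * p + th * q) * x + th * p * a1) + p * (th * p * k1) -
  (- q * (- (dth * p + th * q) * b) + th * p * (- q * v) +
    p * (- (dth * p + th * q) * y + th * p * a2) + p * (th * p * k2)) =
  p ^+ 2 * (dth * (x + y) + th * (a1 - a2 + (k1 - k2))).
Proof.
move=> E; have -> : z = - (x + y) - v by lra.
ring.
Qed.

Lemma density_gapE phi u w t : supported_in c i phi -> dom i t ->
  density_gap phi u w t = phi t ^+ 2 * gap_coef u w t.
Proof.
move=> pS it; have itN : dom i (- t) by rewrite /preimage /= c_even.
pose psi s := theta s * phi s.
have sS : supported_in c i psi := supported_mul pS.
have S1 v : smooth_field c (lf phi v) by exact: local_field_smooth.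
have S2 v : smooth_field c (lf psi v) by exact: local_field_smooth.
have S1' v : smooth_field c (lf (fun s => phi (- s)) v).
  by apply: local_field_smooth => //; exact: supported_reflect.
have S2' v : smooth_field c (lf (fun s => psi (- s)) v).
  by apply: local_field_smooth => //; exact: supported_reflect.
have dpsi : derive1 psi t = derive1 theta t * phi t + theta t * derive1 phi t.
  have dth : differentiable theta t by exact: smooth_on_differentiable thetaS _.
  have dph : differentiable phi t by exact: smooth_on_differentiable pS.1 _.
  rewrite !derive1E -[LHS]/('D_1 (theta * phi) t).
  rewrite (deriveM (diff_derivable dth) (diff_derivable dph)) addrC.
  by rewrite /GRing.scale /= [phi t * _]mulrC.
have E1 : index_density L c G U (lf phi u) (lf psi w) t =
    bf i t (derive1 phi t *: u + phi t *: (u *m G i t))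
           (derive1 psi t *: w + psi t *: (w *m G i t)) +
    bf i t (phi t *: u *m U i t) (psi t *: w).
  have H := index_density_chart L_smooth c_smooth D_metric U_symmetric it (S1 u) (S2 w).
  rewrite H; apply: bform_add_congr.
  - exact: (covD_local_field G c_smooth u pS it).
  - exact: (covD_local_field G c_smooth w sS it).
  - by congr (_ *m _); exact: local_fieldE.
  - exact: local_fieldE.
have E2 : index_density L c G U (lf (fun s => phi (- s)) u) (lf (fun s => psi (- s)) w) (- t) =
    bf i t (- derive1 phi t *: u + phi t *: (u *m G i (- t)))
           (- derive1 psi t *: w + psi t *: (w *m G i (- t))) +
    bf i t (phi t *: u *m U i (- t)) (psi t *: w).
  have H := index_density_chart L_smooth c_smooth D_metric U_symmetric itN (S1' u) (S2' w).
  rewrite H (gramN L_smooth L_reversible c_smooth c_even it).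
  apply: bform_add_congr.
  - exact: covD_local_reflect.
  - exact: covD_local_reflect.
  - by congr (_ *m _); have := local_fieldE (fun s => phi (- s)) u itN; rewrite opprK.
  - by have := local_fieldE (fun s => psi (- s)) w itN; rewrite opprK.
have A := connection_sum_antisym u w it.
rewrite /density_gap -/psi E1 -[fun s => theta (- s) * phi (- s)]/(fun s => psi (- s)) E2.
rewrite /gap_coef dpsi /psi.
clear -A; move: (gram L c i t) (derive1 phi t) (phi t) (derive1 theta t) (theta t) (G i t) (G i (- t)) (U i t) (U i (- t)) A => H q p dth th A B C D E.
rewrite -!scalemxAl !(bformDl, bformDr, bformZl, bformZr).
exact: gap_identity E.
Qed.

Lemma density_gap_out phi u w t : supported_in c i phi -> (\forall s \near t, phi s = 0) ->
  density_gap phi u w t = 0.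
Proof.
move=> pS p0; rewrite /density_gap.
have sS := supported_mul pS.
have S2 := local_field_smooth c_smooth w sS.
have S2' := local_field_smooth c_smooth w (supported_reflect c_even sS).
have n1 : \forall s \near t, lf phi u s = 0.
  by apply: filterS p0 => s; exact: local_field_eq0.
have n2 : \forall s \near (- t), lf (fun s => phi (- s)) u s = 0.
  have cN : {for - t, continuous (fun s : R => - s)} by exact: opp_continuous.
  have p0' : \forall s \near (- t), phi (- s) = 0.
    by apply: (cN [set s | phi s = 0]); rewrite opprK.
  by apply: filterS p0' => s; exact: local_field_eq0.
rewrite (index_density_eq0 U L_smooth c_smooth D_metric S2 n1).
by rewrite (index_density_eq0 U L_smooth c_smooth D_metric S2' n2) subrr.
Qed.

End Gap.

End Parity.

Section PeriodicIntegral.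
Context {R : realType}.
Local Notation mu := (@lebesgue_measure R).

Lemma continuous_integrable (a b : R) (f : R -> R) : continuous f ->
  mu.-integrable `[a, b] (EFin \o f).
Proof.
move=> cf; apply: within_continuous_integrable; apply: within_continuous_pointwise.
by move=> t _; exact: cf.
Qed.

Lemma continuous_RintegralB (a b : R) (f g : R -> R) : continuous f -> continuous g ->
  \int[mu]_(t in `[a, b]) (f t - g t) =
  \int[mu]_(t in `[a, b]) f t - \int[mu]_(t in `[a, b]) g t.
Proof. by move=> cf cg; rewrite RintegralB //; exact: continuous_integrable. Qed.

Lemma Rintegral_periodic_gt0 (tau t0 : R) (f : R -> R) : 0 < tau -> continuous f ->
  (forall t, f (t + tau) = f t) -> (forall t, 0 <= f t) -> 0 < f t0 ->
  0 < \int[mu]_(t in `[0, tau]) f t.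
Proof.
move=> tau0 cf fP f0 ft0; have [k /andP[k1 k2]] := modulo_period 0 t0 tau0.
apply: (Rintegral_gt0 (t0 := t0 + tau *~ k) tau0 cf) => //.
  by rewrite in_itv /= k1 ltW // -[ltRHS]add0r.
by rewrite (periodic_int k fP).
Qed.

End PeriodicIntegral.

Section Parity.
Context {R : realType} {n : nat} {M : smooth_manifold R n}.
Variables (L : lagrangian M) (c : R -> M) (tau : R) (G U : mx_family M).
Hypothesis tau_gt0 : 0 < tau.
Hypothesis L_smooth : smooth_lagrangian L.
Hypothesis L_convex : fibrewise_convex L.
Hypothesis L_periodic : periodic_lagrangian L tau.
Hypothesis L_reversible : reversible_lagrangian L.
Hypothesis c_smooth : smooth_into setT c.
Hypothesis c_periodic : forall t, c (t + tau) = c t.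
Hypothesis c_even : forall t, c (- t) = c t.
Hypothesis D_metric : metric_connection L c tau G.
Hypothesis U_symmetric : symmetric_endomorphism L c tau U.
Hypothesis DU : represents_second_variation L c tau G U.
Implicit Types (i j : cidx M) (t : R).

Local Notation dom i := (c @^-1` cdom i).
Local Notation mu := (@lebesgue_measure R).
Local Notation bf i t := (bform (gram L c i t)).

Lemma bform_differentiable (H : R -> 'M[R]_n) (a b : R -> 'rV[R]_n) t :
  (forall k l, differentiable (fun s => H s k l) t) ->
  differentiable a t -> differentiable b t ->
  differentiable (fun s => bform (H s) (a s) (b s)) t.
Proof.
move=> dH da db.
have -> : (fun s => bform (H s) (a s) (b s)) =
    \sum_k \sum_l (fun s => a s 0 k * b s 0 l * H s k l).
  by apply/funext => s; rewrite bformE fct_sumE; apply: eq_bigr => k _; rewrite fct_sumE.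
apply: differentiable_sum => k; apply: differentiable_sum => l.
have dk := @differentiable_coord_comp _ _ _ _ _ 0 k _ da.
have dl := @differentiable_coord_comp _ _ _ _ _ 0 l _ db.
exact: differentiableM (differentiableM dk dl) (dH k l).
Qed.

Lemma reflect_smooth_mx i (A : R -> 'M[R]_n) : smooth_on (dom i) A ->
  smooth_on (dom i) (fun t => A (- t)).
Proof.
move=> As k.
have Na : forall h v x : R, - (h *: v + x) = h *: - v + - x.
  by move=> h v x; rewrite opprD scalerN.
have Nd (x : R) : differentiable (fun s : R => - s) x.
  by apply: (@differentiableN _ _ _ id); exact: ex_diff.
apply: (Ck_on_sub _ (Ck_on_affine (l := fun s : R => - s) Na Nd (As k))).
by move=> t; rewrite /preimage /= c_even.
Qed.

Lemma mulmx_differentiable i (u : 'rV[R]_n) (A : R -> 'M[R]_n) t :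
  smooth_on (dom i) A -> dom i t -> differentiable (fun s => u *m A s) t.
Proof.
move=> As it; have oi := dom_open c_smooth (i := i).
have [H _] := Ck_on_mulmx oi (@Ck_on_cst _ _ _ 1 (dom i) u) (As 1%N).
exact: H.
Qed.

Lemma gap_coef_continuous i (theta : R -> R) (u w : 'rV[R]_n) t :
  smooth_on setT theta -> dom i t ->
  {for t, continuous (gap_coef L c G U i theta u w)}.
Proof.
move=> ths it.
have Gs : smooth_on (dom i) (G i) by case: D_metric => -[+ _] _ _; apply.
have Us : smooth_on (dom i) (U i) by case: U_symmetric => -[+ _] _ _; apply.
have dG v := mulmx_differentiable v Gs it.
have dG' v := mulmx_differentiable v (reflect_smooth_mx Gs) it.
have dU v := mulmx_differentiable v Us it.
have dU' v := mulmx_differentiable v (reflect_smooth_mx Us) it.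
have dth : {for t, continuous theta} by exact: smooth_on_continuous ths _.
have dth' : {for t, continuous (derive1 theta)}.
  exact: smooth_on_continuous (smooth_on_derive1 ths) _.
have B a b : differentiable a t -> differentiable b t -> {for t, continuous (fun s => bf i s (a s) (b s))}.
  move=> da db; apply: differentiable_continuous; apply: bform_differentiable => // k l.
  exact: gram_coord_differentiable.
have dc (v : 'rV[R]_n) : differentiable (fun=> v) t by exact: differentiable_cst.
apply: continuousD; apply: continuousM => //.
  by apply: continuousD; exact: B.
apply: continuousD; first by apply: continuousB; exact: B.
by apply: continuousB; exact: B.
Qed.

(** If the coefficient were positive at [t0], it would be positive near [t0]; for
    a bump [phi] supported there, the gap would be a nonnegative function,
    positive at [t0], with zero integral. *)
Lemma gap_coef_le0 i (theta : R -> R) (u w : 'rV[R]_n) t0 :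
  smooth_on setT theta -> (forall t, theta (t + tau) = theta t) ->
  (forall t, `|theta t| <= 1) -> dom i t0 ->
  gap_coef L c G U i theta u w t0 <= 0.
Proof.
move=> ths thP th1 it0; rewrite leNgt; apply/negP => m0.
have im0 : nbhs (cchart c i t0) (chart i @` cdom (M := M) i).
  by apply: open_nbhs_nbhs; split; [exact: chart_image_open|exists (c t0)].
have [r /= r0 Hr] := (nbhs_normP _ _).1 im0.
(* On [P] the curve stays at distance r / 2 from the centre of a ball of radius r
   contained in the image of the chart, which leaves room for the variation. *)
pose P t := [/\ dom i t, `|cchart c i t0 - cchart c i t| < r / 2
  & 0 < gap_coef L c G U i theta u w t].
have r2 : 0 < r / 2 by rewrite divr_gt0.
have Pt0 : \forall t \near t0, P t.
  have n1 := near_dom c_smooth it0.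
  have cc : {for t0, continuous (cchart c i)}.
    exact: smooth_on_continuous (@cchart_smooth _ _ _ c c_smooth i) it0.
  have n2 : \forall t \near t0, `|cchart c i t0 - cchart c i t| < r / 2.
    by move/cvgrPdist_lt: cc => /(_ _ r2).
  have n3 : \forall t \near t0, 0 < gap_coef L c G U i theta u w t.
    have gc : {for t0, continuous (gap_coef L c G U i theta u w)} := gap_coef_continuous (u:=u) (w:=w) ths it0.
    by apply: (cvgr_gt _ gc).
  by apply: filterS3 n1 n2 n3 => t; split.
have [phi [pS pP p1 p0 pz]] := supported_bump tau_gt0 c_periodic Pt0 (fun t (h : P t) => let: And3 h1 _ _ := h in h1).
pose psi s := theta s * phi s.
have sS : supported_in c i psi := supported_mul ths pS.
have sP t : psi (t + tau) = psi t by rewrite /psi thP pP.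
pose N := `|u| + `|w| + 1.
have N0 : 0 < N by rewrite ltr_wpDl ?addr_ge0.
(* The translation of [varied_chart] has norm less than e (|u| + |w| + 1). *)
pose e := r / 2 / N.
have e0 : 0 < e by rewrite divr_gt0.
have inside p : `|p.1.1| < e -> `|p.1.2| < e -> dom i p.2 ->
    (chart i @` cdom (M := M) i) (varied_chart c i phi psi u w p).
  move=> ha hb ip; have [[k [_ hk _]]|nP] := pselect (exists k : int, P (p.2 + tau *~ k)); last first.
    have f0 : phi p.2 = 0 by apply: (nbhs_singleton (pz _ _)) => k Pk; apply: nP; exists k.
    rewrite /varied_chart /psi f0 !mulr0 !scale0r !addr0.
    by exists (c p.2).
  apply: Hr => /=; rewrite /cchart (periodic_int k c_periodic) -/(cchart c i p.2) in hk.
  rewrite /varied_chart -addrA opprD addrA; apply: (le_lt_trans (ler_normB _ _)).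
  have eN : e * N = r / 2 by rewrite divfK // gt_eqF.
  rewrite (splitr r); apply: ltr_leD => //; rewrite -eN.
  apply: (le_trans (ler_normD _ _)); rewrite !normrZ /N !mulrDr mulr1.
  rewrite -[leLHS]addr0; apply: lerD; last exact: ltW.
  have f1 (x y : R) : `|x| < e -> 0 <= y <= 1 -> `|x| * y <= e.
    move=> xe /andP[y0 y1]; rewrite -[leRHS]mulr1; apply: ler_pM => //; exact: ltW.
  apply: lerD; apply: ler_wpM2r => //; apply: f1 => //; apply/andP; split=> //.
  by rewrite -[leRHS]mulr1; apply: ler_pM.
have E := index_integral_reflect L_smooth L_periodic L_reversible c_smooth c_periodic c_even DU
  e0 pS sS pP sP inside.
pose d1 := index_density L c G U (local_field c i phi u) (local_field c i psi w).
pose d2 := index_density L c G U (local_field c i (fun s => phi (- s)) u)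
  (local_field c i (fun s => psi (- s)) w).
have S1 := local_field_smooth c_smooth u pS.
have S2 := local_field_smooth c_smooth w sS.
have S1' := local_field_smooth c_smooth u (supported_reflect c_even pS).
have S2' := local_field_smooth c_smooth w (supported_reflect c_even sS).
have c1 : continuous d1 := index_density_continuous L_smooth c_smooth D_metric U_symmetric S1 S2.
have c2 : continuous d2 := index_density_continuous L_smooth c_smooth D_metric U_symmetric S1' S2'.
have pP' := reflect_periodic pP; have sP' := reflect_periodic sP.
have P1 t : d1 (t + tau) = d1 t.
  exact: (index_density_periodic L_periodic c_smooth c_periodic D_metric U_symmetric t S1 S2
    (fun s => local_field_periodic c_periodic i u s pP)
    (fun s => local_field_periodic c_periodic i w s sP)).
have P2 t : d2 (t + tau) = d2 t.
  exact: (index_density_periodic L_periodic c_smooth c_periodic D_metric U_symmetric t S1' S2'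
    (fun s => local_field_periodic c_periodic i u s pP')
    (fun s => local_field_periodic c_periodic i w s sP')).
pose f t := d1 t - d2 (- t).
have c2N : continuous (fun t => d2 (- t)).
  by move=> t; apply: (@continuous_comp _ _ _ (fun s : R => - s) d2); [exact: opp_continuous|exact: c2].
have cf : continuous f by move=> t; apply: continuousB; [exact: c1|exact: c2N].
have fP t : f (t + tau) = f t.
  by rewrite /f P1 (reflect_periodic P2).
have fgap t : f t = density_gap L c G U i theta phi u w t by [].
have fin t : P t -> f t = phi t ^+ 2 * gap_coef L c G U i theta u w t.
  case=> it _ _; rewrite fgap.
  exact: (density_gapE tau_gt0 L_smooth L_reversible c_smooth c_periodic c_even D_metric U_symmetric ths u w pS it).
have f0 t : 0 <= f t.
  have [[k Pk]|nP] := pselect (exists k : int, P (t + tau *~ k)).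
    rewrite -(periodic_int k fP) (fin _ Pk); case: (Pk) => _ _ h.
    exact: (mulr_ge0 (sqr_ge0 _) (ltW h)).
  have fz : \forall s \near t, phi s = 0 by apply: pz => k Pk; apply: nP; exists k.
  have fE : f t = 0 := density_gap_out U L_smooth c_smooth c_even D_metric ths u w pS fz.
  by rewrite fE.
have ft0 : 0 < f t0.
  rewrite (fin _ (nbhs_singleton Pt0)).
  exact: (mulr_gt0 (exprn_gt0 2 p0) m0).
have fI := continuous_RintegralB 0 tau c1 c2N.
have e2 := Rintegral_periodic_reflect c2 P2.
have fI0 : \int[mu]_(t in `[0, tau]) f t = 0 :=
  etrans fI (etrans (f_equal2 (fun x y => x - y) E e2) (subrr _)).
have := Rintegral_periodic_gt0 tau_gt0 cf fP f0 ft0.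
by rewrite fI0 ltxx.
Qed.

(** The coefficient is odd in [u]. *)
Lemma gap_coef_eq0 i (theta : R -> R) (u w : 'rV[R]_n) t0 :
  smooth_on setT theta -> (forall t, theta (t + tau) = theta t) ->
  (forall t, `|theta t| <= 1) -> dom i t0 ->
  gap_coef L c G U i theta u w t0 = 0.
Proof.
move=> ths thP th1 it0; apply/eqP; rewrite eq_le gap_coef_le0 //=.
have := gap_coef_le0 (- u) w ths thP th1 it0.
have bN (H : 'M[R]_n) x y : bform H (- x) y = - bform H x y.
  by rewrite -scaleN1r bformZl mulN1r.
rewrite /gap_coef !mulNmx !bN.
move: (bform _ (u *m G i t0) w) (bform _ (u *m G i (- t0)) w) => a b.
move: (bform _ (u *m G i t0) (w *m G i t0)) => d.
move: (bform _ (u *m G i (- t0)) (w *m G i (- t0))) => e.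
move: (bform _ (u *m U i t0) w) (bform _ (u *m U i (- t0)) w) => f g.
move: (derive1 theta t0) (theta t0) => p q.
lra.
Qed.

(** The connection is odd and the potential is even under time reversal; this
    is where the uniqueness of the representation of the second variation
    enters. *)
Theorem connection_odd_potential_even i t : dom i t ->
  G i (- t) = - G i t /\ U i (- t) = U i t.
Proof.
move=> it.
(* With [th], which vanishes at t, only the term in its derivative survives in
   the coefficient, which gives G(- t) = - G(t); with [one], the remaining terms
   then give U(- t) = U(t). *)
pose one : R -> R := cst 1; pose th s := sin (phase tau t s).
have C1 u w : gap_coef L c G U i one u w t = 0.
  apply: gap_coef_eq0 => // [k|s]; first exact: Ck_on_cst.
  by rewrite normr1.
have C2 u w : gap_coef L c G U i th u w t = 0.
  apply: gap_coef_eq0 => //; first exact: smooth_sin_phase.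
    by move=> s; rewrite /th phaseD // sinD2pi.
  by move=> s; exact: sin_max.
have w0 : pi *+ 2 / tau != 0 :> R.
  by rewrite gt_eqF // divr_gt0 // mulrn_wgt0 // pi_gt0.
have pos (v : 'rV[R]_n) : bf i t v v = 0 -> v = 0.
  move=> v0; apply/eqP/negPn/negP => vn.
  by have := gram_pos L_smooth c_smooth L_convex it vn; rewrite v0 ltxx.
have A u w : bf i t (u *m G i t) w + bf i t (u *m G i (- t)) w = 0.
  have := C2 u w; rewrite /gap_coef derive1_sin_phase /th /phase subrr mulr0 sin0 mul0r addr0.
  by move/eqP; rewrite mulf_eq0 (negbTE w0) /= => /eqP.
have mx0 (B : 'M[R]_n) : (forall u : 'rV[R]_n, u *m B = 0) -> B = 0.
  by move=> B0; apply/row_matrixP => k; rewrite row0 rowE B0.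
have GG : G i (- t) = - G i t.
  apply/eqP; rewrite -addr_eq0 addrC; apply/eqP; apply: mx0 => u.
  by apply: pos; rewrite {1}mulmxDr bformDl A.
split=> //; apply/eqP; rewrite eq_sym -subr_eq0; apply/eqP; apply: mx0 => u.
have h := C1 u (u *m (U i t - U i (- t))).
have bNN (H : 'M[R]_n) (x y : 'rV[R]_n) : bform H (- x) (- y) = bform H x y.
  by rewrite -scaleN1r -[- y]scaleN1r bformZl bformZr mulrA mulN1r opprK mul1r.
have bBl (H : 'M[R]_n) (x y z : 'rV[R]_n) : bform H (x - y) z = bform H x z - bform H y z.
  by rewrite -scaleN1r bformDl bformZl mulN1r.
move: h; rewrite /gap_coef /one derive1_cst mul0r add0r mul1r GG.
rewrite !mulmxN bNN subrr add0r => h.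
by apply: pos; rewrite {1}mulmxBr bBl.
Qed.

End Parity.

(** * Sobolev fields and the index form over a period *)

Section Sobolev.
Context {R : realType} {n : nat}.
Local Notation mu := (@lebesgue_measure R).
Implicit Types (a b p : R).

Lemma L2_reflect p a b (g : R -> R) : L2 (p - b) (p - a) g -> L2 a b (fun s => - g (p - s)).
Proof.
move=> [mg g2].
have E : refl p @^-1` `[p - b, p - a] = `[a, b]%classic.
  by rewrite refl_itv !subKr.
split.
  apply: measurable_funN; rewrite -E.
  apply: (measurable_comp (F := `[p - b, p - a]%classic)) mg _ => //.
  - by move=> _ [t ? <-].
  - by apply: measurable_funTS; exact: measurable_refl.
have mI : measurable (`[p - b, p - a]%classic : set (measurableTypeR R)) by exact: measurable_itv.
have := @integrable_refl R p _ (fun t => g t ^+ 2) mI g2; rewrite E.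
by apply: eq_integrable => // t _ /=; rewrite sqrrN.
Qed.

Lemma W12_on_L2 a b (f g : R -> 'rV[R]_n) (k : 'I_n) : W12_on a b f g ->
  L2 a b (fun t => g t 0 k).
Proof. by move=> /(_ k)[mg g2 _]; split. Qed.

Lemma W12_on_continuous a b (f g : R -> 'rV[R]_n) (k : 'I_n) : a <= b -> W12_on a b f g ->
  {within `[a, b], continuous (fun t => f t 0 k)}.
Proof.
move=> ab W; have [_ _ fE] := W k.
exact: (primitive_within_continuous ab (L2_integrable (W12_on_L2 k W)) fE).
Qed.

Lemma W12_on_eq a b (f g h : R -> 'rV[R]_n) :
  (forall t, t \in `[a, b] -> g t = h t) -> W12_on a b f g -> W12_on a b f h.
Proof.
move=> gh W k; have [mg g2 fE] := W k; split.
- by apply: eq_measurable_fun mg => t /set_mem /gh ->.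
- by apply: eq_integrable g2 => // t /set_mem /gh ->.
move=> t tab; rewrite fE //; congr (_ + _); apply: eq_Rintegral => s /set_mem /= st.
rewrite gh //; move: st tab; rewrite !in_itv /= => /andP[-> st] /andP[_].
exact: le_trans st.
Qed.

Lemma W12_on_reflect p a b (f g : R -> 'rV[R]_n) :
  W12_on (p - b) (p - a) f g -> W12_on a b (fun s => f (p - s)) (fun s => - g (p - s)).
Proof.
move=> W k; have [mg g2 fE] := W k; have [mN N2] := L2_reflect (W12_on_L2 k W).
have NE : (fun s => (- g (p - s)) 0 k) = (fun s => - g (p - s) 0 k).
  by apply/funext => s; rewrite mxE.
split; first by rewrite NE.
  by apply: eq_integrable N2 => // s _; rewrite mxE.
move=> t; rewrite in_itv /= => /andP[at_ tb].
have gi := L2_integrable (W12_on_L2 k W).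
have ba : p - b <= p - t by lra.
have ta : p - t <= p - a by lra.
rewrite (fE (p - t)) ?in_itv /= ?ba ?ta // (fE (p - a)); last first.
  by rewrite in_itv /= lexx andbT (le_trans ba ta).
have S : p - b <= p - t <= p - a by rewrite ba ta.
rewrite [X in _ = _ + X + _](Rintegral_split S gi) NE.
have mI : measurable_fun `[p - t, p - a] (fun s => g s 0 k).
  apply: measurable_funS mg => // s /=; rewrite !in_itv /= => /andP[h ->].
  by rewrite (le_trans ba h).
have E := Rintegral_refl p mI; rewrite !subKr in E.
have Ni : mu.-integrable `[a, t] (EFin \o (fun s => - g (p - s) 0 k)).
  apply: integrableS (L2_integrable (L2_reflect (W12_on_L2 k W))) => // s /=.
  by rewrite !in_itv /= => /andP[-> st]; exact: le_trans tb.
have mt : measurable (`[a, t]%classic : set (measurableTypeR R)) by exact: measurable_itv.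
have EN : \int[mu]_(s in `[a, t]) g (p - s) 0 k = - \int[mu]_(s in `[a, t]) - g (p - s) 0 k.
  rewrite -mulN1r -(RintegralZl (-1) mt Ni); apply: eq_Rintegral => s _.
  by rewrite mulN1r opprK.
by rewrite E EN addrA subrK.
Qed.

End Sobolev.

Section Density.
Context {R : realType} {n : nat} {M : smooth_manifold R n}.
Variables (L : lagrangian M) (c : R -> M) (tau : R) (G U : mx_family M).
Hypothesis L_smooth : smooth_lagrangian L.
Hypothesis c_smooth : smooth_into setT c.
Hypothesis D_metric : metric_connection L c tau G.
Hypothesis U_symmetric : symmetric_endomorphism L c tau U.
Implicit Types (i j : cidx M) (t : R) (xi zeta : R -> tvec M).

Local Notation dom i := (c @^-1` cdom i).
Local Notation mu := (@lebesgue_measure R).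

(** Density of the index form on a Sobolev field [xi] with [zeta = D xi]. *)
Definition quad_density xi zeta t : R :=
  metric L c t (zeta t) (zeta t) + metric L c t (mx_apply U t (xi t)) (xi t).

Lemma integrable_sum_fun a b (I : Type) (r : seq I) (F : I -> R -> R) :
  (forall k, mu.-integrable `[a, b] (EFin \o F k)) ->
  mu.-integrable `[a, b] (EFin \o (fun t => \sum_(k <- r) F k t)).
Proof.
have mI : measurable (`[a, b]%classic : set (measurableTypeR R)) by exact: measurable_itv.
move=> H; elim: r => [|k r IH].
  apply: eq_integrable (within_continuous_integrable (@within_continuous_cst R `[a, b]%classic 0)) => //.
  by move=> t _; rewrite /= big_nil.
apply: eq_integrable (integrableD mI (H k) IH) => //.
by move=> t _; rewrite /= big_cons EFinD.
Qed.

Lemma smooth_mx_entry i (A : R -> 'M[R]_n) a b k l : smooth_on (dom i) A ->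
  `[a, b] `<=` dom i -> {within `[a, b], continuous (fun t => A t k l)}.
Proof.
move=> As sub; apply: within_continuous_pointwise => t tab.
have it : dom i t by exact: sub.
exact: differentiable_continuous (differentiable_coord_comp k l (smooth_on_differentiable As it)).
Qed.

(** In a chart, the coordinates of [xi] are continuous and those of [zeta] are
    square integrable. *)
Lemma quad_density_integrable_chart i a b xi zeta : a <= b -> `[a, b] `<=` dom i ->
  W12_field c G `[a, b] xi zeta ->
  mu.-integrable `[a, b] (EFin \o quad_density xi zeta).
Proof.
move=> ab sub [xT xW].
have W := xW i a b (fun t h => h) sub.
have mI : measurable (`[a, b]%classic : set (measurableTypeR R)) by exact: measurable_itv.
have Gs : smooth_on (dom i) (G i) by case: D_metric => -[+ _] _ _; apply.
have Us : smooth_on (dom i) (U i) by case: U_symmetric => -[+ _] _ _; apply.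
have cX k : {within `[a, b], continuous (fun t => xi t i 0 k)} := W12_on_continuous (k:=k) ab W.
have cM (A : R -> 'M[R]_n) k : smooth_on (dom i) A ->
    {within `[a, b], continuous (fun t => (xi t i *m A t) 0 k)}.
  move=> As.
  have -> : (fun t => (xi t i *m A t) 0 k) = (fun t => \sum_j xi t i 0 j * A t j k).
    by apply/funext => t; rewrite mxE.
  apply: within_continuous_sum => j; apply: within_continuousM; first exact: cX.
  exact: smooth_mx_entry As sub.
have cH k l : {within `[a, b], continuous (fun t => gram L c i t k l)}.
  apply: within_continuous_pointwise => t tab; apply: differentiable_continuous.
  by apply: gram_coord_differentiable => //; exact: sub.
have LZ k : L2 a b (fun t => zeta t i 0 k).
  have E : (fun t => zeta t i 0 k) =
      (fun t => (zeta t i - xi t i *m G i t) 0 k + (xi t i *m G i t) 0 k).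
    by apply/funext => t; rewrite [X in _ = X + _]mxE [X in _ = _ + X + _]mxE subrK.
  rewrite E; apply: L2D; first exact: W12_on_L2 W.
  by apply: L2_continuous; exact: cM.
have F1 : mu.-integrable `[a, b] (EFin \o (fun t => \sum_k zeta t i 0 k * \sum_l zeta t i 0 l * gram L c i t k l)).
  apply: integrable_sum_fun => k; apply: L2M_integrable => //.
  by apply: L2_sum => l; exact: L2_continuousM.
have F2 : mu.-integrable `[a, b] (EFin \o (fun t => \sum_k \sum_l (xi t i *m U i t) 0 k * xi t i 0 l * gram L c i t k l)).
  apply: within_continuous_integrable; apply: within_continuous_sum => k.
  apply: within_continuous_sum => l; apply: within_continuousM => //.
  by apply: within_continuousM => //; exact: cM.
have F := integrableD mI F1 F2; apply: eq_integrable F => // t /set_mem tab.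
have it := sub t tab; have [xt zt] := xT t tab.
have UT : tangent (c t) (mx_apply U t (xi t)) by case: U_symmetric => _ + _; apply.
rewrite /= /quad_density (metric_chart L_smooth c_smooth it zt zt).
rewrite (metric_chart L_smooth c_smooth it UT xt) !bformE -EFinD; congr (_ + _)%:E.
by apply: eq_bigr => k _; rewrite mulr_sumr; apply: eq_bigr => l _; rewrite mulrA.
Qed.

Lemma W12_field_sub (J J' : set R) xi zeta : J' `<=` J ->
  W12_field c G J xi zeta -> W12_field c G J' xi zeta.
Proof.
move=> JJ [xT xW]; split=> [t /JJ|i a b sub sub']; first exact: xT.
by apply: xW => //; exact: subset_trans JJ.
Qed.

(** Every time has a neighbourhood on which the curve stays in a chart. *)
Lemma quad_density_integrable a b xi zeta :
  W12_field c G `[a, b] xi zeta -> mu.-integrable `[a, b] (EFin \o quad_density xi zeta).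
Proof.
move=> W; apply: integrable_local => t tab; have [i it] := cdom_cover (c t).
have [d /= d0 Hd] := (nbhs_normP _ _).1 (near_dom c_smooth it).
have d2 : 0 < d / 2 by rewrite divr_gt0.
exists (d / 2) => //.
pose a' := Num.max a (t - d / 2); pose b' := Num.min b (t + d / 2).
have /andP[at_ tb] : a <= t <= b by move: tab; rewrite in_itv.
have ab' : a' <= b'.
  by rewrite ge_max !le_min; apply/andP; split; apply/andP; split; lra.
have sub : `[a', b'] `<=` `[a, b].
  by move=> s /=; rewrite !in_itv /= ge_max le_min => /andP[/andP[-> _] /andP[-> _]].
have subd : `[a', b'] `<=` dom i.
  move=> s /=; rewrite in_itv /= ge_max le_min => /andP[/andP[_ h1] /andP[_ h2]].
  by apply: Hd => /=; rewrite ltr_norml; apply/andP; split; lra.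
have I := quad_density_integrable_chart ab' subd (W12_field_sub sub W).
apply: integrableS I => //.
  by apply: measurableI; exact: measurable_itv.
move=> s [/=]; rewrite !in_itv /= ge_max le_min => /andP[-> ->] /andP[h1 h2].
by rewrite !ltW.
Qed.

End Density.

Section Positivity.
Context {R : realType} {n : nat} {M : smooth_manifold R n}.
Variables (L : lagrangian M) (c : R -> M) (T tau : R) (G U : mx_family M).
Hypothesis T_gt0 : 0 < T.
Hypothesis tauE : tau = 2 * T.
Hypothesis L_smooth : smooth_lagrangian L.
Hypothesis L_convex : fibrewise_convex L.
Hypothesis L_periodic : periodic_lagrangian L tau.
Hypothesis L_reversible : reversible_lagrangian L.
Hypothesis c_smooth : smooth_into setT c.
Hypothesis c_periodic : forall t, c (t + tau) = c t.
Hypothesis c_even : forall t, c (- t) = c t.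
Hypothesis D_metric : metric_connection L c tau G.
Hypothesis U_symmetric : symmetric_endomorphism L c tau U.
Hypothesis parity : forall i t, cdom i (c t) -> G i (- t) = - G i t /\ U i (- t) = U i t.
Hypothesis minimum : nondegenerate_minimum L c T G U.
Implicit Types (i j : cidx M) (t : R) (xi zeta : R -> tvec M).

Local Notation dom i := (c @^-1` cdom i).
Local Notation mu := (@lebesgue_measure R).
Local Notation q := (quad_density L c U).

Lemma curve_reflect t : c (tau - t) = c t.
Proof. by rewrite addrC c_periodic c_even. Qed.

Lemma connection_reflect i t : dom i t -> G i (tau - t) = - G i t.
Proof.
move=> it; have [GP _] := parity it; rewrite -GP.
have -> : tau - t = - t + tau by rewrite addrC.
by case: D_metric => -[_ GP'] _ _; apply: GP'; rewrite c_even.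
Qed.

Lemma potential_reflect i t : dom i t -> U i (tau - t) = U i t.
Proof.
move=> it; have [_ UP] := parity it; rewrite -UP.
have -> : tau - t = - t + tau by rewrite addrC.
by case: U_symmetric => -[_ UP'] _ _; apply: UP'; rewrite c_even.
Qed.

Lemma metric_reflect t (u w : tvec M) : tangent (c t) u -> tangent (c t) w ->
  metric L c (tau - t) u w = metric L c t u w.
Proof.
move=> uT wT; have -> : tau - t = - t + tau by rewrite addrC.
have uT' : tangent (c (- t)) u by rewrite c_even.
have wT' : tangent (c (- t)) w by rewrite c_even.
rewrite (metricP L_periodic c_smooth c_periodic uT' wT').
exact: metricN.
Qed.

Lemma mx_apply_reflect t (v : tvec M) : tangent (c t) v ->
  mx_apply U (tau - t) v = mx_apply U t v.
Proof.
move=> vT; apply/funext => i; rewrite /mx_apply; have [it|it] := pselect (dom i t).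
  by rewrite (potential_reflect it).
by rewrite (tangent_out vT it) !mul0mx.
Qed.

Lemma metric_opp t (u : tvec M) : tangent (c t) u ->
  metric L c t (- u) (- u) = metric L c t u u.
Proof.
move=> uT; have uT' := tangentZ (-1) uT; rewrite -(scaleN1r u).
rewrite (metricZl L_smooth c_smooth _ uT uT') (metricZr L_smooth c_smooth _ uT uT).
by rewrite mulrA mulN1r opprK mul1r.
Qed.

Section Reflection.
Variables (xi zeta : R -> tvec M).
Hypothesis W : W12_field c G setT xi zeta.

Lemma reflected_tangent t : tangent (c t) (xi (tau - t)) /\ tangent (c t) (zeta (tau - t)).
Proof.
by have := W.1 (tau - t) I; rewrite curve_reflect.
Qed.

(** The time reversal of a Sobolev field is a Sobolev field, the connection
    being odd. *)
Lemma W12_field_reflect :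
  W12_field c G setT (fun t => xi (tau - t)) (fun t => - zeta (tau - t)).
Proof.
split=> [t _|i a b _ sub].
  have [h1 h2] := reflected_tangent t; exact: (conj h1 (tangentN h2)).
have sub' : `[tau - b, tau - a] `<=` dom i.
  move=> t; rewrite /= in_itv /= => /andP[h1 h2].
  rewrite /preimage /= -curve_reflect; apply: (sub (tau - t)).
  by rewrite /= in_itv /=; apply/andP; split; lra.
have W1 := W12_on_reflect (W.2 i (tau - b) (tau - a) (fun t _ => I) sub').
apply: W12_on_eq W1 => t tab; have it : dom i t by exact: sub.
rewrite (connection_reflect it) mulmxN opprK opprD.
by [].
Qed.

Lemma quad_density_reflect t :
  q (fun t => xi (tau - t)) (fun t => - zeta (tau - t)) t = q xi zeta (tau - t).
Proof.
have [h1 h2] := reflected_tangent t; rewrite /quad_density.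
have UT : tangent (c t) (mx_apply U t (xi (tau - t))) by case: U_symmetric => _ + _; apply.
rewrite (mx_apply_reflect h1) (metric_reflect h2 h2) (metric_reflect UT h1).
by rewrite (metric_opp h2).
Qed.

End Reflection.

(** The form [K] is nonnegative on all Sobolev fields.  When [xi] vanishes on the
    half period, [minimum] says nothing, but the integrand reduces to the squared
    norm of [zeta], which need not be zero at every time. *)
Lemma K_form_ge0 xi zeta : W12_field c G `[0, T] xi zeta -> 0 <= K_form L c T U xi zeta.
Proof.
move=> W; have [H|H] := pselect (exists2 t, t \in `[0, T] & xi t <> 0).
  exact/ltW/(minimum W H).
apply: Rintegral_ge0 => t tT; have [xT zT] := W.1 t tT.
have x0 : xi t = 0 by apply: contrapT => x0; apply: H; exists t.
have m0 : mx_apply U t 0 = 0 :> tvec M by apply/funext => i; rewrite /mx_apply mul0mx.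
rewrite x0 m0 (metric0l L_smooth c_smooth (tangent0 (c t))) addr0.
exact: (metric_ge0 L_smooth c_smooth L_convex zT).
Qed.

(** The integral over [T, tau] is the integral over [0, T] for the reversed
    field. *)
Lemma index_form_split xi zeta : W12_field c G setT xi zeta ->
  \int[mu]_(t in `[0, tau]) q xi zeta t =
  K_form L c T U xi zeta +
  K_form L c T U (fun t => xi (tau - t)) (fun t => - zeta (tau - t)).
Proof.
move=> W; have Wt := W12_field_sub (J' := `[0, tau]) (fun t _ => I) W.
have qi := quad_density_integrable L_smooth c_smooth D_metric U_symmetric Wt.
have S : 0 <= T <= tau by rewrite tauE mulr_natl mulr2n lerDl (ltW T_gt0).
apply: (etrans (Rintegral_split S qi)).
have mq : measurable_fun `[T, tau] (q xi zeta).
  have Wt' := W12_field_sub (J' := `[T, tau]) (fun t _ => I) W.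
  have /integrableP[mf _] := quad_density_integrable L_smooth c_smooth D_metric U_symmetric Wt'.
  exact/measurable_EFinP.
have E2 := Rintegral_refl tau mq.
have tT : tau - T = T by rewrite tauE mulr_natl mulr2n addrK.
rewrite subrr tT in E2; apply: (f_equal2 +%R (erefl _) (etrans E2 _)).
by apply: eq_Rintegral => t _; exact/esym/quad_density_reflect.
Qed.

(** Positivity over the whole period, without any boundary condition. *)
Lemma index_form_ge0 xi zeta : W12_field c G setT xi zeta ->
  0 <= \int[mu]_(t in `[0, tau]) q xi zeta t.
Proof.
move=> W; rewrite (index_form_split W); apply: addr_ge0; apply: K_form_ge0.
  exact: W12_field_sub W.
exact: W12_field_sub (W12_field_reflect W).
Qed.

Lemma index_form_gt0 xi zeta t : W12_field c G setT xi zeta ->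
  t \in `[0, tau] -> xi t <> 0 ->
  0 < \int[mu]_(t in `[0, tau]) q xi zeta t.
Proof.
move=> W tt xt; have W1 := W12_field_sub (J' := `[0, T]) (fun t _ => I) W.
have W2 := W12_field_sub (J' := `[0, T]) (fun t _ => I) (W12_field_reflect W).
have K1 := K_form_ge0 W1; have K2 := K_form_ge0 W2.
rewrite (index_form_split W); move: tt; rewrite in_itv /= => /andP[t0 t1].
have [tT|Tt] := leP t T.
  have tin : t \in `[0, T] by rewrite in_itv /= t0 tT.
  exact: (ltr_pwDl (minimum W1 (ex_intro2 _ _ t tin xt)) K2).
have tin : tau - t \in `[0, T].
  rewrite in_itv /= subr_ge0 t1 /= lerBlDr tauE mulr_natl mulr2n lerD2l.
  exact: ltW.
have xt' : xi (tau - (tau - t)) <> 0 by rewrite subKr.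
have H2 : exists2 s, s \in `[0, T] & xi (tau - s) <> 0 by exists (tau - t).
exact: (ltr_wpDl K1 (minimum W2 H2)).
Qed.

End Positivity.

Local Open Scope complex_scope.

(** * Complex fields and multipliers *)

Section Complex.
Context {R : realType} {n : nat} {M : smooth_manifold R n}.

Lemma normc_eq1 (a b : R) : `|a +i* b| = 1 :> R[i] -> a ^+ 2 + b ^+ 2 = 1.
Proof.
move=> ab1; have := add_Re2_Im2 (a +i* b); rewrite ab1 expr1n /= => -[].
by [].
Qed.

Lemma cscale_eq0 (rho : R[i]) (v : ctvec M) : `|rho| = 1 :> R[i] ->
  Defs.cscale rho v = (0, 0) -> v = (0, 0).
Proof.
case: rho => a b; case: v => v1 v2 /normc_eq1 ab1 [/= e1 e2].
have H (x y : R) : a * x - b * y = 0 -> a * y + b * x = 0 -> x = 0 /\ y = 0.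
  move=> h1 h2; split.
    have -> : x = (a ^+ 2 + b ^+ 2) * x by rewrite ab1 mul1r.
    have -> : (a ^+ 2 + b ^+ 2) * x = a * (a * x - b * y) + b * (a * y + b * x) by ring.
    by rewrite h1 h2 !mulr0 addr0.
  have -> : y = (a ^+ 2 + b ^+ 2) * y by rewrite ab1 mul1r.
  have -> : (a ^+ 2 + b ^+ 2) * y = a * (a * y + b * x) - b * (a * x - b * y) by ring.
  by rewrite h1 h2 !mulr0 subr0.
have K i k : v1 i 0 k = 0 /\ v2 i 0 k = 0.
  apply: H.
    have e : (a *: v1 i - b *: v2 i) 0 k = (0 : 'rV[R]_n) 0 k.
      exact: (congr1 (fun f : tvec M => f i 0 k) e1).
    by move: e; rewrite !mxE.
  have e : (a *: v2 i + b *: v1 i) 0 k = (0 : 'rV[R]_n) 0 k.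
    exact: (congr1 (fun f : tvec M => f i 0 k) e2).
  by move: e; rewrite !mxE.
by congr (_, _); apply/funext => i; apply/rowP => k; have [h1 h2] := K i k; rewrite ?h1 ?h2 mxE.
Qed.

End Complex.

Section Solutions.
Context {R : realType} {n : nat} {M : smooth_manifold R n}.
Variables (L : lagrangian M) (c : R -> M) (tau : R) (G U : mx_family M).
Hypothesis tau_gt0 : 0 < tau.
Hypothesis L_smooth : smooth_lagrangian L.
Hypothesis c_smooth : smooth_into setT c.
Hypothesis D_metric : metric_connection L c tau G.
Hypothesis U_symmetric : symmetric_endomorphism L c tau U.
Implicit Types (i j : cidx M) (t : R) (xi zeta : R -> tvec M).

Local Notation dom i := (c @^-1` cdom i).
Local Notation mu := (@lebesgue_measure R).

Lemma smooth_W12_on i a b (f : R -> 'rV[R]_n) : smooth_on (dom i) f ->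
  `[a, b] `<=` dom i -> W12_on a b f (fun t => derive1 f t).
Proof.
move=> fs sub k.
have cf : {within `[a, b], continuous (fun t => derive1 f t 0 k)}.
  apply: within_continuous_pointwise => t tab; apply: differentiable_continuous.
  apply: differentiable_coord_comp.
  exact: (smooth_on_differentiable (smooth_on_derive1 fs) (sub t tab)).
have [m1 m2] := L2_continuous cf; split => // t; rewrite in_itv /= => /andP[at_ tb].
have subt : `[a, t] `<=` `[a, b].
  by move=> s /=; rewrite !in_itv /= => /andP[-> st]; exact: le_trans tb.
have dF s : s \in `[a, t] -> is_derive s 1 (fun s => f s 0 k) (derive1 f s 0 k).
  move=> sat; have df := smooth_on_differentiable fs (sub s (subt s sat)).
  split; last by rewrite derive1E -derive_coord.
  exact: diff_derivable (differentiable_coord_comp 0 k df).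
have E := Rintegral_FTC at_ dF (continuous_subspaceW subt cf).
by rewrite E addrC subrK.
Qed.

(** A smooth field is a Sobolev field, represented with its covariant
    derivative. *)
Lemma smooth_field_W12 xi : smooth_field c xi -> W12_field c G setT xi (covD c G xi).
Proof.
move=> xS; split=> [t _|i a b _ sub].
  exact: (conj (xS.1 t) (covD_tangent D_metric t xS)).
apply: W12_on_eq (smooth_W12_on (xS.2 i) sub) => t tab.
by rewrite (covDE G xi (sub t tab)) addrK.
Qed.

(** Integration by parts for a solution of the variational system: (D xi, xi) is
    a primitive of the density. *)
Lemma solution_index_form xi : smooth_field c xi ->
  (forall t, covD c G (covD c G xi) t = mx_apply U t (xi t)) ->
  \int[mu]_(t in `[0, tau]) quad_density L c U xi (covD c G xi) t =
  metric L c tau (covD c G xi tau) (xi tau) - metric L c 0 (covD c G xi 0) (xi 0).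
Proof.
move=> xS sol; have dS := covD_smooth c_smooth D_metric xS.
have [_ _ DM] := D_metric.
apply: (Rintegral_FTC (F := fun s => metric L c s (covD c G xi s) (xi s)) (ltW tau_gt0)).
  move=> t _; have df := metric_fields_differentiable L_smooth c_smooth t dS xS.
  split; first exact: diff_derivable.
  rewrite -derive1E (DM _ _ dS xS t) sol /quad_density.
  exact: addrC.
apply: within_continuous_pointwise => t _.
exact: (index_density_continuous L_smooth c_smooth D_metric U_symmetric xS xS).
Qed.

(** At the end point 0 the covariant derivative vanishes by continuity. *)
Lemma covD_eq0_right xi : smooth_field c xi -> (forall t, t \in `[0, tau] -> xi t = 0) ->
  covD c G xi 0 = 0.
Proof.
move=> xS x0; have dS := covD_smooth c_smooth D_metric xS.
have d0 t : 0 < t < tau -> covD c G xi t = 0.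
  move=> ht; apply: covD_eq0 => //.
  have : \forall s \near t, s \in `]0, tau[ by exact: near_in_itvoo.
  by apply: filterS => s /subset_itv_oo_cc /x0.
apply/funext => i; have [it|it] := pselect (dom i 0); last first.
  exact: (tangent_out (dS.1 0) it).
apply/rowP => k; rewrite [RHS]mxE; apply/eqP/negPn/negP => ne.
pose f t := covD c G xi t i 0 k.
have cf : {for 0, continuous f}.
  apply: differentiable_continuous; apply: differentiable_coord_comp.
  exact: (smooth_on_differentiable (dS.2 i) it).
have Hn : \forall t \near (0 : R), f t != 0.
  exact: (cf [set x : R | x != 0] (open_nbhs_nbhs (conj (@open_neq R 0) ne))).
have [d /= dgt0 Hd] : exists2 d : R, 0 < d & forall t, `|0 - t| < d -> f t != 0.
  by have /nbhs_normP[d dgt0 Hd] := Hn; exists d => // t; exact: Hd.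
pose s := Num.min d tau / 2.
have m0 : 0 < Num.min d tau by rewrite lt_min dgt0.
have s0 : 0 < s by rewrite divr_gt0.
have sm : s < Num.min d tau by rewrite ltr_pdivrMr // ltr_pMr // ltr1n.
have sd : s < d by apply: (lt_le_trans sm); rewrite ge_min lexx.
have st : s < tau by apply: (lt_le_trans sm); rewrite ge_min lexx orbT.
have /negP : f s != 0 by apply: Hd => /=; rewrite sub0r normrN gtr0_norm.
by apply; rewrite /f d0 ?s0 //; apply/eqP; exact: mxE.
Qed.

(** Multiplication of both arguments by a + i b multiplies the real part of the
    Hermitian extension of the metric by a^2 + b^2. *)
Lemma metric_rotation t (a b : R) (x1 x2 y1 y2 : tvec M) :
  tangent (c t) x1 -> tangent (c t) x2 -> tangent (c t) y1 -> tangent (c t) y2 ->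
  metric L c t (a *: x1 - b *: x2) (a *: y1 - b *: y2) +
  metric L c t (a *: x2 + b *: x1) (a *: y2 + b *: y1) =
  (a ^+ 2 + b ^+ 2) * (metric L c t x1 y1 + metric L c t x2 y2).
Proof.
have [i it] := cdom_cover (c t) => X1 X2 Y1 Y2.
rewrite -(scaleNr b x2) -(scaleNr b y2).
rewrite (metric_chart L_smooth c_smooth it (tangent_lin a (- b) X1 X2) (tangent_lin a (- b) Y1 Y2)).
rewrite (metric_chart L_smooth c_smooth it (tangent_lin a b X2 X1) (tangent_lin a b Y2 Y1)).
rewrite (metric_chart L_smooth c_smooth it X1 Y1) (metric_chart L_smooth c_smooth it X2 Y2).
have E (e f : R) (u w : tvec M) : (e *: u + f *: w) i = e *: u i + f *: w i by [].
rewrite !E.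
move: (gram L c i t) (x1 i) (x2 i) (y1 i) (y2 i) => H z1 z2 w1 w2.
rewrite !(bformDl, bformDr, bformZl, bformZr); ring.
Qed.

End Solutions.

Section Conclusion.
Context {R : realType} {n : nat} {M : smooth_manifold R n}.
Variables (L : lagrangian M) (c : R -> M) (tau : R) (G U : mx_family M).
Hypothesis tau_gt0 : 0 < tau.
Hypothesis L_smooth : smooth_lagrangian L.
Hypothesis L_periodic : periodic_lagrangian L tau.
Hypothesis c_smooth : smooth_into setT c.
Hypothesis c_periodic : forall t, c (t + tau) = c t.
Hypothesis D_metric : metric_connection L c tau G.
Hypothesis U_symmetric : symmetric_endomorphism L c tau U.

Local Notation mu := (@lebesgue_measure R).
Local Notation Q xi zeta := (\int[mu]_(t in `[0, tau]) quad_density L c U xi zeta t).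

Hypothesis index_ge0 : forall xi zeta, W12_field c G setT xi zeta -> 0 <= Q xi zeta.
Hypothesis index_gt0 : forall xi zeta t, W12_field c G setT xi zeta ->
  t \in `[0, tau] -> xi t <> 0 -> 0 < Q xi zeta.

(** The vanishing of a field with [xi (t + tau) = rho xi t] is a periodic
    condition. *)
Lemma quasiperiodic_neq0 (rho : R[i]) (xi : R -> ctvec M) s : `|rho| = 1 :> R[i] ->
  (forall t, xi (t + tau) = Defs.cscale rho (xi t)) -> xi s <> (0, 0) ->
  exists2 t, t \in `[0, tau] & xi t <> (0, 0).
Proof.
move=> rho1 xiP xs.
have fP t : (xi (t + tau) = (0, 0)) = (xi t = (0, 0)).
  apply/propext; rewrite xiP; split=> [|->]; first exact: cscale_eq0.
  by case: (rho) => a b; rewrite /Defs.cscale /= !scaler0 subr0 addr0.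
have [k /andP[k0 k1]] := modulo_period 0 s tau_gt0.
exists (s + tau *~ k); first by rewrite in_itv /= k0 -[tau in leRHS]add0r ltW.
by rewrite (periodic_int (f := fun t => xi t = (0, 0)) k fP s).
Qed.

Lemma complexD_diag (p q r s u v x y : R) : u = v -> x = y ->
  ((p + q) +i* (u - v)) + ((r + s) +i* (x - y)) = ((p + r) + (q + s)) +i* 0.
Proof.
by move=> -> ->; rewrite !subrr; apply: (f_equal2 (@Complex R)); [exact: addrACA|exact: addr0].
Qed.

(** The imaginary part vanishes by symmetry of the metric and of the potential. *)
Lemma h_form_diag (xi zeta : R -> ctvec M) :
  W12_field c G setT (fun t => (xi t).1) (fun t => (zeta t).1) ->
  W12_field c G setT (fun t => (xi t).2) (fun t => (zeta t).2) ->
  h_form L c tau U xi zeta xi zeta =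
  (Q (fun t => (xi t).1) (fun t => (zeta t).1) +
   Q (fun t => (xi t).2) (fun t => (zeta t).2)) +i* 0.
Proof.
move=> W1 W2; have [_ UT Usym] := U_symmetric; rewrite /h_form /cintegral.
pose q1 := quad_density L c U (fun t => (xi t).1) (fun t => (zeta t).1).
pose q2 := quad_density L c U (fun t => (xi t).2) (fun t => (zeta t).2).
have I1 := quad_density_integrable L_smooth c_smooth D_metric U_symmetric
  (W12_field_sub (J' := `[0, tau]) (fun t _ => I) W1).
have I2 := quad_density_integrable L_smooth c_smooth D_metric U_symmetric
  (W12_field_sub (J' := `[0, tau]) (fun t _ => I) W2).
have H t : herm_metric L c t (zeta t) (zeta t) + herm_metric L c t (cmx_apply U t (xi t)) (xi t) =
    (q1 t + q2 t) +i* 0.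
  have [x1 z1] := W1.1 t I; have [x2 z2] := W2.1 t I.
  have e1 := metricC L_smooth c_smooth z2 z1.
  have e2 := metricC L_smooth c_smooth (UT t _ x1) x2.
  exact: (complexD_diag _ _ _ _ e1 (etrans (Usym t _ _ x2 x1) (esym e2))).
apply: (f_equal2 (@Complex R)).
  have E := @RintegralD _ _ _ mu `[0, tau] _ _ (measurable_itv _) I1 I2.
  apply: (etrans _ E); apply: eq_Rintegral => t _.
  exact: (congr1 (@complex.Re R) (H t)).
apply: (@etrans _ _ (\int[mu]_(t in `[0, tau]) cst (0 : R) t)).
  by apply: eq_Rintegral => t _; exact: (congr1 (@complex.Im R) (H t)).
by rewrite Rintegral_cst ?mul0r //; exact: measurable_itv.
Qed.

Lemma h_form_gt0 (rho : R[i]) : `|rho| = 1 :> R[i] -> h_positive_definite L c tau G U rho.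
Proof.
move=> rho1 xi zeta [W1 W2 xiP] [s xs].
have [t tt xt] := quasiperiodic_neq0 rho1 xiP xs.
rewrite (h_form_diag W1 W2) ltcE /= eqxx /=.
have [x1|x1] := pselect ((xi t).1 = 0); last first.
  exact: (ltr_pwDl (index_gt0 W1 tt x1) (index_ge0 W2)).
have x2 : (xi t).2 <> 0.
  by move=> x2; apply: xt; rewrite (surjective_pairing (xi t)) x1 x2.
exact: (ltr_wpDl (index_ge0 W1) (index_gt0 W2 tt x2)).
Qed.

Lemma multiplier_neq1 (rho : R[i]) : multiplier c tau G U rho -> `|rho| <> 1 :> R[i].
Proof.
case: rho => a b [p p0 [xi [[xS1 xS2 sol] pE qE]]] /normc_eq1 ab1.
pose x1 t := (xi t).1; pose x2 t := (xi t).2.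
have sol1 t : covD c G (covD c G x1) t = mx_apply U t (x1 t) by exact: (congr1 fst (sol t)).
have sol2 t : covD c G (covD c G x2) t = mx_apply U t (x2 t) by exact: (congr1 snd (sol t)).
have W1 := smooth_field_W12 D_metric xS1.
have W2 := smooth_field_W12 D_metric xS2.
have Q1 := solution_index_form tau_gt0 L_smooth c_smooth D_metric U_symmetric xS1 sol1.
have Q2 := solution_index_form tau_gt0 L_smooth c_smooth D_metric U_symmetric xS2 sol2.
have e1 : x1 tau = a *: x1 0 - b *: x2 0 by have := congr1 (fun r => r.1.1) qE; rewrite pE => /esym.
have e2 : x2 tau = a *: x2 0 + b *: x1 0 by have := congr1 (fun r => r.1.2) qE; rewrite pE => /esym.
have d1 : covD c G x1 tau = a *: covD c G x1 0 - b *: covD c G x2 0.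
  by have := congr1 (fun r => r.2.1) qE; rewrite pE => /esym.
have d2 : covD c G x2 tau = a *: covD c G x2 0 + b *: covD c G x1 0.
  by have := congr1 (fun r => r.2.2) qE; rewrite pE => /esym.
have T1 t : tangent (c t) (covD c G x1 t) by exact: (covD_tangent D_metric t xS1).
have T2 t : tangent (c t) (covD c G x2 t) by exact: (covD_tangent D_metric t xS2).
have mt u w : tangent (c tau) u -> tangent (c tau) w -> metric L c tau u w = metric L c 0 u w.
  have ct : c tau = c 0 by rewrite -[LHS](congr1 c (add0r tau)) c_periodic.
  rewrite ct => uT wT; rewrite -[LHS](congr1 (fun s => metric L c s u w) (add0r tau)).
  exact: (metricP L_periodic c_smooth c_periodic uT wT).
(* The boundary terms at tau and 0 are equal, since |rho| = 1. *)
have Q0 : Q x1 (covD c G x1) + Q x2 (covD c G x2) = 0.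
  have m1 := mt _ _ (T1 tau) (xS1.1 tau); have m2 := mt _ _ (T2 tau) (xS2.1 tau).
  have E := metric_rotation L_smooth c_smooth a b (T1 0) (T2 0) (xS1.1 0) (xS2.1 0).
  have E' : metric L c tau (covD c G x1 tau) (x1 tau) + metric L c tau (covD c G x2 tau) (x2 tau) =
      metric L c 0 (covD c G x1 0) (x1 0) + metric L c 0 (covD c G x2 0) (x2 0).
    have f1 := f_equal2 (metric L c 0) d1 e1; have f2 := f_equal2 (metric L c 0) d2 e2.
    apply: (etrans (f_equal2 +%R (etrans m1 f1) (etrans m2 f2))).
    by apply: (etrans E); rewrite ab1; exact: mul1r.
  apply: (etrans (f_equal2 +%R Q1 Q2)).
  move: E'; move: (metric L c tau _ _) (metric L c tau _ _) (metric L c 0 _ _) (metric L c 0 _ _).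
  by move=> r1 r2 r3 r4 E'; rewrite addrACA E' -opprD subrr.
have z1 t : t \in `[0, tau] -> x1 t = 0.
  move=> tt; apply: contrapT => xt.
  by have := ltr_pwDl (index_gt0 W1 tt xt) (index_ge0 W2); rewrite Q0 ltxx.
have z2 t : t \in `[0, tau] -> x2 t = 0.
  move=> tt; apply: contrapT => xt.
  by have := ltr_wpDl (index_ge0 W1) (index_gt0 W2 tt xt); rewrite Q0 ltxx.
have i0 : (0 : R) \in `[0, tau] by rewrite in_itv /= lexx ltW.
(* The solution vanishes on the period, and so do its initial data, against the
   choice of the eigenvector. *)
apply: p0; rewrite pE (surjective_pairing (xi 0)) /ccovD.
rewrite -/(x1 0) -/(x2 0) (z1 0 i0) (z2 0 i0).
rewrite (covD_eq0_right tau_gt0 c_smooth D_metric xS1 z1).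
by rewrite (covD_eq0_right tau_gt0 c_smooth D_metric xS2 z2).
Qed.

End Conclusion.

Unset Implicit Arguments.

Theorem proposition7p2 (R : realType) (n : nat) (M : smooth_manifold R n)
    (L : lagrangian M) (T tau : R) (gamma : R -> M) (G U : mx_family M)
    (T_gt0 : 0 < T) (tauE : tau = 2 * T)
    (L_smooth : smooth_lagrangian L) (L_convex : fibrewise_convex L)
    (L_periodic : periodic_lagrangian L tau)
    (L_reversible : reversible_lagrangian L)
    (gamma_trajectory : trajectory L gamma)
    (gamma_periodic : forall t, gamma (t + tau) = gamma t)
    (gamma_reversible : forall t, gamma (- t) = gamma t)
    (D_metric : metric_connection L gamma tau G)
    (U_symmetric : symmetric_endomorphism L gamma tau U)
    (DU_second_variation : represents_second_variation L gamma tau G U)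
    (gamma_minimum : nondegenerate_minimum L gamma T G U) :
  (forall rho : R[i], `|rho| = 1 ->
     h_positive_definite L gamma tau G U rho) /\
  (forall rho : R[i], multiplier gamma tau G U rho -> `|rho| <> 1).
Proof.
have tau_gt0 : 0 < tau by rewrite tauE mulr_gt0.
have [c_smooth _] := gamma_trajectory.
have parity i t := @connection_odd_potential_even _ _ _ _ _ _ _ _ tau_gt0 L_smooth L_convex
  L_periodic L_reversible c_smooth gamma_periodic gamma_reversible D_metric U_symmetric
  DU_second_variation i t.
have ge0 := @index_form_ge0 _ _ _ _ _ _ _ _ _ T_gt0 tauE L_smooth L_convex L_periodic
  L_reversible c_smooth gamma_periodic gamma_reversible D_metric U_symmetric parity
  gamma_minimum.
have gt0 := @index_form_gt0 _ _ _ _ _ _ _ _ _ T_gt0 tauE L_smooth L_convex L_periodic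
  L_reversible c_smooth gamma_periodic gamma_reversible D_metric U_symmetric parity
  gamma_minimum.
split=> rho.
  exact: (h_form_gt0 tau_gt0 L_smooth c_smooth D_metric U_symmetric ge0 gt0).
exact: (multiplier_neq1 tau_gt0 L_smooth L_periodic c_smooth gamma_periodic D_metric
  U_symmetric ge0 gt0).
Qed.
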